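(* Let $d,l$ be natural numbers. For any non-zero locally finite $\mathbb{C}^l$-valued charge $\mu$ on $\mathbb{R}^d$ and any $\varepsilon>0$ there exist $x\in\operatorname{supp}\mu$, $a\in\mathbb{C}^l\setminus\{0\}$, and a non-zero (scalar, non-negative, locally finite) measure $\nu$ on $\mathbb{R}^d$ such that 1) $a\otimes\nu\in\operatorname{Tan}[\mu,x]$; 2) $\underline{\dim}_{\mathrm{H}}\,\nu(0)\le\underline{\dim}_{\mathrm{H}}\,\mu+\varepsilon$, where $\underline{\dim}_{\mathrm{H}}\,\nu(0)$ is the local lower Hausdorff dimension of $\nu$ at $0$; 3) $\nu\in\mathcal{S}'(\mathbb{R}^d)$; 4) furthermore, if $\mu\in\mathcal{S}'(\mathbb{R}^d,\mathbb{C}^l)$, then $a\otimes\nu$ is tangent to $\mu$ in the Schwartz sense, i.e. $c_jT_{x,r_j}[\mu]\to a\otimes\nu$ in $\mathcal{S}'(\mathbb{R}^d,\mathbb{C}^l)$ for some sequences $c_j>0$ and $r_j\searrow 0$.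
   Context: Measures are scalar and non-negative; charges are countably additive Borel set functions that may be $\mathbb{R}$-, $\mathbb{C}$- or $\mathbb{C}^l$-valued; a charge $\mu$ is locally finite if its total variation $|\mu|$ is finite on bounded sets, and $\operatorname{supp}\mu=\operatorname{supp}|\mu|$. For $a\in\mathbb{C}^l$ and a scalar measure $\nu$, $a\otimes\nu$ is the charge $(a\otimes\nu)(B)=\nu(B)a$. Lower Hausdorff dimension: $\underline{\dim}_{\mathrm{H}}\,\mu=\inf\{\alpha : \text{there exists a Borel set } F \text{ with } \dim_{\mathrm{H}}F\le\alpha \text{ and } \mu(F)\ne0\}$ (for a locally finite charge, $F$ is taken bounded so that $\mu(F)$ is defined). Local lower Hausdorff dimension: $\underline{\dim}_{\mathrm{H}}\,\mu(x)=\liminf_{r\to0}\dfrac{\log|\mu|(B_r(x))}{\log r}$ for $x\in\operatorname{supp}\mu$, where $B_r(x)$ is the closed Euclidean ball (in particular, assertion 2 includes $0\in\operatorname{supp}\nu$). Dilations: $T_{x,r}[\mu](B)=\mu(x+rB)$ for Borel $B$, equivalently $\int f\,dT_{x,r}[\mu]=\int f(r^{-1}(y-x))\,d\mu(y)$. The tangent cone $\operatorname{Tan}[\mu,x]$ (in Preiss's sense) is the set of all non-zero locally finite charges $\lambda$ for which there are $c_j>0$ and $r_j\searrow0$ with $c_jT_{x,r_j}[\mu]\to\lambda$ in the weak-* sense on compact sets, i.e. when tested against every continuous compactly supported function. $\mathcal{S}'(\mathbb{R}^d)$ and $\mathcal{S}'(\mathbb{R}^d,\mathbb{C}^l)$ are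 the spaces of (scalar and $\mathbb{C}^l$-valued) Schwartz tempered distributions. A locally finite measure $\nu$ belongs to $\mathcal{S}'(\mathbb{R}^d)$ if and only if there is $N\in\mathbb{N}$ and $C$ with $\nu(B_R(0))\le CR^N$ for all $R\ge1$. *)

(* Defs.v *)
(* Charges on R^d, their dimensions, tangent charges and tempered distributions,
   on top of MathComp-Analysis; C is [R[i]] (real-closed). *)
From HB Require Import structures.
From mathcomp Require Import all_boot all_order all_algebra.
From mathcomp Require Import complex.
From mathcomp Require Import all_classical all_reals all_analysis.

Set Implicit Arguments.
Unset Strict Implicit.
Unset Printing Implicit Defensive.

Import Order.TTheory GRing.Theory Num.Theory.
Import numFieldNormedType.Exports.

Local Open Scope classical_set_scope.
Local Open Scope ring_scope.

(* ['rV[R]_d] with its Borel sigma-algebra.  The topology of ['rV[R]_d] comes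
   from the max norm; it is the Euclidean topology, with the same bounded sets. *)
Definition borelRd (R : realType) (d : nat) :=
  g_sigma_algebraType (@open 'rV[R]_d).

Section Euclidean.
Context {R : realType}.
Local Notation C := R[i].

Definition enorm d (x : 'rV[R]_d) : R := Num.sqrt (\sum_i x 0 i ^+ 2).

Definition eball d (x : 'rV[R]_d) (r : R) : set 'rV[R]_d :=
  [set y | enorm (y - x) <= r].

Definition cnorm l (v : 'rV[C]_l) : R :=
  Num.sqrt (\sum_k Normc.normc (v 0 k) ^+ 2).

Definition cvgC l (u : nat -> 'rV[C]_l) (v : 'rV[C]_l) : Prop :=
  (fun n => cnorm (u n - v)) @ \oo --> (0 : R).

Definition bounded_borel d (A : set 'rV[R]_d) : Prop :=
  (measurable : set (set (borelRd R d))) A /\ bounded_set A.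

End Euclidean.

Section Hausdorff.
Context {R : realType} {d : nat}.
Implicit Types (A : set 'rV[R]_d) (s delta : R).
Local Open Scope ereal_scope.

Definition ediam A : \bar R :=
  ereal_sup [set z | exists x y, [/\ A x, A y & z = (enorm (x - y)%R)%:E]].

(* Empty pieces are skipped, so that the measure of exponent 0 is the
   counting measure ([x `^ 0 = 1] for every [x]). *)
Definition hausdorff_content s delta A : \bar R :=
  ereal_inf [set \sum_(0 <= i <oo | U i != set0) poweR (ediam (U i)) s |
    U in [set U : nat -> set 'rV[R]_d |
      A `<=` \bigcup_i U i /\ forall i, ediam (U i) <= delta%:E]].

Definition hausdorff_measure s A : \bar R :=
  ereal_sup [set hausdorff_content s delta A |
    delta in [set delta : R | (0 < delta)%R]].

Definition hausdorff_dim A : \bar R :=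
  ereal_inf [set s%:E |
    s in [set s : R | (0 <= s)%R /\ hausdorff_measure s A = 0]].

End Hausdorff.

(* A locally finite charge is a set function of which only the values on
   bounded Borel sets matter. *)
Section Charges.
Context {R : realType} {d : nat}.
Local Notation C := R[i].
Local Notation E := 'rV[R]_d.

(* Total variation; finite partitions of subsets of [A] into bounded Borel
   pieces give the same supremum as countable Borel partitions of [A]. *)
Definition tvar l (mu : set E -> 'rV[C]_l) (A : set E) : \bar R :=
  ereal_sup [set z | exists (n : nat) (F : 'I_n -> set E),
    [/\ forall i, bounded_borel (F i), forall i, F i `<=` A,
        trivIset setT F & z = (\sum_i cnorm (mu (F i)))%:E]].

Definition lf_charge l (mu : set E -> 'rV[C]_l) : Prop :=
  (forall F : nat -> set E,
     (forall i, bounded_borel (F i)) -> trivIset setT F ->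
     bounded_set (\bigcup_i F i) ->
     cvgC (fun n => \sum_(i < n) mu (F i)) (mu (\bigcup_i F i))) /\
  (forall B, bounded_borel B -> (tvar mu B < +oo)%E).

Definition charge_neq0 l (mu : set E -> 'rV[C]_l) : Prop :=
  exists B, bounded_borel B /\ mu B <> 0.

Definition lf_measure (nu : {measure set (borelRd R d) -> \bar R}) : Prop :=
  forall B, bounded_borel B -> (nu B < +oo)%E.

Definition tensor l (a : 'rV[C]_l) (nu : {measure set (borelRd R d) -> \bar R})
    : set E -> 'rV[C]_l :=
  fun B => (real_complex R (fine (nu B))) *: a.

Definition supp (m : set E -> \bar R) : set E :=
  [set x | forall U : set E, open U -> U x -> (0 < m U)%E].

Definition dimH l (mu : set E -> 'rV[C]_l) : \bar R :=
  ereal_inf [set alpha%:E | alpha in [set alpha : R | exists F : set E,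
    [/\ bounded_borel F, (hausdorff_dim F <= alpha%:E)%E & mu F <> 0]]].

(* Here [m] is [|mu|], or a measure. *)
Definition local_dimH (m : set E -> \bar R) (x : E) : \bar R :=
  limf_einf (fun r : R => (ln (fine (m (eball x r))) / ln r)%:E) 0^'+.

Definition dilation l (mu : set E -> 'rV[C]_l) (x : E) (r : R)
    : set E -> 'rV[C]_l :=
  fun B => mu [set x + r *: y | y in B].

(* Integral of a compactly supported function against a locally finite charge:
   each real component [sigma] of the charge is split into its upper variations
   [upvar sigma] and [upvar (- sigma)], the Jordan decomposition of [sigma]. *)
Definition upvar (sigma : set E -> R) (A : set E) : \bar R :=
  ereal_sup [set (sigma B)%:E |
    B in [set B : set E | bounded_borel B /\ B `<=` A]].

Definition rint (f : E -> R) (sigma : set E -> R) : R :=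
  fine (@integral _ (borelRd R d) R (upvar sigma) setT (EFin \o f)) -
  fine (@integral _ (borelRd R d) R (upvar (fun B => - sigma B)) setT
         (EFin \o f)).

Definition cint l (f : E -> C) (mu : set E -> 'rV[C]_l) : 'rV[C]_l :=
  let ref x := complex.Re (f x) in
  let imf x := complex.Im (f x) in
  \row_k
    let rem B := complex.Re (mu B 0 k) in
    let imm B := complex.Im (mu B 0 k) in
    Complex (rint ref rem - rint imf imm) (rint ref imm + rint imf rem).

Definition compact_supp (f : E -> C) : Prop :=
  compact (closure [set x | f x <> 0]).

Definition test_continuous (f : E -> C) : Prop :=
  [/\ continuous (fun x => complex.Re (f x)),
      continuous (fun x => complex.Im (f x)) & compact_supp f].

Definition blowup l (mu : set E -> 'rV[C]_l) (x : E) (c r : nat -> R) (j : nat)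
    : set E -> 'rV[C]_l :=
  fun B => (real_complex R (c j)) *: dilation mu x (r j) B.

Definition blowup_seqs (c r : nat -> R) : Prop :=
  [/\ forall j, 0 < c j, forall j, 0 < r j, decreasing_seq r &
      r @ \oo --> (0 : R)].

Definition Tan l (mu : set E -> 'rV[C]_l) (x : E) : set (set E -> 'rV[C]_l) :=
  [set lam | [/\ lf_charge lam, charge_neq0 lam &
    exists c r, blowup_seqs c r /\
      forall f, test_continuous f ->
        cvgC (fun j => cint f (blowup mu x c r j)) (cint f lam)]].

End Charges.

Section Tempered.
Context {R : realType} {d : nat}.
Local Notation C := R[i].
Local Notation E := 'rV[R]_d.

Definition partial (s : seq 'I_d) (f : E -> R) : E -> R :=
  foldr (fun i g => fun x => 'D_(delta_mx 0 i : E) g x) f s.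

Definition smooth (f : E -> R) : Prop :=
  forall s, continuous (partial s f) /\
    forall i x, derivable (partial s f) x (delta_mx 0 i : E).

Definition csmooth (phi : E -> C) : Prop :=
  smooth (fun x => complex.Re (phi x)) /\ smooth (fun x => complex.Im (phi x)).

Definition cpartial (s : seq 'I_d) (phi : E -> C) (x : E) : C :=
  Complex (partial s (fun y => complex.Re (phi y)) x)
          (partial s (fun y => complex.Im (phi y)) x).

Definition schwartz_norm (N : nat) (phi : E -> C) : \bar R :=
  ereal_sup [set z | exists (s : seq 'I_d) (x : E), (size s <= N)%N /\
    z = ((1 + enorm x) ^+ N * Normc.normc (cpartial s phi x))%:E].

Definition schwartz (phi : E -> C) : Prop :=
  csmooth phi /\ forall N, (schwartz_norm N phi < +oo)%E.

(* Only the values of [T] on Schwartz functions matter. *)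
Definition tempered_distribution l (T : (E -> C) -> 'rV[C]_l) : Prop :=
  (forall (a : C) phi psi, schwartz phi -> schwartz psi ->
     T (fun x => a * phi x + psi x) = a *: T phi + T psi) /\
  exists (N : nat) (K : R), forall phi, schwartz phi ->
    ((cnorm (T phi))%:E <= K%:E * schwartz_norm N phi)%E.

(* The tempered distribution [T] extends the distribution defined by [mu].
   It is unique on Schwartz functions, since smooth compactly supported
   functions are dense; [phi] need not be [|mu|]-integrable for Schwartz [phi]. *)
Definition represents l (T : (E -> C) -> 'rV[C]_l) (mu : set E -> 'rV[C]_l)
    : Prop :=
  tempered_distribution T /\
  forall phi, csmooth phi -> compact_supp phi -> T phi = cint phi mu.

Definition tempered l (mu : set E -> 'rV[C]_l) : Prop :=
  exists T, represents T mu.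

(* For sequences, weak-* convergence in S' is the same as strong convergence. *)
Definition cvg_tempered l (mu_ : nat -> set E -> 'rV[C]_l)
    (lam : set E -> 'rV[C]_l) : Prop :=
  exists (T_ : nat -> (E -> C) -> 'rV[C]_l) (T : (E -> C) -> 'rV[C]_l),
    [/\ forall j, represents (T_ j) (mu_ j), represents T lam &
        forall phi, schwartz phi -> cvgC (fun j => T_ j phi) (T phi)].

(* A scalar measure is read as the C^1-valued charge [1 (x) nu]. *)
Definition tempered_measure (nu : {measure set (borelRd R d) -> \bar R})
    : Prop :=
  tempered (tensor (const_mx 1 : 'rV[C]_1) nu).

End Tempered.

(* Main.v *)
From HB Require Import structures.
Require Import Defs.
From mathcomp Require Import all_boot all_order all_algebra.
From mathcomp Require Import complex.
From mathcomp Require Import all_classical all_reals all_analysis.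
From mathcomp Require Import measurable_realfun.
From mathcomp Require Import ring lra zify.

Set Implicit Arguments.
Unset Strict Implicit.
Unset Printing Implicit Defensive.

Import Order.TTheory GRing.Theory Num.Theory.
Import numFieldNormedType.Exports.

Local Open Scope classical_set_scope.
Local Open Scope ring_scope.

(** Fix an exponent slightly above the lower dimension of the charge and a bounded
    Borel set [F] that is charged although its Hausdorff measure of that exponent
    vanishes.  Let [m] be a measure that dominates the upper variations of all real
    and imaginary components of the charge, restricted to a window around [F].
    Covering [F] economically shows that at [m]-almost every point of [F] the masses
    of dyadic balls of radius [r] exceed [r `^ a] for arbitrarily small [r]
    ([mass_distribution]).

    Such a bound along some scales does not survive a blow-up by itself, so the
    scales are selected once more.  The negative logarithms of the masses of the
    concentric dyadic balls form a nondecreasing sequence that is infinitely often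
    below a line of slope [a].  A counting argument in the style of Pliss's lemma then
    yields indices after which the sequence rises with slope at most [c], for any
    [c > a], along a long stretch, and before which its slope never exceeds a constant
    ([good_scales]).  For the measure this means: from the chosen scale downwards balls
    lose mass no faster than [r `^ c], and upwards mass grows at most polynomially.

    The polynomial growth is uniform along the scales and is used four times.  It
    makes the normalised blow-ups of [m] precompact for the vague topology
    ([vague_compactness], through the Riesz representation theorem), it makes the
    limit [nu] a tempered measure ([decay_integral], [measure_distribution]), it
    controls the tails of Schwartz functions uniformly along the blow-ups
    ([density_limit]), and it is a doubling condition.  Because of the latter the
    elementary covering lemma of Vitali suffices to prove that almost every point is a
    Lebesgue point along the chosen scales for the densities of the components with
    respect to [m] ([doubling_lebesgue_point]).  At such a point the charge looks like
    its own density at that point times [m], so its blow-ups converge to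
    [a (x) nu], where [a] collects the values of the densities
    ([density_blowup]); since [F] is charged, the point can be taken with [a <> 0].
    The lower bound on the masses of small balls passes to [nu] and bounds its local
    dimension at the origin ([local_dimH_le]).

    Convergence in the Schwartz sense requires an argument beyond test functions of
    compact support, since Schwartz functions need not be integrable against the
    charge.  The tempered distribution of the charge is tested on a Schwartz function
    rescaled to size [r] around the point.  A fixed cut-off splits that function.  The
    inner part has compact support, and the blow-ups act on it as on a function of fast
    decay.  The outer part lives at a fixed distance from the point, where the rescaled
    function is smaller than any power of [r] in every Schwartz norm
    ([schwartz_away]), while the normalising constants grow polynomially in [1 / r]
    ([cvg_tempered_of_limit]). *)

(** * Dyadic scales, balls and continuous test functions *)

Section DyadicPowers.
Context {R : realType}.

Lemma exp2N_lt (e : R) : 0 < e -> exists n : nat, 2 ^- n < e.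
Proof.
move=> e0; have := @cvg_expr R (2^-1); rewrite gtr0_norm ?invr_gt0// invf_lt1// ltr1n.
move=> /(_ isT) /cvgrPdist_lt /(_ e e0)[n _ hn].
exists n; have := hn n (leqnn n).
by rewrite sub0r normrN exprVn ger0_norm// invr_ge0 exprn_ge0.
Qed.

Lemma exp2N_gt0 n : 0 < 2 ^- n :> R.
Proof. by rewrite invr_gt0 exprn_gt0. Qed.

Lemma exp2N_le k n : (k <= n)%N -> 2 ^- n <= 2 ^- k :> R.
Proof. by move=> kn; rewrite lef_pV2 ?posrE ?exprn_gt0// ler_weXn2l// ler1n. Qed.

End DyadicPowers.

Section Basics.
Context {R : realType} {d : nat}.
Local Notation E := 'rV[R]_d.
Local Notation BE := (borelRd R d).
Implicit Types (m : {measure set BE -> \bar R}) (x y : E) (r : R).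

Lemma exists_measure (f : set BE -> \bar R) :
  f set0 = 0%E -> (forall A, (0 <= f A)%E) -> semi_sigma_additive f ->
  exists m : {measure set BE -> \bar R}, (m : set BE -> \bar R) = f.
Proof.
move=> f0 fge0 fadd.
pose M := isMeasure.Build _ BE R f f0 fge0 fadd.
by exists (HB.pack f M : {measure set BE -> \bar R}).
Qed.

Lemma open_borel (A : set E) : open A -> measurable (A : set BE).
Proof. exact: sub_sigma_algebra. Qed.

Lemma closed_borel (A : set E) : closed A -> measurable (A : set BE).
Proof.
move=> cA; rewrite -(setCK A).
by apply: (@measurableC _ BE); apply: open_borel; exact: closed_openC.
Qed.

Lemma continuous_borel (f : E -> R) :
  continuous f -> measurable_fun [set: BE] (f : BE -> R).
Proof.
move=> cf; apply: (measurability _ (RGenOpens.measurableE R)).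
move=> _ [_ [a [b ->]] <-]; rewrite setTI.
by apply: open_borel; apply: open_comp => //; exact: interval_open.
Qed.

Definition cball x r : set E := [set y | `|y - x| <= r].

Lemma closed_cball x r : closed (cball x r).
Proof.
have -> : cball x r = (fun y => `|y - x|) @^-1` [set t | t <= r] by [].
apply: closed_comp; last exact: closed_le.
move=> y _; apply: continuous_comp; last exact: norm_continuous.
by apply: continuousB; [exact: cvg_id|exact: cst_continuous].
Qed.

Lemma compact_cball x r : compact (cball x r).
Proof.
apply: bounded_closed_compact; last exact: closed_cball.
exists (`|x| + r); split; first exact: num_real.
move=> M ltM y /= yx; apply: ltW; apply: le_lt_trans ltM.
by rewrite -[y](subrK x) addrC (le_trans (ler_normD _ _))// lerD2l.
Qed.

Lemma measurable_cball x r : measurable (cball x r : set BE).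
Proof. by apply: closed_borel; exact: closed_cball. Qed.

Lemma sub_cball x r y s : `|x - y| + r <= s -> cball x r `<=` cball y s.
Proof.
move=> h z zx; apply: le_trans h.
by rewrite -[z](subrK x) -addrA addrC (le_trans (ler_normD _ _))// lerD2l.
Qed.

Lemma le_cball x r s : r <= s -> cball x r `<=` cball x s.
Proof. by move=> rs; apply: sub_cball; rewrite subrr normr0 add0r. Qed.

Lemma bounded_cball (A : set E) : bounded_set A <-> exists M, A `<=` cball 0 M.
Proof.
split.
  move=> [M [_ hM]]; exists (M + 1) => y Ay; rewrite /cball /= subr0.
  by apply: (hM (M + 1)) => //; rewrite ltrDl.
move=> [M hM]; exists M; split; first exact: num_real.
by move=> N ltN y /hM; rewrite /cball /= subr0 => h; apply: (le_trans h); exact: ltW.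
Qed.

Lemma bounded_borel_cball x r : bounded_borel (cball x r).
Proof.
split; first exact: measurable_cball.
by apply/bounded_cball; exists (`|x| + r); apply: sub_cball; rewrite subr0.
Qed.

Lemma bounded_borelS (A B : set E) : measurable (A : set BE) -> A `<=` B ->
  bounded_borel B -> bounded_borel A.
Proof.
move=> mA AB [mB bB]; split => //.
move/bounded_cball : bB => [M hM]; apply/bounded_cball.
by exists M; exact: subset_trans hM.
Qed.

Definition Cc (f : E -> R) :=
  continuous f /\ exists M, forall x, M < `|x| -> f x = 0.

Lemma Cc_bounded (f : E -> R) : Cc f ->
  exists2 K, 0 <= K & forall x, `|f x| <= K.
Proof.
move=> [cf [M fM]].
have : compact (f @` cball 0 M).
  apply: continuous_compact; last exact: compact_cball.
  by apply: continuous_subspaceT => x; exact: cf.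
move=> /compact_bounded[K [_ hK]].
exists (`|K| + 1); first by rewrite addr_ge0.
move=> x; have [xM|xM] := leP `|x| M; last by rewrite fM// normr0 addr_ge0.
apply: (hK (`|K| + 1)).
  by rewrite (le_lt_trans (ler_norm _))// ltrDl.
by exists x => //; rewrite /cball /= subr0.
Qed.

Lemma Cc_borel (f : E -> R) : Cc f -> measurable_fun [set: BE] (f : BE -> R).
Proof. by move=> [cf _]; exact: continuous_borel. Qed.

Lemma integrable_bounded_supp m (f : E -> R) (A : set E) K :
  lf_measure m -> measurable_fun [set: BE] (f : BE -> R) ->
  bounded_borel A -> (forall x, `|f x| <= K) -> (forall x, ~ A x -> f x = 0) ->
  m.-integrable [set: BE] (EFin \o (f : BE -> R)).
Proof.
move=> lfm mf bA fK fA.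
have -> : f = f \_ A.
  apply/funext => x; rewrite patchE; case: ifPn => //.
  by rewrite notin_setE => /fA.
have mA : measurable (A : set BE) by case: bA.
rewrite -restrict_EFin; apply/(integrable_mkcond _ mA).
apply: measurable_bounded_integrable => //.
- exact: lfm.
- exact: measurable_funS mf.
- exists K; split; first exact: num_real.
  by move=> M ltM x _ /=; rewrite (le_trans (fK x))// ltW.
Qed.

Lemma integrable_Cc m (f : E -> R) : lf_measure m -> Cc f ->
  m.-integrable [set: BE] (EFin \o (f : BE -> R)).
Proof.
move=> lfm Ccf; have [K _ fK] := Cc_bounded Ccf.
case: (Ccf) => _ [M fM].
apply: (@integrable_bounded_supp _ _ (cball 0 M) K) => //.
- exact: Cc_borel.
- exact: bounded_borel_cball.
- by move=> x /negP; rewrite /cball /= subr0 -ltNge => /fM.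
Qed.

(** Masses of balls are not continuous for vague convergence; comparison with
    [tent] replaces them by integrals, which are. *)
Definition tent r : E -> R := fun x => Num.max 0 (Num.min 1 (2 - `|x| / r)).

Lemma tent_ge0 r x : 0 <= tent r x.
Proof. by rewrite /tent le_max lexx. Qed.

Lemma tent_le1 r x : tent r x <= 1.
Proof. by rewrite /tent ge_max ler01 ge_min lexx. Qed.

Lemma tent1 r x : 0 < r -> `|x| <= r -> tent r x = 1.
Proof.
move=> r0 xr; have : `|x| / r <= 1 by rewrite ler_pdivrMr// mul1r.
move=> h; rewrite /tent min_l; last by lra.
by rewrite max_r.
Qed.

Lemma tent0 r x : 0 < r -> 2 * r <= `|x| -> tent r x = 0.
Proof.
move=> r0 xr; have : 2 <= `|x| / r by rewrite ler_pdivlMr.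
move=> h; rewrite /tent max_l// ge_min; apply/orP; right; lra.
Qed.

Lemma continuous_tent r : continuous (tent r).
Proof.
move=> x; rewrite /tent.
apply: (@continuous_max R E (fun=> 0) _ x); first exact: cst_continuous.
apply: (@continuous_min R E (fun=> 1) _ x); first exact: cst_continuous.
apply: continuousB; first exact: cst_continuous.
by apply: continuousM; [exact: norm_continuous|exact: cst_continuous].
Qed.

Lemma Cc_tent r : 0 < r -> Cc (tent r).
Proof.
move=> r0; split; first exact: continuous_tent.
by exists (2 * r) => x /ltW; exact: tent0.
Qed.

Lemma Cc_mul (f g : E -> R) : continuous f -> Cc g -> Cc (fun x => f x * g x).
Proof.
move=> cf [cg [M gM]]; split; last by exists M => x /gM ->; rewrite mulr0.
by move=> x; apply: continuousM; [exact: cf|exact: cg].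
Qed.

Lemma Cc_add (f g : E -> R) : Cc f -> Cc g -> Cc (fun x => f x + g x).
Proof.
move=> [cf [M fM]] [cg [N gN]]; split; last first.
  by exists (Num.max M N) => x; rewrite gt_max => /andP[/fM -> /gN ->]; rewrite addr0.
by move=> x; apply: continuousD; [exact: cf|exact: cg].
Qed.

Lemma Cc_scale a (f : E -> R) : Cc f -> Cc (fun x => a * f x).
Proof. by apply: Cc_mul => x; exact: cst_continuous. Qed.

Lemma compact_supp_bounded (f : E -> R[i]) : compact_supp f ->
  exists M, forall x, M < `|x| -> f x = 0.
Proof.
move=> /compact_bounded/bounded_cball[M fM]; exists M => x xM.
apply: contrapT => fx.
have : cball 0 M x by apply: fM; exact: subset_closure.
by rewrite /cball /= subr0 leNgt xM.
Qed.

Lemma bounded_compact_supp (f : E -> R[i]) M :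
  (forall x, M < `|x| -> f x = 0) -> compact_supp f.
Proof.
move=> fM; apply: (@subclosed_compact _ _ (cball 0 M)).
- exact: closed_closure.
- exact: compact_cball.
- rewrite [X in _ `<=` X](iffLR (closure_id _)); last exact: closed_cball.
  + apply: closureS => x /= fx; rewrite /cball /= subr0 leNgt.
    by apply/negP => /fM.
Qed.

Lemma measure_cball_le_tent m r : lf_measure m -> 0 < r ->
  fine (m (cball 0 r)) <= \int[m]_x tent r x.
Proof.
move=> lfm r0.
rewrite -[X in X <= _]mul1r -Rintegral_cst; last exact: measurable_cball.
rewrite Rintegral_mkcond; apply: le_Rintegral => //.
- apply: (@integrable_bounded_supp _ _ (cball 0 r) 1) => //.
  + apply/(measurable_restrictT _ (measurable_cball _ _)).
    exact: measurable_cst.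
  + exact: bounded_borel_cball.
  + by move=> x; rewrite patchE; case: ifPn => _; rewrite ?normr1// normr0.
  + by move=> x xr; rewrite patchE memNset.
- by apply: integrable_Cc => //; exact: Cc_tent.
- move=> x _; rewrite patchE; case: ifPn; last by rewrite tent_ge0.
  by rewrite inE /cball /= subr0 => xr; rewrite tent1.
Qed.

Lemma tent_le_measure_cball m r : lf_measure m -> 0 < r ->
  \int[m]_x tent r x <= fine (m (cball 0 (2 * r))).
Proof.
move=> lfm r0.
rewrite -[X in _ <= X]mul1r -Rintegral_cst; last exact: measurable_cball.
rewrite [X in _ <= X]Rintegral_mkcond; apply: le_Rintegral => //.
- by apply: integrable_Cc => //; exact: Cc_tent.
- apply: (@integrable_bounded_supp _ _ (cball 0 (2 * r)) 1) => //.
  + apply/(measurable_restrictT _ (measurable_cball _ _)).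
    exact: measurable_cst.
  + exact: bounded_borel_cball.
  + by move=> x; rewrite patchE; case: ifPn => _; rewrite ?normr1// normr0.
  + by move=> x xr; rewrite patchE memNset.
- move=> x _; rewrite patchE; case: ifPn; first by rewrite tent_le1.
  by rewrite notin_setE /cball /= subr0 => /negP; rewrite -ltNge => /ltW/(tent0 r0) ->.
Qed.

End Basics.

(** * Jordan decomposition of real charges *)

Section Jordan.
Context {R : realType} {d : nat}.
Local Notation E := 'rV[R]_d.
Local Notation BE := (borelRd R d).
Implicit Types (sigma : set E -> R) (p q m : {measure set BE -> \bar R}).

(** Finiteness is expressed by the two upper variations because [rint] is defined
    through them. *)
Definition real_charge sigma :=
  (forall F : nat -> set E, (forall i, bounded_borel (F i)) ->
     trivIset setT F -> bounded_set (\bigcup_i F i) ->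
     (fun n => \sum_(i < n) sigma (F i)) @ \oo --> sigma (\bigcup_i F i)) /\
  (forall B, bounded_borel B -> (upvar sigma B < +oo)%E /\
     (upvar (fun A => (- sigma A)%R) B < +oo)%E).

Lemma bounded_borel0 : bounded_borel (set0 : set E).
Proof.
split; first exact: (@measurable0 _ BE).
by apply/bounded_cball; exists 0 => x.
Qed.

Lemma bounded_borelU (A B : set E) : bounded_borel A -> bounded_borel B ->
  bounded_borel (A `|` B).
Proof.
move=> [mA /bounded_cball[M hM]] [mB /bounded_cball[N hN]]; split.
  exact: (@measurableU _ BE).
apply/bounded_cball; exists (Num.max M N) => x [/hM|/hN] h.
  by apply: le_cball h; rewrite le_max lexx.
by apply: le_cball h; rewrite le_max lexx orbT.
Qed.

Lemma bounded_borelI (A B : set E) : bounded_borel A -> measurable (B : set BE) ->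
  bounded_borel (A `&` B).
Proof.
move=> bA mB; apply: (bounded_borelS _ _ bA); last by move=> x [].
by apply: (@measurableI _ BE) => //; case: bA.
Qed.

Lemma real_chargeN sigma : real_charge sigma ->
  real_charge (fun A => - sigma A).
Proof.
move=> [sadd sfin]; split=> [F bF tF bUF|B bB].
  under eq_fun do rewrite sumrN.
  by apply: cvgN; exact: sadd.
have [h1 h2] := sfin _ bB; split => //.
by under [X in upvar X]eq_fun do rewrite opprK.
Qed.

Lemma real_charge0 sigma : real_charge sigma -> sigma set0 = 0.
Proof.
move=> [sadd _].
have tr0 : trivIset [set: nat] (fun=> set0 : set E) by move=> i j _ _ [x []].
have := sadd _ (fun=> bounded_borel0) tr0.
rewrite bigcup0// => /(_ (bounded_borel0.2)) cv.
have {cv} : series (fun=> sigma set0) @ \oo --> sigma set0.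
  suff -> : series (fun=> sigma set0) = fun n => \sum_(i < n) sigma set0 by [].
  by apply/funext => n; rewrite /series /= big_mkord.
move=> cv; have := cvg_series_cvg_0 (cvgP _ cv).
move/cvg_lim => <- //; first by rewrite lim_cst.
Qed.

Lemma real_chargeU sigma (A B : set E) : real_charge sigma ->
  bounded_borel A -> bounded_borel B -> A `&` B = set0 ->
  sigma (A `|` B) = sigma A + sigma B.
Proof.
move=> rc bA bB AB; have [sadd _] := rc.
have h : forall i, bounded_borel (bigcup2 A B i).
  by case=> [//|[//|i]]; exact: bounded_borel0.
have tr : trivIset setT (bigcup2 A B) by
  move=> [|[|i]] [|[|j]] _ _ [x []]//= xA xB; have : (A `&` B) x by []; rewrite AB.
have := sadd _ h tr; rewrite bigcup2E.
move=> /(_ (bounded_borelU bA bB).2) cv.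
have : (fun n => \sum_(i < n) sigma (bigcup2 A B i)) @ \oo --> sigma A + sigma B.
  apply: (@cvg_near_cst _ _ (sigma A + sigma B)).
  near=> n; have n2 : (2 <= n)%N by near: n; exact: nbhs_infty_ge.
  rewrite -(subnK n2) addnC !big_ord_recl/= big1 ?addr0// => i _.
  exact: real_charge0.
by move=> cv2; apply: (cvg_unique (@Rhausdorff R) cv cv2).
Unshelve. all: by end_near. Qed.

Lemma upvar_ub sigma (A B : set E) : bounded_borel B -> B `<=` A ->
  ((sigma B)%:E <= upvar sigma A)%E.
Proof. by move=> bB BA; apply: ereal_sup_ubound; exists B. Qed.

Lemma upvar_ge0 sigma A : real_charge sigma -> (0 <= upvar sigma A)%E.
Proof.
move=> /real_charge0 s0; rewrite -[0%E]/(0%:E) -s0; apply: upvar_ub => //.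
exact: bounded_borel0.
Qed.

Lemma upvar_mono sigma (A B : set E) : A `<=` B ->
  (upvar sigma A <= upvar sigma B)%E.
Proof.
move=> AB; apply: ge_ereal_sup => _ [C [bC CA] <-].
by apply: upvar_ub => //; exact: subset_trans AB.
Qed.

Lemma upvar_superadditive sigma (A B : set E) : real_charge sigma ->
  A `&` B = set0 -> (upvar sigma A + upvar sigma B <= upvar sigma (A `|` B))%E.
Proof.
move=> rc AB.
have step (C : set E) : bounded_borel C -> C `<=` A ->
    ((sigma C)%:E + upvar sigma B <= upvar sigma (A `|` B))%E.
  move=> bC CA; rewrite addeC -leeBrDr//.
  apply: ge_ereal_sup => _ [D [bD DB] <-].
  rewrite leeBrDr// -EFinD -real_chargeU//.
    apply: upvar_ub; first exact: bounded_borelU.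
    by rewrite setUC; exact: setUSS.
  by apply/seteqP; split => // x [/DB Bx /CA Ax]; rewrite -AB; split.
have [yB|/eqP By] := eqVneq (upvar sigma B) +oo%E.
  have := step _ bounded_borel0 (@sub0set _ _).
  by rewrite yB addey// leye_eq => /eqP ->; rewrite leey.
have fB : upvar sigma B \is a fin_num.
  by rewrite ge0_fin_numE ?upvar_ge0// ltey; apply/eqP.
rewrite -leeBrDr//; apply: ge_ereal_sup => _ [C [bC CA] <-].
by rewrite leeBrDr//; exact: step.
Qed.

(** A competitor for the union splits into competitors for the pieces; conversely
    competitors for finitely many pieces unite to one. *)
Lemma upvar_sigma_additive sigma : real_charge sigma ->
  semi_sigma_additive (upvar sigma : set BE -> \bar R).
Proof.
move=> rc F mF tF mUF.
have u0 : forall i, (0 <= upvar sigma (F i))%E by move=> i; exact: upvar_ge0.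
apply: cvg_toP; first by apply: is_cvg_nneseries => n _ _; exact: u0.
apply/eqP; rewrite eq_le; apply/andP; split.
  apply: lime_le; first by apply: is_cvg_nneseries => n _ _; exact: u0.
  apply: nearW => n.
  apply: (@le_trans _ _ (upvar sigma (\bigcup_(i in `I_n) F i))); last first.
    by apply: upvar_mono => x [i _ Fx]; exists i.
  elim: n => [|n IH]; first by rewrite big_nil upvar_ge0.
  rewrite big_nat_recr//= IIS bigcup_setU bigcup_set1.
  apply: le_trans (upvar_superadditive rc _); first by rewrite leeD2r.
  apply/seteqP; split => // x [[i /= ltin Fix] Fnx].
  have ein : i = n by apply: (tF i n I I); exists x.
  by move: ltin; rewrite ein ltnn.
apply: ge_ereal_sup => _ [B [bB BF] <-].
have [sadd _] := rc.
have BE' : B = \bigcup_i (B `&` F i).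
  by rewrite -setI_bigcupr; apply/esym/setIidPl.
have := sadd (fun i => B `&` F i).
rewrite -BE' => /(_ (fun i => bounded_borelI bB (mF i))).
have tBF : trivIset setT (fun i => B `&` F i).
  by apply: trivIset_setIl.
move=> /(_ tBF bB.2) cv.
have cvE : (fun n => (\sum_(i < n) sigma (B `&` F i))%:E) @ \oo --> (sigma B)%:E.
  by apply: cvg_EFin; [exact: nearW|exact: cv].
rewrite -(cvg_lim _ cvE)//.
apply: lime_le; first exact: (cvgP _ cvE).
apply: nearW => n; rewrite -sumEFin.
apply: le_trans (nneseries_lim_ge n _); last by move=> *; exact: u0.
rewrite big_mkord; apply: lee_sum => i _; apply: upvar_ub.
  exact: bounded_borelI.
by move=> x [].
Qed.

Lemma upvar_measure sigma : real_charge sigma ->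
  exists p, (p : set BE -> \bar R) = upvar sigma /\ lf_measure p.
Proof.
move=> rc; have [||p pE] := exists_measure _ _ (upvar_sigma_additive rc).
- apply/eqP; rewrite eq_le upvar_ge0// andbT.
  apply: ge_ereal_sup => _ [B [_ B0] <-].
  have -> : B = set0 by apply/seteqP; split.
  by rewrite real_charge0.
- by move=> A; exact: upvar_ge0.
exists p; split => //= B bB.
by have := (rc.2 _ bB).1; rewrite -pE.
Qed.

(** Passing from a subset of [A] to its complement in [A] exchanges the two upper
    variations. *)
Lemma upvar_jordan sigma A : real_charge sigma -> bounded_borel A ->
  upvar sigma A = ((sigma A)%:E + upvar (fun B => (- sigma B)%R) A)%E.
Proof.
move=> rc bA.
have key (tau : set E -> R) : real_charge tau ->
    (upvar tau A <= (tau A)%:E + upvar (fun B => (- tau B)%R) A)%E.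
  move=> rt; apply: ge_ereal_sup => _ [B [bB BA] <-].
  have bAB : bounded_borel (A `\` B).
    rewrite setDE; apply: bounded_borelI => //.
    by apply: (@measurableC _ BE); case: bB.
  have -> : tau B = tau A + - tau (A `\` B).
    rewrite -[in tau A](setDUK BA) real_chargeU ?addrK//.
    by rewrite setDE setICA setICr setI0.
  rewrite EFinD leeD2l//; apply: (@upvar_ub (fun B => - tau B)) => //.
apply/eqP; rewrite eq_le key//=.
have := key _ (real_chargeN rc).
under [X in ((- sigma A)%:E + upvar X A)%E]eq_fun do rewrite opprK.
by rewrite addeC EFinN leeBrDr// addeC.
Qed.

(** Converse of the Jordan decomposition; it makes set functions given by explicit
    measures accessible to [rint]. *)
Lemma real_charge_diff sigma p q : lf_measure p -> lf_measure q ->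
  (forall B, bounded_borel B -> sigma B = fine (p B) - fine (q B)) ->
  real_charge sigma.
Proof.
move=> lfp lfq sE; split=> [F bF tF bUF|B bB]; last first.
  split.
    apply: le_lt_trans (lfp _ bB); apply: ge_ereal_sup => _ [C [bC CB] <-].
    rewrite sE// (@le_trans _ _ (fine (p C))%:E)//.
      by rewrite lee_fin lerBlDr lerDl fine_ge0.
    rewrite fineK ?ge0_fin_numE ?lfp//.
    by apply: le_measure => //; rewrite inE; [case: bC|case: bB].
  apply: le_lt_trans (lfq _ bB); apply: ge_ereal_sup => _ [C [bC CB] <-].
  rewrite sE// opprB (@le_trans _ _ (fine (q C))%:E)//.
    by rewrite lee_fin lerBlDr lerDl fine_ge0.
  rewrite fineK ?ge0_fin_numE ?lfq//.
  by apply: le_measure => //; rewrite inE; [case: bC|case: bB].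
have mF i : measurable (F i : set BE) by case: (bF i).
have mUF : measurable (\bigcup_i F i : set BE).
  by apply: (@bigcup_measurable _ BE).
have bUFb : bounded_borel (\bigcup_i F i) by [].
have cvm (m : {measure set BE -> \bar R}) : lf_measure m ->
    (fun n => \sum_(i < n) fine (m (F i))) @ \oo --> fine (m (\bigcup_i F i)).
  move=> lfm.
  have cv := @measure_semi_sigma_additive _ BE _ m F mF tF mUF.
  have fU : m (\bigcup_i F i) \is a fin_num by rewrite ge0_fin_numE ?lfm.
  rewrite -(fineK fU) in cv.
  suff <- : fine \o (fun n => \sum_(0 <= i < n) m (F i))%E =
    (fun n => \sum_(i < n) fine (m (F i))) by exact: fine_cvg cv.
  apply/funext => n /=; rewrite big_mkord sum_fine// => i _.
  by rewrite ge0_fin_numE ?lfm.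
rewrite sE//.
have -> : (fun n => \sum_(i < n) sigma (F i)) =
    (fun n => \sum_(i < n) fine (p (F i)) - \sum_(i < n) fine (q (F i))).
  by apply/funext => n; rewrite -sumrB; apply: eq_bigr => i _; rewrite sE.
by apply: cvgB; exact: cvm.
Qed.

(** If [sigma = p - q] and [u], [v] are the upper variations of [sigma] and
    [- sigma], then [u + q = p + v] on bounded Borel sets.  So any representation of a
    real charge as a difference of measures computes [rint]. *)
Lemma rint_diff sigma p q (f : E -> R) : lf_measure p -> lf_measure q ->
  (forall B, bounded_borel B -> sigma B = fine (p B) - fine (q B)) ->
  Cc f -> rint f sigma = \int[p]_x f x - \int[q]_x f x.
Proof.
move=> lfp lfq sE Ccf.
have rc := real_charge_diff lfp lfq sE.
have [u [uE lfu]] := upvar_measure rc.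
have [v [vE lfv]] := upvar_measure (real_chargeN rc).
rewrite /rint -uE -vE -!/(Rintegral _ _ _).
have [_ [M fM]] := Ccf.
have localize m : (\int[m]_x (f x)%:E = \int[m]_(x in cball 0 M) (f x)%:E)%E.
  rewrite [RHS]integral_mkcond; apply: eq_integral => x _; rewrite patchE.
  case: ifPn => //; rewrite notin_setE /cball /= subr0 => /negP.
  by rewrite -ltNge => /fM ->.
have iloc m : lf_measure m -> m.-integrable (cball 0 M) (EFin \o f).
  move=> lfm; apply: (integrableS (@measurableT _ BE)) => //.
    exact: measurable_cball.
  exact: integrable_Cc.
have fin m : lf_measure m -> (\int[m]_x (f x)%:E \is a fin_num)%E.
  by move=> lfm; apply: integrable_fin_num => //; exact: integrable_Cc.
have mC : measurable (cball 0 M : set BE) by exact: measurable_cball.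
have mf : measurable_fun (cball 0 M : set BE) (EFin \o f).
  by apply/measurable_EFinP; apply: measurable_funTS; exact: Cc_borel.
have eq1 : (\int[u]_x (f x)%:E + \int[q]_x (f x)%:E =
            \int[p]_x (f x)%:E + \int[v]_x (f x)%:E)%E.
  rewrite !localize -!integral_measure_add//; do ?exact: iloc.
  apply: eq_measure_integral => A mA AC.
  have bA : bounded_borel A.
    by apply: (bounded_borelS mA AC); exact: bounded_borel_cball.
  change (measure_add u q A = measure_add p v A).
  rewrite !measure_addE uE vE upvar_jordan// sE// EFinB.
  have fv : upvar (fun B => - sigma B) A \is a fin_num.
    by rewrite -vE ge0_fin_numE// lfv.
  rewrite !fineK ?ge0_fin_numE ?lfp ?lfq//.
  by rewrite addeAC subeK ?ge0_fin_numE ?lfq.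
move: eq1; rewrite /Rintegral.
rewrite -(fineK (fin _ lfu)) -(fineK (fin _ lfv)) -(fineK (fin _ lfp)).
rewrite -(fineK (fin _ lfq)) /= -!EFinD => -[].
lra.
Qed.

End Jordan.

(** * The Riesz representation theorem *)

Section RationalBalls.
Context {R : realType} {d : nat}.
Local Notation E := 'rV[R]_d.

Definition oball (x : E) (r : R) : set E := [set y | `|y - x| < r].

Lemma open_oball (x : E) r : open (oball x r).
Proof.
have -> : oball x r = (fun y => `|y - x|) @^-1` [set t | t < r] by [].
apply: open_comp; last exact: open_lt.
move=> y _; apply: continuous_comp; last exact: norm_continuous.
by apply: continuousB; [exact: cvg_id|exact: cst_continuous].
Qed.

Definition rat_point (q : 'rV[rat]_d) : E := map_mx (@ratr R) q.

Lemma rat_point_dense (x : E) e : 0 < e -> exists q, `|rat_point q - x| < e.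
Proof.
move=> e0.
have /choice[q hq] : forall i, exists q : rat, `|ratr q - x 0 i| < e.
  move=> i; have /rat_in_itvoo[q] : x 0 i - e < x 0 i + e by lra.
  by rewrite in_itv /= => h; exists q; rewrite ltr_distl.
exists (\row_i q i); rewrite [`|_|]mx_normrE; apply/bigmax_ltP; split => //.
by move=> [a i] _ /=; rewrite ord1 !mxE.
Qed.

Lemma open_bigcup_oball (U : set E) : open U ->
  exists B : nat -> set E,
    (forall k, B k = set0 \/ exists x r, B k = oball x r) /\
    U = \bigcup_k B k.
Proof.
move=> oU.
pose B (k : nat) : set E :=
  if @unpickle ('rV[rat]_d * nat)%type k is Some (q, n) then
    if `[< oball (rat_point q) (2 ^- n) `<=` U >]
    then oball (rat_point q) (2 ^- n) else set0
  else set0.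
exists B; split.
  move=> k; rewrite /B; case: unpickle => [[q n]|]; last by left.
  by case: ifP => _; [right; exists (rat_point q), (2 ^- n)|left].
apply/seteqP; split => [x Ux|x [k _]]; last first.
  by rewrite /B; case: unpickle => [[q n]|//]; case: asboolP => // h /h.
have [e e0 he] : exists2 e : R, 0 < e & oball x e `<=` U.
  have /nbhs_ballP[e e0 he] : nbhs x U by exact: open_nbhs_nbhs.
  exists e => // y; rewrite /oball /= distrC => yx; apply: he.
  by rewrite -ball_normE.
have [n hn] := exp2N_lt (divr_gt0 e0 (ltr0n R 2)).
have n0 : 0 < 2 ^- n :> R by exact: exp2N_gt0.
have [q hq] := rat_point_dense x n0.
exists (pickle (q, n)) => //; rewrite /B pickleK; case: ifP => [_|/negbT/negP[]].
  by rewrite /oball /= distrC.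
apply/asboolP; apply: subset_trans he => y; rewrite /oball /= => yq.
rewrite -[y](subrK (rat_point q)) -addrA (le_lt_trans (ler_normD _ _))//; lra.
Qed.

End RationalBalls.

Section Riesz.
Context {R : realType} {d : nat}.
Local Notation E := 'rV[R]_d.
Local Notation BE := (borelRd R d).

Definition positive_functional (L : (E -> R) -> R) :=
  [/\ forall f g, Cc f -> Cc g -> L (fun x => f x + g x) = L f + L g,
      forall a f, Cc f -> L (fun x => a * f x) = a * L f &
      forall f, Cc f -> (forall x, 0 <= f x) -> 0 <= L f].

Definition Cc_ge0 (f : E -> R) := Cc f /\ forall x, 0 <= f x.

Lemma Cc_ge0_0 : Cc_ge0 (fun=> 0).
Proof.
split=> //; split; first by move=> x; exact: cst_continuous.
by exists 0.
Qed.

Lemma pair_enum : exists e : nat -> nat * nat,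
  forall a : nat -> nat -> \bar R, (forall i j, (0 <= a i j)%E) ->
  (\sum_(k <oo) a (e k).1 (e k).2 = \sum_(i <oo) \sum_(j <oo) a i j)%E.
Proof.
have /card_esym/ppcard_eqP[f] := card_nat2.
exists f => a a0.
rewrite nneseries_esum//.
transitivity (\esum_(i in [set: nat]) \esum_(j in [set: nat]) a i j)%E; last first.
  rewrite nneseries_esum//; last by move=> *; apply: nneseries_ge0.
  have -> : [set x : nat | true] = setT by apply/seteqP; split.
  apply: eq_esum => i _; rewrite nneseries_esum//.
  by have -> : [set x : nat | true] = setT by apply/seteqP; split.
rewrite esum_esum//.
have -> : [set: nat] `*`` (fun=> [set: nat]) = [set: nat * nat].
  by apply/seteqP; split.
rewrite (reindex_esum [set: nat] _ f)//.
by have -> : [set x : nat | true] = setT by apply/seteqP; split.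
Qed.

Lemma nneseries_gt (u : nat -> \bar R) x : (forall i, (0 <= u i)%E) ->
  (x < \sum_(i <oo) u i)%E -> exists N, (x < \sum_(i < N) u i)%E.
Proof.
move=> u0 xu; apply: contrapT => /forallNP h; move: xu; apply/negP.
rewrite -leNgt; apply: lime_le; first exact: is_cvg_nneseries.
by apply: nearW => n; rewrite big_mkord leNgt; apply/negP; exact: h.
Qed.

Context (L : (E -> R) -> R) (HL : positive_functional L).

Let LD f g : Cc f -> Cc g -> L (fun x => f x + g x) = L f + L g.
Proof. by case: HL => h _ _; exact: h. Qed.
Let LZ a f : Cc f -> L (fun x => a * f x) = a * L f.
Proof. by case: HL => _ h _; exact: h. Qed.
Let L_ge0 f : Cc_ge0 f -> 0 <= L f.
Proof. by case: HL => _ _ h [cf f0]; exact: h. Qed.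

Lemma functional0 : L (fun=> 0) = 0.
Proof.
rewrite -[RHS](mul0r (L (fun=> 0))) -LZ; last exact: Cc_ge0_0.1.
by congr L; apply/funext => x; rewrite mul0r.
Qed.

Lemma functionalB f g : Cc f -> Cc g -> L (fun x => f x - g x) = L f - L g.
Proof.
move=> cf cg; rewrite -mulN1r -LZ// -LD//; last exact: Cc_scale.
by congr L; apply/funext => x; rewrite mulN1r.
Qed.

Lemma Cc_sub (f g : E -> R) : Cc f -> Cc g -> Cc (fun x => f x - g x).
Proof.
move=> cf cg; have := Cc_add cf (Cc_scale (-1) cg).
by congr Cc; apply/funext => x; rewrite mulN1r.
Qed.

Lemma functional_le f g : Cc f -> Cc g -> (forall x, f x <= g x) -> L f <= L g.
Proof.
move=> cf cg fg; rewrite -subr_ge0 -functionalB//; apply: L_ge0; split.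
  exact: Cc_sub.
by move=> x; rewrite subr_ge0.
Qed.

Lemma Cc_sum (f : nat -> E -> R) n : (forall i, Cc (f i)) ->
  Cc (fun x => \sum_(i < n) f i x).
Proof.
move=> cf; elim: n => [|n IH].
  under [X in Cc X]eq_fun do rewrite big_ord0.
  exact: Cc_ge0_0.1.
under [X in Cc X]eq_fun do rewrite big_ord_recr /=.
exact: Cc_add.
Qed.

Lemma functional_sum (f : nat -> E -> R) n : (forall i, Cc (f i)) ->
  L (fun x => \sum_(i < n) f i x) = \sum_(i < n) L (f i).
Proof.
move=> cf; elim: n => [|n IH].
  rewrite big_ord0 -[RHS]functional0; congr L.
  by apply/funext => x; rewrite big_ord0.
rewrite big_ord_recr /= -IH -LD//; last exact: Cc_sum.
by congr L; apply/funext => x; rewrite big_ord_recr.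
Qed.

(** Dini's theorem: on a ball finitely many terms of the sum already dominate [g] up
    to a small multiple of a cut-off. *)
Lemma functional_sigma (g : E -> R) (f : nat -> E -> R) :
  Cc_ge0 g -> (forall i, Cc_ge0 (f i)) ->
  (forall x, ((g x)%:E <= \sum_(i <oo) (f i x)%:E)%E) ->
  ((L g)%:E <= \sum_(i <oo) (L (f i))%:E)%E.
Proof.
move=> [cg g0] cf gf.
have [_ [M gM]] := cg.
pose r := `|M| + 1; have r0 : 0 < r by rewrite ltr_wpDl.
have Mr : M <= r by rewrite (le_trans (ler_norm _))// lerDl.
have key (e : R) : 0 < e -> exists n, forall x, g x <= \sum_(i < n) f i x + e * tent r x.
  move=> e0.
  have /compact_near_coveringP := @compact_cball R d 0 r.
  move=> /(_ nat \oo (fun n x => g x - e <= \sum_(i < n) f i x)) cpt.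
  have [|N _ hN] := cpt _.
    move=> x _.
    have : ((g x - e / 2)%:E < \sum_(i <oo) (f i x)%:E)%E.
      by apply: lt_le_trans (gf x); rewrite lte_fin; lra.
    move=> /nneseries_gt[|N]; first by move=> i; rewrite lee_fin; case: (cf i).
    rewrite sumEFin lte_fin => hN.
    have cD : continuous (fun y => \sum_(i < N) f i y - g y).
      move=> y; apply: continuousB; last by case: cg => cg _; exact: cg.
      have : Cc (fun y => \sum_(i < N) f i y) by apply: Cc_sum => i; case: (cf i).
      by move=> [h _]; exact: h.
    have nx : \forall y \near x, - e < \sum_(i < N) f i y - g y.
      by apply: (cvgr_gt _ (cD x)); lra.
    exists ([set y | - e < \sum_(i < N) f i y - g y], [set n | (N <= n)%N]).
      by split => //=; exists N.
    move=> [y n] /= [hy Nn].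
    rewrite -(subnKC Nn) big_split_ord /=.
    have : 0 <= \sum_(i < n - N) f (N + i)%N y.
      by apply: sumr_ge0 => i _; case: (cf (N + i)%N).
    lra.
  exists N => x; have f0 : 0 <= \sum_(i < N) f i x.
    by apply: sumr_ge0 => i _; case: (cf i).
  have [xr|xr] := leP `|x| r.
    rewrite tent1// mulr1.
    have : cball 0 r x by rewrite /cball /= subr0.
    by move=> /(hN N (leqnn N)) /=; lra.
  rewrite (gM _ (le_lt_trans Mr xr)) addr_ge0// mulr_ge0 ?tent_ge0//.
  exact: ltW.
apply/lee_addgt0Pr => e e0.
have L0 : 0 <= L (tent r).
  by apply: L_ge0; split; [exact: Cc_tent|move=> x; exact: tent_ge0].
have [|n hn] := key (e / (L (tent r) + 1)); first by rewrite divr_gt0// ltr_wpDl.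
apply: (@le_trans _ _ ((\sum_(i < n) L (f i))%:E + e%:E)%E); last first.
  rewrite leeD2r// -sumEFin -(big_mkord xpredT (fun i => (L (f i))%:E)).
  by apply: nneseries_lim_ge => i _ _; rewrite lee_fin; apply: L_ge0.
rewrite -EFinD lee_fin -functional_sum; last by move=> i; case: (cf i).
apply: (@le_trans _ _ (L (fun x => \sum_(i < n) f i x +
    e / (L (tent r) + 1) * tent r x))).
  apply: functional_le => //; apply: Cc_add; last exact/Cc_scale/Cc_tent.
  by apply: Cc_sum => i; case: (cf i).
rewrite LD ?LZ; [|exact: Cc_tent| |exact/Cc_scale/Cc_tent]; last first.
  by apply: Cc_sum => i; case: (cf i).
rewrite lerD2l mulrAC ler_pdivrMr ?ltr_wpDl//.
by rewrite ler_pM2l// lerDl.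
Qed.

(** Covers by countably many continuous functions, on which [L] can be evaluated, in the
    place of covers by open sets. *)
Definition fcover (A : set E) : set (nat -> E -> R) :=
  [set f | (forall i, Cc_ge0 (f i)) /\
    forall x, A x -> (1%:E <= \sum_(i <oo) (f i x)%:E)%E].

Definition riesz_outer (A : set E) : \bar R :=
  ereal_inf [set (\sum_(i <oo) (L (f i))%:E)%E | f in fcover A].

Lemma riesz_outer_le A f : fcover A f ->
  (riesz_outer A <= \sum_(i <oo) (L (f i))%:E)%E.
Proof. by move=> Af; apply: ereal_inf_lbound; exists f. Qed.

Lemma riesz_outer_le1 A g : Cc_ge0 g -> (forall x, A x -> 1 <= g x) ->
  (riesz_outer A <= (L g)%:E)%E.
Proof.
move=> cg Ag; pose f (i : nat) : E -> R := if i is 0%N then g else fun=> 0.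
have sumf (a : nat -> \bar R) : (forall i, a i.+1 = 0%E) ->
    (\sum_(i <oo) a i = a 0%N)%E.
  move=> a0; apply: lim_near_cst => //; near=> n.
  have : (0 < n)%N by near: n; exact: nbhs_infty_gt.
  by move=> /prednK <-; rewrite big_nat_recl// big1 ?adde0// => i _; exact: a0.
have -> : (L g)%:E = (\sum_(i <oo) (L (f i))%:E)%E.
  by rewrite sumf// => i /=; rewrite functional0.
apply: riesz_outer_le; split.
  by case=> [|i] /=; [|exact: Cc_ge0_0].
by move=> x Ax; rewrite sumf//= lee_fin; exact: Ag.
Unshelve. all: by end_near. Qed.

Lemma riesz_outer_pair A (f : nat -> nat -> E -> R) :
  (forall i j, Cc_ge0 (f i j)) ->
  (forall x, A x -> (1%:E <= \sum_(i <oo) \sum_(j <oo) (f i j x)%:E)%E) ->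
  (riesz_outer A <= \sum_(i <oo) \sum_(j <oo) (L (f i j))%:E)%E.
Proof.
move=> cf Af; have [e he] := pair_enum.
rewrite -he; last by move=> i j; rewrite lee_fin; exact: L_ge0.
apply: (@riesz_outer_le _ (fun k => f (e k).1 (e k).2)); split => // x Ax.
rewrite (he (fun i j => (f i j x)%:E)); first exact: Af.
by move=> i j; rewrite lee_fin; case: (cf i j).
Qed.

Lemma riesz_outer_ge0 A : (0 <= riesz_outer A)%E.
Proof.
apply: le_ereal_inf_tmp => _ [f [cf _] <-]; apply: nneseries_ge0 => i _ _.
by rewrite lee_fin; exact: L_ge0.
Qed.

Lemma riesz_outer0 : riesz_outer set0 = 0%E.
Proof.
apply/eqP; rewrite eq_le riesz_outer_ge0 andbT -[0%E]/(0%:E) -functional0.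
by apply: riesz_outer_le1 => //; exact: Cc_ge0_0.
Qed.

Lemma riesz_outer_mono : {homo riesz_outer : A B / A `<=` B >-> (A <= B)%E}.
Proof.
move=> A B AB; apply: ereal_inf_le_tmp => _ [f [cf Bf] <-].
by exists f => //; split => // x /AB; exact: Bf.
Qed.

Lemma riesz_outer_adherent A e : 0 < e -> riesz_outer A \is a fin_num ->
  exists2 f, fcover A f &
    (\sum_(i <oo) (L (f i))%:E <= riesz_outer A + e%:E)%E.
Proof.
move=> e0 fA; have [_ [f Af <-] lt] := lb_ereal_inf_adherent e0 fA.
by exists f => //; exact: ltW.
Qed.

Lemma riesz_outer_sigma : sigma_subadditive riesz_outer.
Proof.
move=> A; have [[i ioo]|] := pselect (exists i, riesz_outer (A i) = +oo%E).
  rewrite (eseries_pinfty _ _ ioo) ?leey// => n _.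
  by rewrite -ltNye (lt_le_trans _ (riesz_outer_ge0 _)).
rewrite -forallNE => Aoo.
apply/lee_addgt0Pr => e e0.
apply: le_trans (epsilon_trick _ _ (ltW e0)); last first.
  by move=> n; exact: riesz_outer_ge0.
have /choice[f hf] : forall n, exists f, fcover (A n) f /\
    (\sum_(i <oo) (L (f i))%:E <= riesz_outer (A n) + (e / (2 ^ n.+1)%:R)%:E)%E.
  move=> n; have [||f f1 f2] := @riesz_outer_adherent (A n) (e / (2 ^ n.+1)%:R).
  - by rewrite divr_gt0// ltr0n expn_gt0.
  - by rewrite ge0_fin_numE ?riesz_outer_ge0// ltey; apply/eqP; exact: Aoo.
  - by exists f.
apply: (@le_trans _ _ (\sum_(i <oo) \sum_(j <oo) (L (f i j))%:E)%E); last first.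
  apply: lee_nneseries => i _; last by case: (hf i).
  move=> _; apply: nneseries_ge0 => j _ _; rewrite lee_fin; apply: L_ge0.
  by case: (hf i) => -[].
apply: riesz_outer_pair => [i j|x [i _ Aix]]; first by case: (hf i) => -[].
apply: (@le_trans _ _ (\sum_(j <oo) (f i j x)%:E)%E).
  by case: (hf i) => -[_ h] _; exact: h.
have f0 k j : (0 <= (f k j x)%:E)%E.
  by rewrite lee_fin; case: (hf k) => -[/(_ j)[]].
apply: le_trans (nneseries_lim_ge i.+1 _) => /=; last first.
  by move=> *; exact: nneseries_ge0.
rewrite big_nat_recr//= leeDr// sume_ge0// => k _; exact: nneseries_ge0.
Qed.

HB.instance Definition _ := isOuterMeasure.Build R E riesz_outer
  riesz_outer0 riesz_outer_ge0 riesz_outer_mono riesz_outer_sigma.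

(** An increasing sequence [h n] of continuous functions that reaches the indicator of
    [U] splits every function of a cover of [A] into [h n * f], whose telescoping
    pieces cover [A `&` U], and [(1 - h n) * f], which covers the rest of [A]. *)
Lemma riesz_outer_split (U : set E) (h : nat -> E -> R) :
  (forall n, continuous (h n)) -> h 0%N = (fun=> 0) ->
  (forall n x, h n x <= h n.+1 x) -> (forall n x, h n x <= 1) ->
  (forall n x, ~ U x -> h n x = 0) ->
  (forall x, U x -> \forall n \near \oo, h n x = 1) ->
  (riesz_outer : set E -> \bar R).-caratheodory U.
Proof.
move=> ch h00 hS h1 hU0 hU1.
have h0 n x : 0 <= h n x.
  by elim: n => [|n IH]; [rewrite h00|exact: le_trans (hS n x)].
apply: le_caratheodory_measurable => A.
change (riesz_outer (A `&` U) + riesz_outer (A `&` ~` U) <= riesz_outer A)%E.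
have [fA|] := boolP (riesz_outer A \is a fin_num); last first.
  rewrite ge0_fin_numE ?riesz_outer_ge0// -leNgt leye_eq => /eqP ->.
  by rewrite leey.
apply/lee_addgt0Pr => e e0.
have [|f [cf Af] fe] := @riesz_outer_adherent A (e / 2) _ fA; first by rewrite divr_gt0.
have ch' i n : Cc_ge0 (fun x => h n x * f i x).
  have [c0 c1] := cf i; split; first exact: Cc_mul.
  by move=> x; rewrite mulr_ge0.
have cg i n : Cc_ge0 (fun x => (h n.+1 x - h n x) * f i x).
  have [c0 c1] := cf i; split; last by move=> x; rewrite mulr_ge0// subr_ge0.
  by apply: Cc_mul => // x; apply: continuousB; exact: ch.
have ck i n : Cc_ge0 (fun x => (1 - h n x) * f i x).
  have [c0 c1] := cf i; split; last by move=> x; rewrite mulr_ge0// subr_ge0.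
  by apply: Cc_mul => // x; apply: continuousB; [exact: cst_continuous|exact: ch].
have tele i n : \sum_(k < n) L (fun x => (h k.+1 x - h k x) * f i x) =
    L (fun x => h n x * f i x).
  elim: n => [|n IH].
    by rewrite big_ord0 h00 -[LHS]functional0; congr L; apply/funext => x; rewrite mul0r.
  rewrite big_ord_recr /= IH -LD; [|by case: (ch' i n)|by case: (cg i n)].
  by congr L; apply/funext => x; ring.
have split1 i n : L (fun x => h n x * f i x) + L (fun x => (1 - h n x) * f i x) = L (f i).
  rewrite -LD; [|by case: (ch' i n)|by case: (ck i n)].
  by congr L; apply/funext => x; ring.
have bnd i n : L (fun x => h n x * f i x) <= L (f i).
  by rewrite -(split1 i n) lerDl; exact: L_ge0.
pose l i := (\sum_(k <oo) (L (fun x => (h k.+1 x - h k x) * f i x))%:E)%E.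
have l0 i : (0 <= l i)%E.
  by apply: nneseries_ge0 => k _ _; rewrite lee_fin; exact: L_ge0.
have lfin i : (l i <= (L (f i))%:E)%E.
  apply: lime_le.
    by apply: is_cvg_nneseries => k _ _; rewrite lee_fin; exact: L_ge0.
  by apply: nearW => n; rewrite big_mkord sumEFin lee_fin tele bnd.
have lf i : l i \is a fin_num.
  by rewrite ge0_fin_numE// (le_lt_trans (lfin i))// ltry.
have /choice[n hn] : forall i, exists n, (l i <=
    (L (fun x => h n x * f i x))%:E + (e / 2 / (2 ^ i.+1)%:R)%:E)%E.
  move=> i; have e1 : 0 < e / 2 / (2 ^ i.+1)%:R.
    by rewrite !divr_gt0// ltr0n expn_gt0.
  have : (l i - (e / 2 / (2 ^ i.+1)%:R)%:E < l i)%E.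
    by rewrite lteBlDr// lteDl// lte_fin.
  move=> /nneseries_gt[|N hN]; first by move=> k; rewrite lee_fin; exact: L_ge0.
  by exists N; move: hN; rewrite sumEFin tele lteBlDr// => /ltW.
have AU : (riesz_outer (A `&` U) <= \sum_(i <oo) l i)%E.
  apply: (riesz_outer_pair cg) => x [Ax Ux].
  apply: le_trans (Af x Ax) _; apply: lee_nneseries => i _.
    by rewrite lee_fin; case: (cf i).
  have [N _ hN] := hU1 x Ux.
  apply: le_trans (nneseries_lim_ge N _) => /=; last first.
    by move=> k _ _; rewrite lee_fin; case: (cg i k).
  rewrite big_mkord sumEFin lee_fin -mulr_suml.
  have -> : \sum_(k < N) (h k.+1 x - h k x) = h N x - h 0%N x.
    by rewrite -(big_mkord xpredT (fun k => h k.+1 x - h k x)) telescope_sumr.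
  by rewrite (hN N)//= h00 subr0 mul1r.
have AC : (riesz_outer (A `&` ~` U) <=
    \sum_(i <oo) (L (fun x => (1 - h (n i) x) * f i x))%:E)%E.
  apply: riesz_outer_le; split => [i|x [Ax nUx]]; first exact: ck.
  apply: le_trans (Af x Ax) _; apply: lee_nneseries => i _.
    by rewrite lee_fin; case: (cf i).
  by rewrite hU0// subr0 mul1r.
apply: le_trans (leeD AU AC) _.
rewrite -nneseriesD; [|by move=> i *; exact: l0|by move=> i *; rewrite lee_fin; exact: L_ge0].
apply: (@le_trans _ _ (\sum_(i <oo) ((L (f i))%:E + (e / 2 / (2 ^ i.+1)%:R)%:E))%E).
  apply: lee_nneseries => i _; first by rewrite adde_ge0// lee_fin; exact: L_ge0.
  apply: le_trans (leeD2r _ (hn i)) _.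
  by rewrite -!EFinD lee_fin -(split1 i (n i)) addrAC.
apply: le_trans (epsilon_trick _ _ _) _.
- by move=> i; rewrite lee_fin; exact: L_ge0.
- by rewrite divr_ge0// ltW.
apply: le_trans (leeD2r _ fe) _.
by rewrite -addeA -EFinD -splitr.
Qed.

Lemma riesz_outer_oball x r :
  (riesz_outer : set E -> \bar R).-caratheodory (oball x r).
Proof.
pose h (n : nat) (y : E) : R := Num.min 1 (n%:R * Num.max 0 (r - `|y - x|)).
apply: (@riesz_outer_split _ h).
- move=> n y; apply: (@continuous_min R E (fun=> 1) _ y); first exact: cst_continuous.
  apply: continuousM; first exact: cst_continuous.
  apply: (@continuous_max R E (fun=> 0) _ y); first exact: cst_continuous.
  apply: continuousB; first exact: cst_continuous.
  apply: continuous_comp; last exact: norm_continuous.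
  by apply: continuousB; [exact: cvg_id|exact: cst_continuous].
- by apply/funext => y; rewrite /h mul0r min_r.
- move=> n y; rewrite /h le_min ge_min lexx /= ge_min; apply/orP; right.
  by rewrite ler_wpM2r ?ler_nat// le_max lexx.
- by move=> n y; rewrite /h ge_min lexx.
- move=> n y /negP; rewrite /oball /= -leNgt -subr_le0 => yr.
  by rewrite /h max_l// mulr0 min_r.
- move=> y; rewrite /oball /= -subr_gt0 => yr.
  have [N hN] : exists N : nat, (r - `|y - x|)^-1 < N%:R.
    by exists (Num.bound (r - `|y - x|)^-1); apply: archi_boundP; rewrite invr_ge0 ltW.
  exists N => // n /= Nn; rewrite /h max_r ?ltW// min_l//.
  rewrite -ler_pdivrMr// mul1r (le_trans (ltW hN))// ler_nat//.
Qed.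

Lemma riesz_outer_borel (A : set BE) : measurable A ->
  (riesz_outer : set E -> \bar R).-caratheodory A.
Proof.
move: A; apply: smallest_sub.
  split.
  - exact: caratheodory_measurable_set0.
  - by move=> A mA; rewrite setTD; exact: caratheodory_measurable_setC.
  - by move=> F mF; exact: caratheodory_measurable_bigcup.
move=> U /open_bigcup_oball[B [hB ->]]; apply: caratheodory_measurable_bigcup.
move=> k; have [->|[x [r ->]]] := hB k; first exact: caratheodory_measurable_set0.
exact: riesz_outer_oball.
Qed.

Lemma riesz_outer_measure : exists nu : {measure set BE -> \bar R},
  (nu : set BE -> \bar R) = riesz_outer.
Proof.
apply: exists_measure.
- exact: riesz_outer0.
- exact: riesz_outer_ge0.
- move=> F mF tF mUF.
  apply: (@caratheodory_measure_sigma_additive R E riesz_outer F) => //.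
  + by move=> i; exact: riesz_outer_borel.
  + exact: riesz_outer_borel.
Qed.

End Riesz.

Section RieszRepresentation.
Context {R : realType} {d : nat}.
Local Notation E := 'rV[R]_d.
Local Notation BE := (borelRd R d).

Definition trunc (f : E -> R) (s : R) (x : E) := Num.min (f x) s.

Lemma Cc_trunc f s : Cc f -> 0 <= s -> Cc (trunc f s).
Proof.
move=> [cf [M fM]] s0; split; last first.
  by exists M => x /fM; rewrite /trunc => ->; rewrite min_l.
move=> x; apply: (@continuous_min R E f (fun=> s) x); first exact: cf.
exact: cst_continuous.
Qed.

Lemma trunc_slice f s t x : 0 <= s -> s < t ->
  [/\ 0 <= trunc f t x - trunc f s x, trunc f t x - trunc f s x <= t - s,
      (t <= f x -> trunc f t x - trunc f s x = t - s) &
      (f x <= s -> trunc f t x - trunc f s x = 0)].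
Proof.
move=> s0 st; rewrite /trunc.
by case: (leP (f x) t) => h1; case: (leP (f x) s) => h2; split; lra.
Qed.

(** What identifies a functional with the measure [nu]: each slice of a function is
    controlled by the two super-level sets that bound it. *)
Definition sliced (nu : {measure set BE -> \bar R}) (I : (E -> R) -> R) :=
  forall f s t, Cc_ge0 f -> 0 <= s -> s < t ->
    (t - s) * fine (nu [set x | t <= f x]) <= I (fun x => trunc f t x - trunc f s x) <=
    (t - s) * fine (nu [set x | s < f x]).

Lemma level_borel (f : E -> R) s : Cc f -> measurable ([set x | s < f x] : set BE).
Proof.
move=> [cf _]; apply: open_borel.
have -> : [set x | s < f x] = f @^-1` [set t | s < t] by [].
by apply: open_comp => [x _|]; [exact: cf|exact: open_gt].
Qed.

Lemma level_le_borel (f : E -> R) s : Cc f -> measurable ([set x | s <= f x] : set BE).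
Proof.
move=> [cf _]; apply: closed_borel.
have -> : [set x | s <= f x] = f @^-1` [set t | s <= t] by [].
by apply: closed_comp => [x _|]; [exact: cf|exact: closed_ge].
Qed.

Lemma level_bounded (f : E -> R) s : Cc f -> 0 <= s -> bounded_borel [set x | s < f x].
Proof.
move=> cf s0; split; first exact: level_borel.
case: cf => _ [M fM]; apply/bounded_cball; exists M => x /= sf.
rewrite /cball /= subr0 leNgt; apply/negP => /fM fx.
by move: sf; rewrite fx ltNge s0.
Qed.

(** Cut [f] into slices of height [delta].  On each slice the two functionals lie
    between [delta] times the masses of consecutive level sets, so the errors telescope
    to [delta] times the mass of the set where [f] is positive. *)
Lemma sliced_unique nu I J f : lf_measure nu ->
  positive_functional I -> positive_functional J ->
  sliced nu I -> sliced nu J -> Cc_ge0 f -> I f = J f.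
Proof.
move=> lfnu HI HJ sI sJ [cf f0].
have [K K0 fK] := Cc_bounded cf.
pose v k (delta : R) := fine (nu [set x | k%:R * delta < f x]).
have cT k delta : 0 <= delta -> Cc (trunc f (k%:R * delta)).
  by move=> d0; apply: Cc_trunc => //; rewrite mulr_ge0.
have step delta k : 0 < delta ->
    `|I (trunc f (k%:R * delta)) - J (trunc f (k%:R * delta))| <=
      delta * (v 0%N delta - v k delta).
  move=> d0; elim: k => [|k IH].
    have -> : trunc f (0%:R * delta) = fun=> 0.
      by apply/funext => x; rewrite /trunc mul0r min_r.
    by rewrite (functional0 HI) (functional0 HJ) !subrr normr0 mulr0.
  have kd : k%:R * delta < k.+1%:R * delta by rewrite ltr_pM2r// ltr_nat.
  have kd0 : 0 <= k%:R * delta by rewrite mulr_ge0// ltW.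
  have kdE : k.+1%:R * delta - k%:R * delta = delta.
    by rewrite -mulrBl -natrB// subSnn mul1r.
  have := sI f _ _ (conj cf f0) kd0 kd; have := sJ f _ _ (conj cf f0) kd0 kd.
  rewrite (functionalB HI) ?(functionalB HJ); do ?by apply: cT; exact: ltW.
  rewrite kdE.
  have vv : v k.+1 delta <= fine (nu [set x | k.+1%:R * delta <= f x]).
    rewrite fine_le ?ge0_fin_numE//.
    - by apply: lfnu; apply: level_bounded => //; rewrite mulr_ge0// ltW.
    - apply: le_lt_trans (lfnu _ (level_bounded cf kd0)).
      apply: le_measure; rewrite ?inE; [exact: level_le_borel|exact: level_borel|].
      by move=> x /=; apply: lt_le_trans.
    - apply: le_measure; rewrite ?inE; [exact: level_borel|exact: level_le_borel|].
      by move=> x /= /ltW.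
  move: IH; rewrite -/(v k delta) !ler_norml => /andP[h1 h2] /andP[j1 j2] /andP[i1 i2].
  have w : delta * v k.+1 delta <= delta * fine (nu [set x | k.+1%:R * delta <= f x]).
    by rewrite ler_pM2l.
  rewrite !mulrBr in h1 h2 *; apply/andP; split; lra.
apply/eqP; rewrite -subr_eq0 -normr_le0; apply/ler_addgt0Pr => e e0; rewrite add0r.
have V0 : 0 <= v 0%N 1 by rewrite fine_ge0.
pose delta := e / (v 0%N 1 + 1).
have d0 : 0 < delta by rewrite divr_gt0// ltr_wpDl.
have [k hk] : exists k : nat, K / delta < k%:R.
  by exists (Num.bound (K / delta)); apply: archi_boundP; rewrite divr_ge0// ltW.
have fE : trunc f (k%:R * delta) = f.
  apply/funext => x; rewrite /trunc min_l//.
  rewrite (le_trans (ler_norm _))// (le_trans (fK x))//.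
  by rewrite -ler_pdivrMr// ltW.
have := step delta k d0; rewrite fE => /le_trans; apply.
have -> : v 0%N delta = v 0%N 1 by rewrite /v !mul0r.
apply: (@le_trans _ _ (delta * (v 0%N 1 + 1))); last by rewrite /delta divfK// gt_eqF// ltr_wpDl.
rewrite ler_pM2l// lerD2l (@le_trans _ _ 0)// oppr_le0; exact: fine_ge0.
Qed.

Lemma functional_Rintegral (nu : {measure set BE -> \bar R}) : lf_measure nu ->
  positive_functional (fun f => \int[nu]_x f x).
Proof.
move=> lfnu; split=> [f g cf cg|a f cf|f cf f0].
- by rewrite RintegralD//; exact: integrable_Cc.
- by rewrite RintegralZl//; exact: integrable_Cc.
- by apply: Rintegral_ge0 => x _; exact: f0.
Qed.

Lemma Rintegral_indic_scale (nu : {measure set BE -> \bar R}) (A : set E) c :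
  bounded_borel A -> lf_measure nu ->
  nu.-integrable [set: BE] (EFin \o (fun x => c * \1_A x)) /\
  \int[nu]_x (c * \1_A x) = c * fine (nu A).
Proof.
move=> bA lfnu; have mA : measurable (A : set BE) by case: bA.
have int1 : nu.-integrable [set: BE] (EFin \o (\1_A : BE -> R)).
  apply: (@integrable_bounded_supp _ _ _ _ A 1) => //.
  - move=> x; rewrite indicE; case: (_ \in _) => /=; rewrite ?normr1 ?normr0 ?ler01//.
  - by move=> x nAx; rewrite indicE memNset.
split; last first.
  rewrite RintegralZl// /Rintegral integral_indic// setIT//.
have := integrableZl (@measurableT _ BE) c int1.
by congr (integrable _ _ _); apply/funext => x /=; rewrite EFinM.
Qed.

Lemma sliced_Rintegral (nu : {measure set BE -> \bar R}) : lf_measure nu ->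
  sliced nu (fun f => \int[nu]_x f x).
Proof.
move=> lfnu f s t [cf f0] s0 st.
have t0 : 0 < t := le_lt_trans s0 st.
have isl : nu.-integrable [set: BE] (EFin \o (fun x => trunc f t x - trunc f s x)).
  by apply: integrable_Cc => //; apply: Cc_sub; apply: Cc_trunc => //; exact: ltW.
have b1 : bounded_borel [set x | t <= f x].
  apply: bounded_borelS (level_bounded cf s0); first exact: level_le_borel.
  by move=> x /=; exact: lt_le_trans.
have [i1 e1] := Rintegral_indic_scale (t - s) b1 lfnu.
have [i2 e2] := Rintegral_indic_scale (t - s) (level_bounded cf s0) lfnu.
rewrite -e1 -e2; apply/andP; split; apply: le_Rintegral => // x _;
  have [h1 h2 h3 h4] := trunc_slice f x s0 st; rewrite indicE.
  have [ft|ft] := leP t (f x); first by rewrite mem_set// mulr1 h3.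
  by rewrite memNset ?mulr0//= => /le_lt_trans/(_ ft); rewrite ltxx.
have [fs|fs] := leP (f x) s; last by rewrite mem_set// mulr1.
by rewrite h4// mulr_ge0// subr_ge0 ltW.
Qed.

Context (L : (E -> R) -> R) (HL : positive_functional L).

Lemma riesz_outer_ge A g : Cc_ge0 g -> (forall x, g x <= 1) ->
  (forall x, ~ A x -> g x = 0) -> ((L g)%:E <= riesz_outer L A)%E.
Proof.
move=> cg g1 gA; apply: le_ereal_inf_tmp => _ [f [cf Af] <-].
apply: functional_sigma => // x; have [Ax|nAx] := pselect (A x).
  by apply: le_trans (Af x Ax); rewrite lee_fin.
by rewrite gA//; apply: nneseries_ge0 => i _ _; rewrite lee_fin; case: (cf i).
Qed.

Lemma riesz_outer_lf B : bounded_borel B -> (riesz_outer L B < +oo)%E.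
Proof.
move=> [_ /bounded_cball[M BM]].
have r0 : 0 < `|M| + 1 by rewrite ltr_wpDl.
apply: (@le_lt_trans _ _ (L (tent (`|M| + 1)))%:E); last exact: ltry.
apply: riesz_outer_le1 => //.
  by split; [exact: Cc_tent|move=> x; exact: tent_ge0].
move=> x /BM; rewrite /cball /= subr0 => xM; rewrite tent1//.
by rewrite (le_trans xM)// (le_trans (ler_norm _))// lerDl.
Qed.

(** The values of the outer measure on super-level sets bound [L] on slices from both
    sides, as the integral does; so the two functionals agree. *)
Theorem riesz_representation : exists nu : {measure set BE -> \bar R},
  lf_measure nu /\ forall f, Cc f -> \int[nu]_x f x = L f.
Proof.
have [nu nuE] := riesz_outer_measure HL.
have lfnu : lf_measure nu by move=> B bB; rewrite nuE; exact: riesz_outer_lf.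
exists nu; split => //.
have sL : sliced nu L.
  move=> f s t [cf f0] s0 st; have t0 : 0 < t := le_lt_trans s0 st.
  have ts : 0 < t - s by rewrite subr_gt0.
  pose g x := (t - s)^-1 * (trunc f t x - trunc f s x).
  have csl : Cc (fun x => trunc f t x - trunc f s x).
    by apply: Cc_sub; apply: Cc_trunc => //; exact: ltW.
  have cg : Cc_ge0 g.
    split; first exact: Cc_scale.
    move=> x; have [h _ _ _] := trunc_slice f x s0 st.
    by rewrite mulr_ge0// invr_ge0 ltW.
  have -> : L (fun x => trunc f t x - trunc f s x) = (t - s) * L g.
    case: HL => _ hZ _; rewrite -hZ; last by case: cg.
    by congr L; apply/funext => x; rewrite /g mulVKf// gt_eqF.
  rewrite !ler_pM2l//; apply/andP; split.
    rewrite -lee_fin fineK ?ge0_fin_numE//; last first.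
      apply: lfnu; apply: bounded_borelS (level_bounded cf s0).
        exact: level_le_borel.
      by move=> x /=; exact: lt_le_trans.
    rewrite nuE; apply: riesz_outer_le1 => // x /= tf.
    by have [_ _ h _] := trunc_slice f x s0 st; rewrite /g h// mulVf// gt_eqF.
  rewrite -lee_fin fineK ?ge0_fin_numE//; last by apply: lfnu; exact: level_bounded.
  rewrite nuE; apply: riesz_outer_ge => // x.
    have [_ h _ _] := trunc_slice f x s0 st.
    by rewrite /g mulrC ler_pdivrMr// mul1r.
  move=> /negP; rewrite -leNgt => fs; have [_ _ _ h] := trunc_slice f x s0 st.
  by rewrite /g h// mulr0.
have pos f : Cc_ge0 f -> \int[nu]_x f x = L f.
  apply: (@sliced_unique nu (fun f => \int[nu]_x f x) L) => //.
    exact: functional_Rintegral.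
  exact: sliced_Rintegral.
move=> f cf.
have [cf0 [M fM]] := cf.
pose p x := Num.max 0 (f x).
have cp : Cc_ge0 p.
  split; last by move=> x; rewrite /p le_max lexx.
  split; last by exists M => x /fM; rewrite /p => ->; rewrite max_l.
  by move=> x; apply: (@continuous_max R E (fun=> 0) f x); [exact: cst_continuous|exact: cf0].
have cq : Cc_ge0 (fun x => p x - f x).
  split; first by apply: Cc_sub => //; case: cp.
  by move=> x; rewrite subr_ge0 /p le_max lexx orbT.
have ip : nu.-integrable [set: BE] (EFin \o p) by apply: integrable_Cc => //; case: cp.
have := pos _ cq; rewrite RintegralB//; last exact: integrable_Cc.
rewrite (functionalB HL)//; last by case: cp.
rewrite (pos _ cp); lra.
Qed.

End RieszRepresentation.

(** * Vague compactness of locally bounded sequences of measures *)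

Section VagueCompactness.
Context {R : realType} {d : nat}.
Local Notation E := 'rV[R]_d.
Local Notation BE := (borelRd R d).

Lemma ultra_bounded_cvg (U : set_system nat) (u : nat -> R) K : UltraFilter U ->
  U [set n | `|u n| <= K] -> exists l : R, forall e, 0 < e -> U [set n | `|u n - l| < e].
Proof.
move=> uU UK; have PU : ProperFilter U  by exact: ultra_proper.
have [l [_ cl]] : [set` `[- K, K]] `&` cluster (u @ U) !=set0.
  apply: (@segment_compact R (- K) K); rewrite /nbhs /=.
  by move: UK; congr U; apply/seteqP; split => n /=; rewrite in_itv /= ler_norml.
exists l => e e0.
have [//|UC] := in_ultra_setVsetC [set n | `|u n - l| < e] uU.
have /cl : (u @ U) (u @` (~` [set n | `|u n - l| < e])).
  by rewrite /= ; apply: filterS UC => n h; exists n.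
move=> /(_ (ball l e)) /(_ (nbhsx_ballx _ _ e0)) [_ [[n /= hn <-]]].
by rewrite -ball_normE /= distrC.
Qed.

(** Along an ultrafilter every bounded sequence converges, which provides the
    candidates for the limits; countably many of them are then reached by one
    subsequence. *)
Lemma diagonal_subsequence (u : nat -> nat -> R) :
  (forall i, exists K, \forall j \near \oo, `|u i j| <= K) ->
  exists g : nat -> nat, (forall k, (g k < g k.+1)%N) /\
    exists l : nat -> R, forall i, u i \o g @ \oo --> l i.
Proof.
move=> bu; have [U [uU ooU]] := ultraFilterLemma (@eventually_filter).
have PU : ProperFilter U  by exact: ultra_proper.
have /choice[l hl] : forall i, exists l : R, forall e, 0 < e -> U [set n | `|u i n - l| < e].
  move=> i; have [K hK] := bu i; apply: (@ultra_bounded_cvg _ _ K) => //.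
  exact: ooU.
have good k : U [set n | forall i, (i <= k)%N -> `|u i n - l i| < k.+1%:R^-1].
  have : forall N, U [set n | forall i, (i < N)%N -> `|u i n - l i| < k.+1%:R^-1].
    elim=> [|N IH]; first by apply: filterS filterT.
    have := hl N (k.+1%:R^-1); rewrite invr_gt0 ltr0n => /(_ isT) hN.
    apply: filterS2 IH hN => n h1 h2 i; rewrite ltnS leq_eqVlt => /orP[/eqP -> //|].
    exact: h1.
  by move=> /(_ k.+1); apply: filterS => n h i ik; apply: h.
have /choice[next hnext] : forall kN : nat * nat, exists n, (kN.2 < n)%N /\
    forall i, (i <= kN.1)%N -> `|u i n - l i| < kN.1.+1%:R^-1.
  move=> [k N] /=; have UN : U [set n | (N < n)%N].
    by apply: ooU; exists N.+1.
  by have [n [h1 h2]] := filter_ex (filterI UN (good k)); exists n.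
pose g := fix g k := if k is k'.+1 then next (k, g k') else next (0, 0)%N.
exists g; split; first by move=> k /=; case: (hnext (k.+1, g k)).
exists l => i; apply/cvgrPdist_lt => e e0.
have [N hN] : exists N : nat, e^-1 < N%:R.
  by exists (Num.bound e^-1); apply: archi_boundP; rewrite invr_ge0 ltW.
exists (maxn i N) => // k /=; rewrite geq_max => /andP[ik Nk].
rewrite distrC.
have : `|u i (g k) - l i| < k.+1%:R^-1.
  case: k ik Nk => [|k] ik Nk /=.
    by case: (hnext (0, 0)%N) => _ /(_ i ik).
  by case: (hnext (k.+1, g k)) => _ /(_ i ik).
move=> /lt_trans; apply.
rewrite invf_plt ?posrE ?ltr0n// (lt_le_trans hN)// ler_nat.
exact: leq_trans Nk (leqnSn _).
Qed.

Definition rat_ball (n k : nat) : set E :=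
  if @unpickle 'rV[rat]_d k is Some q then oball (rat_point q) (2 ^- n) else set0.

(** For each [n] these sets are a countable Borel partition into pieces of
    diameter at most [2 * 2 ^- n]. *)
Definition rat_cell (n k : nat) : set E :=
  rat_ball n k `\` \bigcup_(i in `I_k) rat_ball n i.

Definition rat_center (k : nat) : E :=
  if @unpickle 'rV[rat]_d k is Some q then rat_point q else 0.

Lemma open_rat_ball n k : open (rat_ball n k).
Proof.
by rewrite /rat_ball; case: unpickle => [q|]; [exact: open_oball|exact: open0].
Qed.

Lemma rat_ballP n k x : rat_ball n k x -> `|x - rat_center k| < 2 ^- n.
Proof. by rewrite /rat_ball /rat_center; case: unpickle. Qed.

Lemma bounded_rat_cell n k : bounded_borel (rat_cell n k).
Proof.
apply: (bounded_borelS _ _ (bounded_borel_cball (rat_center k) (2 ^- n))).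
  apply: (@measurableD _ BE); first by apply: open_borel; exact: open_rat_ball.
  by apply: (@bigcup_measurable _ BE) => i _; apply: open_borel; exact: open_rat_ball.
by move=> x [/rat_ballP/ltW].
Qed.

Lemma rat_cell_disjoint n : trivIset setT (rat_cell n).
Proof.
move=> i j _ _ [x [[xi nxi] [xj nxj]]]; case: (ltngtP i j) => // ij.
  by case: nxj; exists i.
by case: nxi; exists j.
Qed.

Lemma rat_cell_cover n M : exists N, cball 0 M `<=` \bigcup_(k in `I_N) rat_cell n k.
Proof.
have n0 : 0 < 2 ^- n :> R by rewrite invr_gt0 exprn_gt0.
have /compact_near_coveringP/(_ nat \oo (fun N x => exists2 k, (k < N)%N & rat_ball n k x)) :=
  @compact_cball R d 0 M.
move=> h; have [|N _ hN] := h _.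
  move=> x _; have [q hq] := rat_point_dense x n0.
  have bx : rat_ball n (pickle q) x by rewrite /rat_ball pickleK /oball /= distrC.
  exists (rat_ball n (pickle q), [set N | (pickle q < N)%N]).
    split; last by exists (pickle q).+1.
    by apply: open_nbhs_nbhs; split => //; exact: open_rat_ball.
  by move=> [y N] /= [h1 h2]; exists (pickle q).
exists N => x /(hN N (leqnn N))[k kN kx].
have ex : exists k, `[< rat_ball n k x >] by exists k; apply/asboolP.
case: (ex_minnP ex) => k' /asboolP k'x kmin.
have k'k : (k' <= k)%N by apply: kmin; apply/asboolP.
exists k'; first exact: leq_ltn_trans kN.
split => // -[i /= ik' ix]; have := kmin i; rewrite leqNgt ik' => /(_ _)/negP.
by apply => //; apply/asboolP.
Qed.

Lemma riemann_cells (m : {measure set BE -> \bar R}) f n M N w :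
  lf_measure m -> Cc f -> (forall x, M < `|x| -> f x = 0) ->
  cball 0 (M + 1) `<=` \bigcup_(k in `I_N) rat_cell n k -> 
  (forall x y, `|x - y| < 2 ^- n -> `|f x - f y| <= w) -> 
  `|\int[m]_x f x - \sum_(k < N) f (rat_center k) * fine (m (rat_cell n k))| <=
    w * fine (m (cball 0 (M + 1))).
Proof.
move=> lfm cf fM cov osc.
have n1 : 2 ^- n <= 1 :> R by rewrite invf_le1 ?exprn_gt0// exprn_ege1// ler1n.
have w0 : 0 <= w by apply: le_trans (osc 0 0 _); rewrite subrr normr0// invr_gt0 exprn_gt0.
pose s x := \sum_(k < N) f (rat_center k) * \1_(rat_cell n k) x.
have hk k : m.-integrable [set: BE] (EFin \o (fun x => f (rat_center k) * \1_(rat_cell n k) x)) /\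
    \int[m]_x (f (rat_center k) * \1_(rat_cell n k) x) = f (rat_center k) * fine (m (rat_cell n k)).
  by apply: Rintegral_indic_scale => //; exact: bounded_rat_cell.
have is_ : m.-integrable [set: BE] (EFin \o s) /\
    \int[m]_x s x = \sum_(k < N) f (rat_center k) * fine (m (rat_cell n k)).
  rewrite /s; elim: N {cov s} => [|N [IH1 IH2]].
    rewrite big_ord0; split.
      apply: integrable_Cc => //; under [X in Cc X]eq_fun do rewrite big_ord0.
      exact: Cc_ge0_0.1.
    by under eq_Rintegral do rewrite big_ord0; rewrite Rintegral_cst// mul0r.
  have [h1 h2] := hk N; split.
    have := integrableD (@measurableT _ BE) IH1 h1.
    by congr (integrable _ _ _); apply/funext => x /=; rewrite big_ord_recr /= EFinD.
  under eq_Rintegral do rewrite big_ord_recr /=.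
  by rewrite RintegralD// big_ord_recr /= IH2 h2.
have bB := bounded_borel_cball (0 : E) (M + 1).
have [iw ew] := Rintegral_indic_scale w bB lfm.
rewrite -is_.2 -RintegralB//; [|exact: integrable_Cc|exact: is_.1].
rewrite -ew.
apply: le_trans (le_normr_Rintegral _ _) _ => //.
  have := integrableB (@measurableT _ BE) (integrable_Cc lfm cf) is_.1.
  by congr (integrable _ _ _); apply/funext => x /=; rewrite EFinB.
apply: le_Rintegral => //.
  have := integrable_norm (integrableB (@measurableT _ BE) (integrable_Cc lfm cf) is_.1).
  by congr (integrable _ _ _); apply/funext => x /=; rewrite EFinB.
move=> x _.
have one k : rat_cell n k x -> (k < N)%N -> s x = f (rat_center k).
  move=> kx kN; rewrite /s (bigD1 (Ordinal kN))//= big1 ?addr0.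
    by rewrite indicE mem_set// mulr1.
  move=> i ik; rewrite indicE memNset ?mulr0// => ix.
  move/negP: ik; apply; apply/eqP/val_inj => /=.
  by apply: (@rat_cell_disjoint n) => //; exists x.
have [xM|xM] := pselect (cball 0 (M + 1) x).
  rewrite indicE mem_set// mulr1.
  have [k /= kN kx] := cov x xM; rewrite (one k)//; apply: osc.
  by apply: rat_ballP; case: kx.
have {xM}xM : M + 1 < `|x| by move/negP: xM; rewrite /cball /= subr0 -ltNge.
rewrite indicE memNset ?mulr0; last by rewrite /cball /= subr0; apply/negP; rewrite -ltNge.
rewrite fM; last by apply: lt_trans xM; rewrite ltrDl.
rewrite sub0r normrN /s big1 ?normr0// => k _.
have [kx|kx] := pselect (rat_cell n k x); last by rewrite indicE memNset// mulr0.
rewrite fM ?mul0r//.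
have /rat_ballP kx' : rat_ball n k x by case: kx.
have := ler_normD (x - rat_center k) (rat_center k); rewrite subrK; lra.
Qed.

Lemma Cc_uniform (f : E -> R) e : Cc f -> 0 < e ->
  exists n : nat, forall x y, `|x - y| < 2 ^- n -> `|f x - f y| <= e.
Proof.
move=> [cf [M fM]] e0.
have /compact_near_coveringP/(_ nat \oo
  (fun n x => forall y, `|x - y| < 2 ^- n -> `|f x - f y| <= e)) :=
  @compact_cball R d 0 (M + 1).
move=> h; have [|N _ hN] := h _.
  move=> x _.
  have /cvgrPdist_lt/(_ (e / 2)) := cf x; rewrite divr_gt0// => /(_ isT).
  move=> /nbhs_ballP[r /= r0 hr].
  have [n hn] := exp2N_lt (divr_gt0 r0 (ltr0n R 2)).
  exists (ball x (r / 2), [set k | (n <= k)%N]).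
    by split; [exact/nbhsx_ballx/divr_gt0|exists n].
  move=> [y k] /= [xy nk] z yz.
  have kn : 2 ^- k <= 2 ^- n :> R.
    by rewrite lef_pV2 ?posrE ?exprn_gt0// ler_weXn2l// ler1n.
  have h1 : `|f x - f y| < e / 2.
    by apply: hr; apply: (@le_ball _ _ _ (r / 2)) xy; lra.
  have h2 : `|f x - f z| < e / 2.
    apply: hr; move: xy; rewrite -!ball_normE /= => xy.
    by rewrite -[x](subrK y) -addrA (le_lt_trans (ler_normD _ _))//; lra.
  have -> : f y - f z = (f x - f z) - (f x - f y) by ring.
  by rewrite (le_trans (ler_normB _ _))//; lra.
exists N => x y xy.
have [xM|xM] := leP `|x| (M + 1).
  by apply: (hN N (leqnn N)) => //; rewrite /cball /= subr0.
have N1 : 2 ^- N <= 1 :> R by rewrite invf_le1 ?exprn_gt0// exprn_ege1// ler1n.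
rewrite !fM; [by rewrite subrr normr0 ltW| |]; last by lra.
by have := ler_normD (x - y) y; rewrite subrK; lra.
Qed.

Lemma is_cvgn_sum (a : nat -> nat -> R) N : (forall k, cvgn (a k)) ->
  cvgn (fun j => \sum_(k < N) a k j).
Proof.
move=> ca; elim: N => [|N IH].
  by under eq_fun do rewrite big_ord0; exact: is_cvg_cst.
by under eq_fun do rewrite big_ord_recr /=; exact: is_cvgD.
Qed.

(** A subsequence makes the masses of all countably many cells converge.  Integrals of
    uniformly continuous functions are approximated by Riemann sums over the cells,
    uniformly along the sequence, hence converge too; their limit is a positive
    functional. *)
Theorem vague_compactness (m : nat -> {measure set BE -> \bar R}) :
  (forall j, lf_measure (m j)) ->
  (forall M, exists K, \forall j \near \oo, fine (m j (cball 0 M)) <= K) ->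
  exists g : nat -> nat, (forall k, (g k < g k.+1)%N) /\
    exists nu : {measure set BE -> \bar R}, lf_measure nu /\
      forall f, Cc f -> (fun k => \int[m (g k)]_x f x) @ \oo --> \int[nu]_x f x.
Proof.
move=> lfm bm.
pose u (i j : nat) := if @unpickle (nat * nat)%type i is Some (n, k)
  then fine (m j (rat_cell n k)) else 0.
have bu i : exists K, \forall j \near \oo, `|u i j| <= K.
  rewrite /u; case: unpickle => [[n k]|]; last first.
    by exists 0; apply: nearW => j; rewrite normr0.
  have [M hM] : exists M, rat_cell n k `<=` cball 0 M.
    by apply/bounded_cball; case: (bounded_rat_cell n k).
  have [K hK] := bm M; exists K; apply: filterS hK => j /=; apply: le_trans.
  rewrite ger0_norm ?fine_ge0// fine_le ?ge0_fin_numE//.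
  - by apply: lfm; exact: bounded_rat_cell.
  - by apply: lfm; exact: bounded_borel_cball.
  - by apply: le_measure; rewrite ?inE//; [case: (bounded_rat_cell n k)|exact: measurable_cball].
have [g [gS [l hl]]] := diagonal_subsequence bu.
exists g; split => //.
have goo : g @ \oo --> \oo.
  have gk k : (k <= g k)%N by elim: k => // k IH; exact: leq_ltn_trans (gS k).
  move=> A [N _ hN]; exists N => // k /= Nk; apply: hN => /=.
  exact: leq_trans (gk k).
have cv n k : cvgn (fun j => fine (m (g j) (rat_cell n k))).
  have := hl (pickle (n, k)); rewrite /u /comp; under eq_fun do rewrite pickleK.
  by move=> /cvgP.
have cvI f : Cc f -> cvgn (fun k => \int[m (g k)]_x f x).
  move=> cf; apply: cauchy_cvg; apply: cauchy_exP => e e0.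
  have [M fM] : exists M, forall x, M < `|x| -> f x = 0 by case: cf.
  have [K hK] := bm (M + 1).
  have K1 : 0 < `|K| + 1 by rewrite ltr_wpDl.
  have w0 : 0 < e / 2 / (`|K| + 1) by rewrite !divr_gt0.
  have [n hn] := Cc_uniform cf w0.
  have [N hN] := rat_cell_cover n (M + 1).
  pose s j := \sum_(k < N) f (rat_center k) * fine (m (g j) (rat_cell n k)).
  have cs : cvgn s.
    apply: (@is_cvgn_sum (fun k j => f (rat_center k) * fine (m (g j) (rat_cell n k)))).
    by move=> k; apply: is_cvgM; [exact: is_cvg_cst|exact: cv].
  exists (limn s).
  have /cvgrPdist_lt/(_ (e / 2)) := cs; rewrite divr_gt0// => /(_ isT) cs'.
  change (\forall k \near \oo, ball (limn s) e (\int[m (g k)]_x f x)).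
  near=> k.
  rewrite -ball_normE /= -[limn s](subrK (s k)) -addrA.
  apply: le_lt_trans (ler_normD _ _) _.
  have h1 : `|limn s - s k| < e / 2 by near: k.
  suff h2 : `|s k - \int[m (g k)]_x f x| <= e / 2 by lra.
  rewrite distrC (le_trans (riemann_cells (lfm _) cf fM hN hn))//.
  have hk : fine (m (g k) (cball 0 (M + 1))) <= K by near: k; exact: (goo _ hK).
  have := ler_norm K => KK.
  rewrite mulrAC ler_pdivrMr// ler_wpM2l//; first by rewrite divr_ge0// ltW.
  by lra.
pose L (f : E -> R) := limn (fun k => \int[m (g k)]_x f x).
have HL : positive_functional L.
  split=> [f h cf ch|a f cf|f cf f0].
  - rewrite /L -limD; [|exact: cvI|exact: cvI]; congr (limn _); apply/funext => k.
    by rewrite RintegralD//; apply: integrable_Cc.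
  - rewrite /L; apply: cvg_lim => //.
    have -> : (fun k => \int[m (g k)]_x (a * f x)) = (fun k => a * \int[m (g k)]_x f x).
      by apply/funext => k; rewrite RintegralZl//; apply: integrable_Cc.
    by apply: cvgM; [exact: cvg_cst|exact: cvI].
  - apply: limr_ge; first exact: cvI.
    by apply: nearW => k; apply: Rintegral_ge0 => x _.
have [nu [lfnu nuL]] := riesz_representation HL.
exists nu; split => // f cf; rewrite nuL//; exact: cvI.
Unshelve. all: by end_near. Qed.

End VagueCompactness.

(** * Lebesgue points along doubling balls *)

Section Differentiation.
Context {R : realType} {d : nat}.
Local Notation E := 'rV[R]_d.
Local Notation BE := (borelRd R d).
Implicit Types (m lam : {measure set BE -> \bar R}) (A B S U : set E).

Lemma finite_measure_fin m A : (m setT < +oo)%E -> measurable (A : set BE) ->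
  m A \is a fin_num.
Proof.
move=> fm mA; rewrite ge0_fin_numE// (le_lt_trans _ fm)//.
by apply: le_measure => //; rewrite inE.
Qed.

(** Inner and outer regularity together form a property that is stable under
    complements and countable unions. *)
Definition regular_set m A := forall e, 0 < e ->
  exists C U, [/\ closed C, open U, C `<=` A, A `<=` U & (m (U `\` C) < e%:E)%E].

Lemma regular_setC m A : regular_set m A -> regular_set m (~` A).
Proof.
move=> rA e e0; have [C [U [cC oU CA AU h]]] := rA e e0.
exists (~` U), (~` C); split.
- exact: open_closedC.
- exact: closed_openC.
- exact: subsetC.
- exact: subsetC.
- by rewrite setDE setCK setIC -setDE.
Qed.

(** The countable union of the closed sets need not be closed: a finite part of it is
    used, by continuity from above. *)
Lemma regular_bigcup m (A : nat -> set E) : (m setT < +oo)%E ->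
  (forall i, regular_set m (A i)) -> regular_set m (\bigcup_i A i).
Proof.
move=> fm rA e e0.
have /choice[CU hCU] : forall i, exists CU : set E * set E,
    [/\ closed CU.1, open CU.2, CU.1 `<=` A i, A i `<=` CU.2 &
     (m (CU.2 `\` CU.1) < (e / 2 / (2 ^ i.+1)%:R)%:E)%E].
  move=> i; have [|C [U hh]] := rA i (e / 2 / (2 ^ i.+1)%:R).
    by rewrite !divr_gt0// ltr0n expn_gt0.
  by exists (C, U).
pose C i := (CU i).1; pose U i := (CU i).2.
have cC i : closed (C i) by case: (hCU i).
have oU i : open (U i) by case: (hCU i).
have mC i : measurable (C i : set BE) by exact: closed_borel.
have mU i : measurable (U i : set BE) by exact: open_borel.
have mUU : measurable (\bigcup_i U i : set BE) by exact: (@bigcup_measurable _ BE).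
have mCC : measurable (\bigcup_i C i : set BE) by exact: (@bigcup_measurable _ BE).
pose F N := \bigcup_i U i `\` \bigcup_(i in `I_N) C i.
have mF N : measurable (F N : set BE).
  by apply: (@measurableD _ BE) => //; exact: (@bigcup_measurable _ BE).
have FE : \bigcap_N F N = \bigcup_i U i `\` \bigcup_i C i.
  apply/seteqP; split => [x Fx|x [Ux nCx] N _].
    split; first by case: (Fx 0%N I).
    by move=> [i _ Cx]; have [_] := Fx i.+1 I; apply; exists i => /=.
  by split => // -[i _ Cx]; apply: nCx; exists i.
have cv : (m \o F) @ \oo --> m (\bigcap_N F N).
  apply: (@nonincreasing_cvg_mu _ BE) => //.
  - by rewrite (le_lt_trans _ fm)//; apply: le_measure => //; rewrite inE//; exact: mF.
  - rewrite FE; exact: (@measurableD _ BE).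
  - move=> i j ij; apply/subsetPset => x [Ux nCx]; split => // -[k /= ki Ck].
    by apply: nCx; exists k => //=; exact: leq_trans ij.
have lim_le : (m (\bigcap_N F N) <= (e / 2)%:E)%E.
  rewrite FE.
  apply: (@le_trans _ _ (\sum_(i <oo) m (U i `\` C i))%E).
    apply: measure_sigma_subadditive => //.
    - by move=> i; exact: (@measurableD _ BE).
    - exact: (@measurableD _ BE).
    - move=> x [[i _ Ux] nCx]; exists i => //; split => // Cx.
      by apply: nCx; exists i.
  apply: le_trans (epsilon_trick0 xpredT _); last by rewrite divr_ge0// ltW.
  by apply: lee_nneseries => // i _; apply/ltW; case: (hCU i).
have [N hN] : exists N, (m (F N) < e%:E)%E.
  have lt : (m (\bigcap_N F N) < e%:E)%E.
    by rewrite (le_lt_trans lim_le)// lte_fin; lra.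
  have nb : nbhs (m (\bigcap_N F N)) [set y | (y < e%:E)%E].
    by apply: open_nbhs_nbhs; split => //; exact: open_ereal_lt_ereal.
  by have [N _ hN] := cv _ nb; exists N; exact: (hN N (leqnn N)).
exists (\bigcup_(i in `I_N) C i), (\bigcup_i U i); split => //.
- rewrite bigcup_mkord; apply: closed_bigsetU => i _; exact: cC.
- by apply: bigcup_open.
- by move=> x [i _ Cx]; exists i => //; case: (hCU i) => _ _ h _ _; exact: h.
- by move=> x [i _ Ax]; exists i => //; case: (hCU i) => _ _ _ h _; exact: h.
Qed.

Lemma regular_cball m x r : (m setT < +oo)%E -> regular_set m (~` cball x r).
Proof.
move=> fm; apply: regular_setC => e e0.
pose F (n : nat) := oball x (r + n.+1%:R^-1) `\` cball x r.
have mF N : measurable (F N : set BE).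
  by apply: (@measurableD _ BE); [apply: open_borel; exact: open_oball|exact: measurable_cball].
have FE : \bigcap_N F N = set0.
  apply/seteqP; split => // y Fy.
  have [_ /negP] := Fy 0%N I; rewrite /cball /= -ltNge => yr.
  have [N hN] : exists N : nat, (`|y - x| - r)^-1 < N%:R.
    by exists (Num.bound (`|y - x| - r)^-1); apply: archi_boundP; rewrite invr_ge0; lra.
  have [] := Fy N I; rewrite /oball /= => h _.
  have : N.+1%:R^-1 < `|y - x| - r.
    by rewrite invf_plt ?posrE ?ltr0n ?subr_gt0// (lt_trans hN)// ltr_nat.
  move: h; move: (N.+1%:R^-1) => z; lra.
have cv : (m \o F) @ \oo --> m (\bigcap_N F N).
  apply: (@nonincreasing_cvg_mu _ BE) => //.
  - by rewrite (le_lt_trans _ fm)//; apply: le_measure => //; rewrite inE//; exact: mF.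
  - by rewrite FE.
  - move=> i j ij; apply/subsetPset => y [h nC]; split => //.
    apply: lt_le_trans h _; rewrite lerD2l lef_pV2 ?posrE ?ltr0n//.
    by rewrite ler_nat ltnS.
have nb : nbhs (m (\bigcap_N F N)) [set y | (y < e%:E)%E].
  apply: open_nbhs_nbhs; split; first exact: open_ereal_lt_ereal.
  by rewrite /= FE measure0 lte_fin.
have [N _ hN] := cv _ nb.
exists (cball x r), (oball x (r + N.+1%:R^-1)); split.
- exact: closed_cball.
- exact: open_oball.
- by [].
- by move=> y; rewrite /cball /oball /= => /le_lt_trans; apply; rewrite ltrDl invr_gt0.
- exact: (hN N (leqnn N)).
Qed.

Lemma regular_oball m x r : (m setT < +oo)%E -> regular_set m (oball x r).
Proof.
move=> fm.
have -> : oball x r = \bigcup_n cball x (r - n.+1%:R^-1).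
  apply/seteqP; split => [y|y [n _]]; rewrite /oball /cball /=.
    move=> yr.
    have [N hN] : exists N : nat, (r - `|y - x|)^-1 < N%:R.
      by exists (Num.bound (r - `|y - x|)^-1); apply: archi_boundP; rewrite invr_ge0; lra.
    exists N => //=.
    have : N.+1%:R^-1 < r - `|y - x|.
      by rewrite invf_plt ?posrE ?ltr0n ?subr_gt0// (lt_trans hN)// ltr_nat.
    move: (N.+1%:R^-1) => z; lra.
  by move=> /le_lt_trans; apply; rewrite ltrBlDr ltrDl invr_gt0.
apply: regular_bigcup => // n.
by rewrite -[cball _ _]setCK; apply: regular_setC; exact: regular_cball.
Qed.

Lemma borel_regular m A : (m setT < +oo)%E -> measurable (A : set BE) ->
  regular_set m A.
Proof.
move=> fm; move: A; apply: smallest_sub.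
  have r0 : regular_set m set0.
    move=> e e0; exists set0, set0; split; [exact: closed0|exact: open0|by []|by []|].
    by rewrite set0D measure0 lte_fin.
  split => //.
  - by move=> A rA; rewrite setTD; exact: regular_setC.
  - by move=> F rF; exact: regular_bigcup.
move=> U /open_bigcup_oball[B [hB ->]]; apply: regular_bigcup => // k.
have [->|[x [r ->]]] := hB k; last exact: regular_oball.
move=> e e0; exists set0, set0; split; [exact: closed0|exact: open0|by []|by []|].
by rewrite set0D measure0 lte_fin.
Qed.

Lemma outer_regular m A e : (m setT < +oo)%E -> measurable (A : set BE) -> 0 < e ->
  exists U, [/\ open U, A `<=` U & (m (U `\` A) < e%:E)%E].
Proof.
move=> fm mA e0; have [C [U [cC oU CA AU h]]] := borel_regular fm mA e0.
exists U; split => //; apply: le_lt_trans h.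
apply: le_measure; rewrite ?inE.
- by apply: (@measurableD _ BE) => //; exact: open_borel.
- by apply: (@measurableD _ BE); [exact: open_borel|exact: closed_borel].
- exact: setDS.
Qed.

(** Greedy choice: the largest ball comes first, and the balls that meet it lie in its
    threefold enlargement. *)
Lemma finite_vitali (s : seq (E * R)) : (forall b, b \in s -> 0 <= b.2) ->
  exists s' : seq (E * R), [/\ uniq s', {subset s' <= s},
    forall b c, b \in s' -> c \in s' -> b != c ->
      cball b.1 b.2 `&` cball c.1 c.2 = set0 &
    forall b, b \in s -> exists2 c, c \in s' & cball b.1 b.2 `<=` cball c.1 (3 * c.2)].
Proof.
have [n] := ubnP (size s); elim: n s => // n IH s sn s0.
case: (eqVneq s [::]) => [->|sN]; first by exists [::].
have [b [bs bmax]] : exists b, b \in s /\ forall c, c \in s -> c.2 <= b.2.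
  elim: s sN {sn s0} => // a [|c s] IHs _.
    by exists a; split => [|c]; rewrite inE// => /eqP ->.
  have [//|b [bs bmax]] := IHs.
  have [ab|ba] := leP a.2 b.2.
    exists b; split; first by rewrite in_cons bs orbT.
    by move=> e; rewrite in_cons => /orP[/eqP ->|/bmax].
  exists a; split; first by rewrite in_cons eqxx.
  move=> e; rewrite in_cons => /orP[/eqP -> //|/bmax]; move=> /le_trans; apply.
  exact: ltW.
pose t := [seq c <- s | `[< cball b.1 b.2 `&` cball c.1 c.2 = set0 >]].
have cc (e : E * R) : 0 <= e.2 -> cball e.1 e.2 e.1.
  by move=> e0; rewrite /cball /= subrr normr0.
have [||s' [us' s's ds' cs']] := IH t.
- suff ts : (size t < size s)%N by apply: leq_trans ts _.
  rewrite size_filter -(count_predC (fun c => `[< cball b.1 b.2 `&` cball c.1 c.2 = set0 >]) s).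
  rewrite -addn1 leq_add2l -has_count; apply/hasP; exists b => //=.
  by apply/asboolP => h; have : set0 b.1 by rewrite -h; split; exact/cc/s0.
- by move=> c; rewrite mem_filter => /andP[_ /s0].
exists (b :: s'); split.
- rewrite /= us' andbT; apply/negP => /s's; rewrite mem_filter => /andP[/asboolP h _].
  by have : set0 b.1 by rewrite -h; split; exact/cc/s0.
- move=> c; rewrite in_cons => /orP[/eqP -> //|/s's].
  by rewrite mem_filter => /andP[].
- move=> c e; rewrite !in_cons => /orP[/eqP ->|cs] /orP[/eqP ->|es] ce.
  + by rewrite eqxx in ce.
  + by have := s's _ es; rewrite mem_filter => /andP[/asboolP].
  + by have := s's _ cs; rewrite mem_filter => /andP[/asboolP h _]; rewrite setIC.
  + exact: ds'.
- move=> c cs; have [bc|bc] := pselect (cball b.1 b.2 `&` cball c.1 c.2 = set0).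
    have [|e es' ce] := cs' c; first by rewrite mem_filter cs andbT; apply/asboolP.
    by exists e => //; rewrite in_cons es' orbT.
  exists b; first by rewrite in_cons eqxx.
  have /eqP/set0P[z [bz cz]] := bc.
  have c2 := bmax c cs.
  move=> y; rewrite /cball /= in bz cz * => yc.
  have := ler_distD c.1 y b.1; have := ler_distD z c.1 b.1.
  by rewrite (distrC c.1 z); lra.
Qed.

Lemma negligible_small m A :
  (forall e, 0 < e -> exists B, [/\ measurable (B : set BE), A `<=` B & (m B <= e%:E)%E]) ->
  m.-negligible A.
Proof.
move=> h.
have /choice[B hB] : forall n : nat, exists B, [/\ measurable (B : set BE), A `<=` B &
    (m B <= (n.+1%:R^-1)%:E)%E].
  by move=> n; apply: h; rewrite invr_gt0.
exists (\bigcap_n B n); split.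
- by apply: (@bigcap_measurable _ BE) => // n _; case: (hB n).
- apply/eqP; rewrite eq_le measure_ge0 andbT.
  apply/lee_addgt0Pr => e e0; rewrite add0e.
  have [N hN] : exists N : nat, e^-1 < N%:R.
    by exists (Num.bound e^-1); apply: archi_boundP; rewrite invr_ge0 ltW.
  have [mB _ leB] := hB N.
  apply: le_trans (_ : (m (B N) <= _)%E).
    apply: le_measure; rewrite ?inE//; last by move=> x /(_ N I).
    by apply: (@bigcap_measurable _ BE) => // n _; case: (hB n).
  apply: le_trans leB _; rewrite lee_fin ltW// invf_plt ?posrE ?ltr0n//.
  by rewrite (lt_trans hN)// ltr_nat.
- by move=> x Ax n _; case: (hB n) => _ AB _; exact: AB.
Qed.

Lemma measure_seq_disjoint m (s : seq (E * R)) (F : E * R -> set E) :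
  (m setT < +oo)%E -> (forall c, measurable (F c : set BE)) -> uniq s ->
  (forall b c, b \in s -> c \in s -> b != c -> F b `&` F c = set0) ->
  fine (m (\big[setU/set0]_(c <- s) F c)) = \sum_(c <- s) fine (m (F c)).
Proof.
move=> fm mF; elim: s => [|b s IH] /=; first by rewrite !big_nil measure0.
move=> /andP[bs us] ds; rewrite !big_cons.
have mU : measurable (\big[setU/set0]_(c <- s) F c : set BE).
  by apply: (@bigsetU_measurable _ BE).
rewrite measureU//; last first.
  rewrite -bigcup_seq; apply/seteqP; split => // x [bx [c /= cs cx]].
  have bc : b != c by apply/eqP => bc; move: bs; rewrite bc cs.
  have := ds b c; rewrite !inE eqxx cs orbT => /(_ isT isT bc) h.
  by have : (F b `&` F c) x by []; rewrite h.
rewrite fineD ?finite_measure_fin// IH// => c e cs es.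
by apply: ds; rewrite inE ?cs ?es orbT.
Qed.

Lemma measure_seq_le m (s : seq (E * R)) (F : E * R -> set E) :
  (m setT < +oo)%E -> (forall c, measurable (F c : set BE)) ->
  fine (m (\big[setU/set0]_(c <- s) F c)) <= \sum_(c <- s) fine (m (F c)).
Proof.
move=> fm mF; elim: s => [|b s IH]; first by rewrite !big_nil measure0.
rewrite !big_cons.
have mU : measurable (\big[setU/set0]_(c <- s) F c : set BE).
  by apply: (@bigsetU_measurable _ BE).
apply: le_trans (lerD (lexx _) IH).
rewrite -fineD ?finite_measure_fin// fine_le ?finite_measure_fin//.
- exact: (@measurableU _ BE).
- by rewrite fin_numD !finite_measure_fin.
- exact: measureU2.
Qed.

Definition dyball (x : E) (n : nat) := cball x (2 ^- n).

(** Each ball is replaced by one ball of the same radius that is chosen for a rational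
    point near its centre. *)
Lemma countable_dyadic_cover (P : E -> nat -> Prop) :
  exists b : nat -> option (E * nat),
    (forall k x n, b k = Some (x, n) -> P x n) /\
    forall x n, P x n -> exists k y i, b k = Some (y, i) /\ dyball y i x.
Proof.
pose near (q : 'rV[rat]_d) n x := P x n /\ `|rat_point q - x| < 2 ^- n / 2.
pose b (k : nat) : option (E * nat) :=
  if @unpickle ('rV[rat]_d * nat)%type k is Some (q, n) then
    if pselect (exists x, near q n x) is left ex then Some (sval (cid ex), n) else None
  else None.
exists b; split.
  move=> k x n; rewrite /b; case: unpickle => [[q i]|//].
  by case: pselect => // ex [<- <-]; case: cid => y [].
move=> x n Pxn.
have [q hq] : exists q, `|rat_point q - x| < 2 ^- n / 2.
  by apply: rat_point_dense; rewrite divr_gt0// invr_gt0 exprn_gt0.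
exists (pickle (q, n)); rewrite /b pickleK; case: pselect => [ex|]; last first.
  by move=> []; exists x.
case: cid => y [Py hy] /=; exists y, n; split => //.
rewrite /dyball /cball /=.
have := ler_distD (rat_point q) x y; rewrite (distrC x (rat_point q)); lra.
Qed.

(** Exceptional balls fit into a neighbourhood of [S] that has little [lam]-mass outside
    [S].  Disjoint ones among them have [lam]-mass at least [t] times their [m]-mass, at
    most [s] times of which comes from [S]; hence their [m]-mass is small, and doubling
    turns them into a cover. *)
Lemma density_bound m lam S s t D : (m setT < +oo)%E -> (lam setT < +oo)%E ->
  measurable (S : set BE) ->
  (forall A, measurable (A : set BE) -> A `<=` S -> fine (lam A) <= s * fine (m A)) ->
  0 <= s -> s < t -> 0 <= D ->
  m.-negligible [set x | S x /\ forall N, exists n, [/\ (N <= n)%N,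
    fine (m (cball x (3 * 2 ^- n))) <= D * fine (m (dyball x n)) &
    t * fine (m (dyball x n)) <= fine (lam (dyball x n))]].
Proof.
move=> fm fl mS lS s0 st D0; apply: negligible_small => e e0.
(* If [M] is the total mass of the disjoint balls, then [(t - s) M <= e'], while the
   threefold balls have total mass at most [D M]. *)
pose e' := e * (t - s) / (D + 1).
have e'0 : 0 < e' by rewrite divr_gt0 ?mulr_gt0 ?subr_gt0// ltr_wpDl.
have [U [oU SU hU]] := outer_regular fl mS e'0.
pose P x n := [/\ dyball x n `<=` U,
    fine (m (cball x (3 * 2 ^- n))) <= D * fine (m (dyball x n)) &
    t * fine (m (dyball x n)) <= fine (lam (dyball x n))].
have [b [bP bcov]] := countable_dyadic_cover P.
pose B k := if b k is Some (x, n) then dyball x n else set0.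
have mB k : measurable (B k : set BE).
  by rewrite /B; case: (b k) => [[x n]|//]; exact: measurable_cball.
exists (\bigcup_k B k); split.
- exact: (@bigcup_measurable _ BE).
- move=> x [Sx hx].
  have [r /= r0 hr] : exists2 r : R, 0 < r & ball x r `<=` U.
    have /nbhs_ballP[r r0 hr] : nbhs x U by apply: open_nbhs_nbhs; split => //; exact: SU.
    by exists r.
  have [N hN] := exp2N_lt r0.
  have [n [Nn h1 h2]] := hx N.
  have Pxn : P x n.
    split => // y; rewrite /dyball /cball /= => yx; apply: hr.
    rewrite -ball_normE /= distrC (le_lt_trans yx)// (le_lt_trans _ hN)//.
    by rewrite lef_pV2 ?posrE ?exprn_gt0// ler_weXn2l// ler1n.
  have [k [y [i [bk yx]]]] := bcov _ _ Pxn.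
  by exists k => //; rewrite /B bk.
have finm A : measurable (A : set BE) -> m A \is a fin_num by exact: finite_measure_fin.
have finl A : measurable (A : set BE) -> lam A \is a fin_num by exact: finite_measure_fin.
have fin_cover N : (m (\bigcup_(k in `I_N) B k) <= e%:E)%E.
  pose s0' := pmap b (iota 0 N).
  pose sb := [seq (xn.1, 2 ^- xn.2 : R) | xn <- s0'].
  have sbP c : c \in sb -> exists n, P c.1 n /\ c.2 = 2 ^- n.
    move=> /mapP[[x n]]; rewrite mem_pmap => /mapP[k _ /esym bk] -> /=.
    by exists n; split => //; exact: bP bk.
  have [|s' [us' s's ds' cs']] := @finite_vitali sb.
    by move=> c /sbP[n [_ ->]]; rewrite invr_ge0 exprn_ge0.
  have m1 c : measurable (cball c.1 c.2 : set BE) by exact: measurable_cball.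
  have m3 c : measurable (cball c.1 (3 * c.2) : set BE) by exact: measurable_cball.
  have cover : \bigcup_(k in `I_N) B k `<=` \big[setU/set0]_(c <- s') cball c.1 (3 * c.2).
    move=> x [k /= kN]; rewrite /B; case bk : (b k) => [[y n]|//] yx.
    have ysb : (y, 2 ^- n) \in sb.
      apply/mapP; exists (y, n) => //; rewrite mem_pmap -bk; apply: map_f.
      by rewrite mem_iota.
    have [c cins sub] := cs' _ ysb.
    by rewrite -bigcup_seq; exists c => //; exact: sub.
  pose V : set E := \big[setU/set0]_(c <- s') cball c.1 c.2.
  have mV : measurable (V : set BE) by apply: (@bigsetU_measurable _ BE).
  have VU : V `<=` U.
    by rewrite /V -bigcup_seq => x [c /s's/sbP[n [[h _ _] cn]]]; rewrite cn => /h.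
  pose M := \sum_(c <- s') fine (m (cball c.1 c.2)).
  have mVE : fine (m V) = M by exact: measure_seq_disjoint.
  have lVE : fine (lam V) = \sum_(c <- s') fine (lam (cball c.1 c.2)).
    exact: measure_seq_disjoint.
  have tM : t * M <= fine (lam V).
    rewrite lVE mulr_sumr !big_seq; apply: ler_sum => c /s's/sbP[n [[_ _ h] cn]].
    by rewrite cn.
  have mVS : measurable (V `&` S : set BE) by exact: (@measurableI _ BE).
  have mVD : measurable (V `\` S : set BE) by exact: (@measurableD _ BE).
  have mUD : measurable (U `\` S : set BE).
    by apply: (@measurableD _ BE) => //; exact: open_borel.
  have lV : fine (lam V) <= s * M + e'.
    rewrite (measureDI lam mV mS) fineD ?finl// addrC lerD//.
      apply: le_trans (lS _ mVS _) _; first by move=> x [].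
      rewrite -mVE ler_wpM2l// fine_le ?finm//.
      by apply: le_measure; rewrite ?inE//; exact: subIsetl.
    rewrite -lee_fin fineK ?finl//; apply: le_trans (ltW hU).
    by apply: le_measure; rewrite ?inE//; exact: setSD.
  have Me : (t - s) * M <= e' by rewrite mulrBl lerBlDl (le_trans tM).
  have M0 : 0 <= M by apply: sumr_ge0 => c _; rewrite fine_ge0.
  have mW : measurable (\big[setU/set0]_(c <- s') cball c.1 (3 * c.2) : set BE).
    by apply: (@bigsetU_measurable _ BE).
  apply: le_trans (_ : (m (\big[setU/set0]_(c <- s') cball c.1 (3 * c.2)) <= _)%E).
    by apply: le_measure; rewrite ?inE//; exact: (@bigcup_measurable _ BE).
  rewrite -[m _]fineK ?finm// lee_fin.
  apply: le_trans (measure_seq_le _ _ _) _ => //.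
  apply: (@le_trans _ _ (D * M)).
    rewrite mulr_sumr !big_seq; apply: ler_sum => c /s's/sbP[n [[_ h _] cn]].
    by rewrite cn.
  have ts : 0 < t - s by rewrite subr_gt0.
  have MM : M <= e / (D + 1).
    by rewrite -(ler_pM2l ts) (le_trans Me)// /e' mulrCA mulrA.
  apply: (@le_trans _ _ ((D + 1) * (e / (D + 1)))).
    by apply: ler_pM => //; rewrite lerDl.
  by rewrite mulrC divfK// gt_eqF// ltr_wpDl.
pose F N := \bigcup_(k in `I_N) B k.
have -> : \bigcup_k B k = \bigcup_N F N.
  apply/seteqP; split => [x [k _ Bx]|x [N _ [k _ Bx]]]; last by exists k.
  by exists k.+1 => //; exists k => /=.
have cv : (m \o F) @ \oo --> m (\bigcup_N F N).
  apply: (@nondecreasing_cvg_mu _ BE).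
  - by move=> N; exact: (@bigcup_measurable _ BE).
  - apply: (@bigcup_measurable _ BE) => N _; exact: (@bigcup_measurable _ BE).
  - move=> i j ij; apply/subsetPset => x [k /= ki Bk]; exists k => //=.
    exact: leq_trans ij.
rewrite -(cvg_lim _ cv)//; apply: lime_le; first exact: (cvgP _ cv).
by apply: nearW => N; exact: fin_cover.
Qed.

(** For each rational [q] the measure [`|p - q| m] has density at most [e] on the set
    where [`|p - q| <= e], so [density_bound] applies; a value [p x] is then
    approximated by rationals. *)
Theorem doubling_lebesgue_point m (p : E -> R) : (m setT < +oo)%E ->
  m.-integrable [set: BE] (EFin \o (p : BE -> R)) ->
  exists N : set E, m.-negligible N /\ forall x, ~ N x -> forall D e, 0 < e ->
    \forall n \near \oo,
      fine (m (cball x (3 * 2 ^- n))) <= D * fine (m (dyball x n)) ->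
      \int[m]_(y in dyball x n) `|p y - p x| <= e * fine (m (dyball x n)).
Proof.
move=> fm ip.
have mp : measurable_fun [set: BE] (p : BE -> R).
  by apply/measurable_EFinP; exact: (measurable_int m).
have icst (c : R) : m.-integrable [set: BE] (EFin \o (fun=> c)).
  apply: measurable_bounded_integrable => //.
  by exists `|c|; split; [exact: num_real|move=> M cM y _ /=; exact: ltW].
have iq (c : R) : m.-integrable [set: BE] (EFin \o (fun y => `|p y - c|)).
  have := integrable_norm (integrableB (@measurableT _ BE) ip (icst c)).
  by congr (integrable _ _ _); apply/funext => y /=; rewrite EFinB.
have /choice[lam hlam] : forall q : R, exists lam : {measure set BE -> \bar R},
    (lam : set BE -> \bar R) = (fun A => \int[m]_(y in A) (`|p y - q|)%:E)%E.
  move=> q; apply: exists_measure.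
  - by rewrite integral_set0.
  - by move=> A; apply: integral_ge0 => y _; rewrite lee_fin.
  - apply: semi_sigma_additive_nng_induced; last by move=> y; rewrite lee_fin.
    exact: (measurable_int m (iq q)).
have flam q : (lam q setT < +oo)%E.
  rewrite hlam; have /integrableP[_] := iq q.
  by under eq_integral do rewrite /= normr_id.
pose S q k := [set x : E | `|p x - ratr q| < k.+1%:R^-1].
have mS q k : measurable (S q k : set BE).
  have -> : S q k = (fun y => `|p y - ratr q|) @^-1` `]-oo, k.+1%:R^-1[.
    by apply/seteqP; split => y; rewrite /S /= in_itv.
  rewrite -[X in measurable X]setTI.
  have : measurable_fun [set: BE] (fun y : BE => `|p y - ratr q|).
    apply: measurableT_comp => //; apply: measurable_funB => //.
  by apply => //; exact: measurable_itv.
pose bad q k := [set x | S q k x /\ forall N, exists n, [/\ (N <= n)%N,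
    fine (m (cball x (3 * 2 ^- n))) <= k%:R * fine (m (dyball x n)) &
    2 / k.+1%:R * fine (m (dyball x n)) <= fine (lam (ratr q) (dyball x n))]].
have nbad q k : m.-negligible (bad q k).
  have k0 : 0 < k.+1%:R^-1 :> R by rewrite invr_gt0.
  apply: (@density_bound m (lam (ratr q)) (S q k) k.+1%:R^-1) => //.
  - move=> A mA AS; rewrite hlam -/(Rintegral _ _ _) -Rintegral_cst//.
    apply: le_Rintegral => //.
    + exact: (integrableS (@measurableT _ BE)).
    + exact: (integrableS (@measurableT _ BE)).
    + by move=> y /AS/ltW.
  - by move: k0; move: (k.+1%:R^-1) => z; lra.
pose bad' (i : nat) : set E :=
  if @unpickle (rat * nat)%type i is Some (q, k) then bad q k else set0.
exists (\bigcup_i bad' i); split.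
  apply: negligible_bigcup => i; rewrite /bad'; case: unpickle => [[q k]|] //.
  exact: negligible_set0.
move=> x nbx D e e0.
have [k hk] : exists k : nat, `|D| + 3 / e < k%:R.
  by exists (Num.bound (`|D| + 3 / e)); apply: archi_boundP; rewrite addr_ge0// divr_ge0// ltW.
have k1 : 0 < k.+1%:R :> R by rewrite ltr0n.
have e3 : 0 <= 3 / e by rewrite divr_ge0// ltW.
have Dk : D <= k%:R.
  by have := ler_norm D; lra.
have ek : 3 / k.+1%:R <= e.
  rewrite ler_pdivrMr// -ler_pdivrMl// mulrC.
  rewrite (@le_trans _ _ k%:R)//; last by rewrite ler_nat.
  by have := normr_ge0 D; lra.
have [q hq] : exists q : rat, `|p x - ratr q| < k.+1%:R^-1.
  have /rat_in_itvoo[q] : p x - k.+1%:R^-1 < p x + k.+1%:R^-1.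
    by rewrite ltrBlDr -addrA ltrDl addr_gt0// invr_gt0.
  by rewrite in_itv /= => h; exists q; rewrite distrC ltr_distl.
have nb : ~ bad q k x.
  have bE : bad' (pickle (q, k)) = bad q k by rewrite /bad' pickleK.
  by move=> bx; apply: nbx; exists (pickle (q, k)); [exact: I|rewrite bE; exact: bx].
have [N hN] : exists N, forall n, (N <= n)%N ->
    fine (m (cball x (3 * 2 ^- n))) <= k%:R * fine (m (dyball x n)) ->
    fine (lam (ratr q) (dyball x n)) < 2 / k.+1%:R * fine (m (dyball x n)).
  apply: contrapT => /forallNP h; apply: nb; split => // N.
  apply: contrapT => /forallNP h'; apply: (h N) => n Nn hn.
  by rewrite ltNge; apply/negP => h2; apply: (h' n).
exists N => // n /= Nn hD.
have m0 : 0 <= fine (m (dyball x n)) by rewrite fine_ge0.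
have lq := hN n Nn (le_trans hD (ler_wpM2r m0 Dk)).
have mB : measurable (dyball x n : set BE) by exact: measurable_cball.
apply: (@le_trans _ _ (\int[m]_(y in dyball x n) (`|p y - ratr q| + k.+1%:R^-1))).
  apply: le_Rintegral => //.
  - by apply: (integrableS (@measurableT _ BE)) => //; exact: iq.
  - apply: (integrableS (@measurableT _ BE)) => //.
    have := integrableD (@measurableT _ BE) (iq (ratr q)) (icst k.+1%:R^-1).
    by congr (integrable _ _ _); apply/funext => y /=; rewrite EFinD.
  - move=> y _; apply: le_trans (ler_distD (ratr q) _ _) _.
    by rewrite lerD2l distrC ltW.
rewrite RintegralD//; [|exact: (integrableS (@measurableT _ BE))..].
rewrite Rintegral_cst//.
move: lq; rewrite hlam -/(Rintegral _ _ _) => lq.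
apply: (@le_trans _ _ (3 / k.+1%:R * fine (m (dyball x n)))); last by rewrite ler_wpM2r.
move: lq; move: (k.+1%:R^-1) (fine _) => z w.
lra.
Qed.

End Differentiation.

(** * Hausdorff measures and the mass distribution principle *)

Section EuclideanNorm.
Context {R : realType}.

Lemma norm_coord d (x : 'rV[R]_d) i : `|x 0 i| <= `|x|.
Proof.
rewrite [leRHS]/Num.norm /= mx_normrE.
by apply: (le_bigmax _ (fun ij => `|x ij.1 ij.2|) (0, i)).
Qed.

Lemma norm_le_coord d (x : 'rV[R]_d) c : 0 <= c -> (forall i, `|x 0 i| <= c) -> `|x| <= c.
Proof.
move=> c0 h; rewrite [leLHS]/Num.norm /= mx_normrE.
by apply/bigmax_leP; split => // -[a i] _ /=; rewrite ord1.
Qed.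

Lemma enorm_ge0 d (x : 'rV[R]_d) : 0 <= enorm x.
Proof. exact: sqrtr_ge0. Qed.

Lemma norm_le_enorm d (x : 'rV[R]_d) : `|x| <= enorm x.
Proof.
apply: norm_le_coord => [|i]; first exact: enorm_ge0.
rewrite -sqrtr_sqr ler_wsqrtr// (bigD1 i)//= lerDl.
by apply: sumr_ge0 => j _; exact: sqr_ge0.
Qed.

Lemma enorm_le_norm d (x : 'rV[R]_d) : enorm x <= d%:R * `|x|.
Proof.
have dx : 0 <= d%:R * `|x| by rewrite mulr_ge0.
rewrite -(ger0_norm dx) -sqrtr_sqr ler_wsqrtr//.
apply: (@le_trans _ _ (\sum_(i < d) `|x| ^+ 2)).
  by apply: ler_sum => i _; rewrite -real_normK ?num_real// lerXn2r ?nnegrE// norm_coord.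
rewrite sumr_const card_ord exprMn -[leLHS]mulr_natl ler_wpM2r ?sqr_ge0//.
by rewrite -natrX ler_nat; case: d {x dx} => // d; rewrite expnS leq_pmulr.
Qed.

End EuclideanNorm.

Section Hausdorff.
Context {R : realType} {d : nat}.
Local Notation E := 'rV[R]_d.
Local Notation BE := (borelRd R d).
Implicit Types (m : {measure set BE -> \bar R}) (A F : set E).

Lemma ediam_fin (U : set E) (delta : R) : (ediam U <= delta%:E)%E -> U !=set0 ->
  exists2 r : R, 0 <= r <= delta & ediam U = r%:E /\
    forall x y, U x -> U y -> `|x - y| <= r.
Proof.
move=> Ud [x Ux].
have U0 : (0 <= ediam U)%E.
  apply: ereal_sup_ubound; exists x, x; split => //.
  by rewrite subrr /enorm big1 ?sqrtr0// => i _; rewrite mxE expr0n.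
have Ufin : ediam U \is a fin_num by rewrite ge0_fin_numE// (le_lt_trans Ud)// ltry.
exists (fine (ediam U)).
  by rewrite fine_ge0//= -lee_fin fineK.
split; first by rewrite fineK.
move=> y z Uy Uz; apply: le_trans (norm_le_enorm _) _.
by rewrite -lee_fin fineK//; apply: ereal_sup_ubound; exists y, z.
Qed.

(** The ball replaces a set of diameter [r] of a cover; the extra [e] serves sets of
    diameter [0]. *)
Lemma dyadic_scale (r a s e : R) K : 0 <= r <= 2 ^- K -> 0 <= s <= a -> 0 < a -> 0 < e ->
  exists n, [/\ (K <= n)%N, r <= 2 ^- n & (2 ^- n) `^ a <= 2 `^ a * r `^ s + e].
Proof.
move=> /andP[r0 rK] /andP[s0 sa] a0 e0.
have [->|rN0] := eqVneq r 0.
  have [n hn] : exists n : nat, 2 ^- n < e `^ a^-1.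
    by apply: exp2N_lt; rewrite powR_gt0.
  exists (maxn K n); split; [exact: leq_maxl|exact/ltW/exp2N_gt0|].
  apply: (@le_trans _ _ e); last by rewrite lerDr mulr_ge0 ?powR_ge0.
  apply: (@le_trans _ _ ((e `^ a^-1) `^ a)).
    apply: ge0_ler_powR; rewrite ?nnegrE ?powR_ge0 ?ltW ?exp2N_gt0//.
    by apply: le_lt_trans hn; apply: exp2N_le; exact: leq_maxr.
  by rewrite -powRrM mulVf ?gt_eqF// powRr1// ltW.
have {r0 rN0}r0 : 0 < r by rewrite lt_neqAle eq_sym rN0.
have ex : exists n : nat, (K <= n)%N && (2 ^- n.+1 < r).
  have [n hn] := exp2N_lt r0; exists (maxn K n); rewrite leq_maxl /=.
  apply: le_lt_trans hn; apply: exp2N_le.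
  by apply: leq_trans (leqnSn _); exact: leq_maxr.
case: (ex_minnP ex) => n /andP[Kn nr] nmin.
have rn : r <= 2 ^- n.
  move: Kn; rewrite leq_eqVlt => /orP[/eqP <- //|Kn].
  rewrite leNgt; apply/negP => h.
  have n1 : n = n.-1.+1 by rewrite prednK//; exact: leq_ltn_trans Kn.
  have := nmin n.-1; rewrite -n1 h andbT -ltnS -n1 => /(_ Kn).
  by rewrite n1 /= ltnn.
exists n; split => //.
apply: (@le_trans _ _ (2 `^ a * r `^ s)); last by rewrite lerDl ltW.
apply: (@le_trans _ _ (2 `^ a * r `^ a)).
  rewrite -(@powRM _ 2 r a) ?(ltW r0)//.
  apply: ge0_ler_powR; rewrite ?nnegrE ?(ltW a0) ?(ltW (exp2N_gt0 _)) ?mulr_ge0 ?(ltW r0)//.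
  have e2 : 2 ^- n = 2 * 2 ^- n.+1 :> R.
    by rewrite exprS invfM mulVKf.
  by rewrite e2 ler_wpM2l// ltW.
rewrite ler_wpM2l ?powR_ge0//.
have r1 : r <= 1.
  apply: le_trans rn _; rewrite invf_le1 ?exprn_gt0// exprn_ege1// ler1n//.
by apply: ger_powR => //; rewrite r0.
Qed.

(** Around each set of a cover that meets the exceptional set take the dyadic ball of
    comparable radius [r]: its mass is less than [r `^ a], and the sum of these bounds
    is as small as the cover is cheap. *)
Lemma mass_distribution m F s a : 0 <= s <= a -> 0 < a ->
  hausdorff_measure s F = 0%E ->
  m.-negligible [set x | F x /\ exists K, forall n, (K <= n)%N ->
    (m (dyball x n) < ((2 ^- n) `^ a)%:E)%E].
Proof.
move=> /andP[s0 sa] a0 HF.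
pose A K := [set x | F x /\ forall n, (K <= n)%N -> (m (dyball x n) < ((2 ^- n) `^ a)%:E)%E].
have -> : [set x | F x /\ exists K, forall n, (K <= n)%N ->
    (m (dyball x n) < ((2 ^- n) `^ a)%:E)%E] = \bigcup_K A K.
  apply/seteqP; split => [x [Fx [K hK]]|x [K _ [Fx hK]]]; first by exists K.
  by split => //; exists K.
apply: negligible_bigcup => K; apply: negligible_small => e e0.
pose delta : R := 2 ^- K.
have d0 : 0 < delta := exp2N_gt0 K.
have : (hausdorff_content s delta F < (e / 2 / 2 `^ a)%:E)%E.
  apply: (@le_lt_trans _ _ (hausdorff_measure s F)).
    by apply: ereal_sup_ubound; exists delta.
  by rewrite HF lte_fin !divr_gt0// powR_gt0.
move=> /ereal_inf_lt[_ [U [FU Ud] <-] sumU].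
have /choice[b hb] : forall i, exists B : set E, [/\ measurable (B : set BE),
    U i `&` A K `<=` B &
    (m B <= (2 `^ a)%:E * (if U i != set0 then poweR (ediam (U i)) s else 0) +
       (e / 2 / (2 ^ i.+1)%:R)%:E)%E].
  move=> i; have ei : 0 < e / 2 / (2 ^ i.+1)%:R :> R.
    by rewrite !divr_gt0// ltr0n expn_gt0.
  have [[x [Ux Ax]]|noA] := pselect (U i `&` A K !=set0); last first.
    exists set0; split => //; first by move=> x UAx; apply: noA; exists x.
    rewrite measure0 adde_ge0 ?lee_fin ?(ltW ei)// mule_ge0 ?lee_fin ?powR_ge0//.
    by case: ifPn => // _; exact: poweR_ge0.
  have UN : U i !=set0 by exists x.
  have [r /andP[r0 rd] [rE hr]] := ediam_fin (Ud i) UN.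
  have [||n [Kn rn pw]] := @dyadic_scale r a s _ K _ _ a0 ei; [by rewrite r0|by rewrite s0|].
  exists (dyball x n); split.
  - exact: measurable_cball.
  - by move=> y [Uy _]; rewrite /dyball /cball /= (le_trans _ rn)// hr.
  - apply: (@le_trans _ _ ((2 ^- n) `^ a)%:E); first by apply/ltW; case: Ax => _; exact.
    have -> : U i != set0 by apply/set0P.
    by rewrite rE poweR_EFin -EFinM -EFinD lee_fin.
exists (\bigcup_i b i); split.
- by apply: (@bigcup_measurable _ BE) => i _; case: (hb i).
- move=> x Ax; have [i _ Ux] := FU x Ax.1.
  by exists i => //; case: (hb i) => _ h _; apply: h.
apply: (@le_trans _ _ (\sum_(i <oo) m (b i))%E).
  apply: measure_sigma_subadditive => //; first by move=> i; case: (hb i).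
  by apply: (@bigcup_measurable _ BE) => i _; case: (hb i).
pose v i := (if U i != set0 then poweR (ediam (U i)) s else 0)%E.
have v0 i : (0 <= v i)%E by rewrite /v; case: ifPn => // _; exact: poweR_ge0.
apply: (@le_trans _ _ (\sum_(i <oo) ((2 `^ a)%:E * v i + (e / 2 / (2 ^ i.+1)%:R)%:E))%E).
  by apply: lee_nneseries => // i _; case: (hb i).
apply: le_trans (epsilon_trick _ _ _) _.
- by move=> i; rewrite mule_ge0// lee_fin powR_ge0.
- by rewrite divr_ge0// ltW.
rewrite nneseriesZl; last by move=> i _; exact: v0.
have : (\sum_(i <oo) v i < (e / 2 / 2 `^ a)%:E)%E.
  by move: sumU; rewrite eseries_mkcond.
move=> /ltW h.
apply: (@le_trans _ _ ((2 `^ a)%:E * (e / 2 / 2 `^ a)%:E + (e / 2)%:E)%E).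
  by rewrite leeD2r// lee_wpmul2l// lee_fin powR_ge0.
by rewrite -EFinM -EFinD lee_fin mulrC divfK ?gt_eqF ?powR_gt0// -splitr.
Qed.

Lemma hausdorff_null_lt F (a : R) : (hausdorff_dim F < a%:E)%E ->
  exists2 s, 0 <= s < a & hausdorff_measure s F = 0%E.
Proof.
move=> /ereal_inf_lt[_ [s [s0 Hs] <-]]; rewrite lte_fin => sa.
by exists s => //; rewrite s0.
Qed.

Lemma grid_cover (M n : nat) : exists (N : nat) (U : nat -> set E),
  [/\ (N <= ((2 * M + 1) * 2 ^ n) ^ d)%N, cball 0 M%:R `<=` \bigcup_(i in `I_N) U i,
     forall i, (N <= i)%N -> U i = set0 &
     forall i x y, U i x -> U i y -> enorm (x - y) <= d%:R * 2 ^- n].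
Proof.
pose q := ((2 * M + 1) * 2 ^ n)%N.
pose T := {ffun 'I_d -> 'I_q}.
pose cell (f : T) : set E := [set x | forall i,
  (f i)%:R <= (x ord0 i + M%:R) * 2 ^+ n < (f i).+1%:R].
exists #|{: T}|, (fun k => if insub k is Some i then cell (enum_val (i : 'I_#|{: T}|)) else set0).
split.
- by rewrite card_ffun !card_ord.
- move=> x; rewrite /cball /= subr0 => xM.
  have y0 (i : 'I_d) : 0 <= (x ord0 i + M%:R) * 2 ^+ n.
    rewrite mulr_ge0// -lerBlDr sub0r.
    by have := le_trans (norm_coord x i) xM; rewrite ler_norml => /andP[].
  have yq (i : 'I_d) : (Num.truncn ((x ord0 i + M%:R) * (2 ^+ n : R))%R < q)%N.
    rewrite truncn_lt_nat// /q natrM natrX ltr_pM2r ?exprn_gt0// natrD natrM.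
    by have := le_trans (norm_coord x i) xM; rewrite ler_norml => /andP[_]; lra.
  pose f : T := [ffun i => Ordinal (yq i)].
  exists (enum_rank f); first exact: ltn_ord.
  rewrite valK /= enum_rankK => i; rewrite ffunE /=.
  exact: truncn_itv.
- by move=> i Ni; case: insubP => // u; rewrite ltnNge Ni.
- move=> k x y; case: insubP => // u _ _ cx cy.
  apply: le_trans (enorm_le_norm _) _; rewrite ler_wpM2l//.
  apply: norm_le_coord => [|i]; first exact/ltW/exp2N_gt0.
  have := cx i; have := cy i; rewrite !mxE => hy hx.
  have P0 : 0 < 2 ^+ n :> R by rewrite exprn_gt0.
  rewrite -[leRHS]div1r ler_pdivlMr// -[X in _ * X](ger0_norm (ltW P0)) -normrM.
  move: hy hx; rewrite ler_norml -[(enum_val u i).+1%:R]natr1 -[x 0 i]/(x ord0 i) -[y 0 i]/(y ord0 i).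
  move: (2 ^+ n) (x ord0 i) (y ord0 i) => P a b.
  move=> /andP[a1 a2] /andP[b1 b2]; apply/andP; split; lra.
Qed.

(** A cube is covered by [C * 2 ^ (n d)] cells of diameter [C * 2 ^- n], so the
    exponent [d + 1] gives a total of order [2 ^- n]. *)
Lemma bounded_hausdorff_null F : bounded_set F ->
  exists2 s : R, 0 <= s & hausdorff_measure s F = 0%E.
Proof.
move=> /bounded_cball[M0 FM0].
have [M hM] : exists M : nat, M0 < M%:R.
  exists (Num.bound `|M0|); apply: le_lt_trans (ler_norm _) _.
  by apply: archi_boundP.
have {FM0}FM : F `<=` cball 0 M%:R.
  by apply: subset_trans FM0 _; apply: le_cball; exact: ltW.
exists d.+1%:R => //.
apply/eqP; rewrite eq_le; apply/andP; split; last first.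
  apply: le_trans (_ : (hausdorff_content d.+1%:R 1 F <= _)%E); last first.
    by apply: ereal_sup_ubound; exists 1; first exact: ltr01.
  apply: le_ereal_inf_tmp => _ [U _ <-].
  by apply: nneseries_ge0 => i _ _; exact: poweR_ge0.
apply: ge_ereal_sup => _ [delta delta0 <-].
apply/lee_addgt0Pr => e e0; rewrite add0e.
(* Number of cells times the power of their diameter, up to the factor [2 ^- n]. *)
pose C : R := (2 * M + 1)%:R ^+ d * d%:R ^+ d.+1.
have C0 : 0 <= C by rewrite mulr_ge0.
have [n hn] : exists n : nat, 2 ^- n < Num.min (e / (C + 1)) (delta / (d%:R + 1)).
  by apply: exp2N_lt; rewrite lt_min !divr_gt0// ltr_wpDl.
move: hn; rewrite lt_min => /andP[ne nd].
have [N [U [NN cov UN dU]]] := grid_cover M n.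
have Ud i : (ediam (U i) <= (d%:R * 2 ^- n)%:E)%E.
  by apply: ge_ereal_sup => _ [x [y [Ux Uy ->]]]; rewrite lee_fin (dU i).
apply: (@le_trans _ _ (\sum_(0 <= i <oo | U i != set0) poweR (ediam (U i)) d.+1%:R)%E).
  apply: ereal_inf_lbound; exists U => //; split.
    by move=> x /FM/cov[i _ Ux]; exists i.
  move=> i; apply: le_trans (Ud i) _; rewrite lee_fin.
  apply: (@le_trans _ _ ((d%:R + 1) * 2 ^- n)); first by rewrite ler_wpM2r// lerDl.
  by rewrite mulrC -ler_pdivlMr ?ltr_wpDl// ltW.
have bnd i : ((if U i != set0 then poweR (ediam (U i)) d.+1%:R else 0) <=
    (if (i < N)%N then ((d%:R * 2 ^- n) ^+ d.+1)%:E else 0))%E.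
  case: ifPn => [/set0P Ui|_]; last first.
    by case: ifP => // _; rewrite lee_fin exprn_ge0// mulr_ge0// ltW// exp2N_gt0.
  case: ifPn => [_|]; last by rewrite -leqNgt => /UN h; case: Ui => x; rewrite h.
  have [r /andP[r0 rd] [-> _]] := ediam_fin (Ud i) Ui.
  by rewrite poweR_EFin powR_mulrn// lee_fin lerXn2r// nnegrE// (le_trans r0).
rewrite eseries_mkcond.
apply: (@le_trans _ _ (\sum_(0 <= i <oo) (if (i < N)%N then ((d%:R * 2 ^- n) ^+ d.+1)%:E else 0))%E).
  apply: lee_nneseries => [i _ _|i _]; last exact: bnd.
  by case: ifP => // _; exact: poweR_ge0.
apply: lime_le.
  apply: is_cvg_nneseries => i _ _; case: ifP => // _.
apply: nearW => k.
apply: (@le_trans _ _ (N%:R * (d%:R * 2 ^- n) ^+ d.+1)%:E).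
  set c := (d%:R * 2 ^- n) ^+ d.+1.
  have c0 : 0 <= c by rewrite exprn_ge0// mulr_ge0// ltW// exp2N_gt0.
  have -> : (\sum_(0 <= i < k) (if (i < N)%N then c%:E else 0) = ((minn k N)%:R * c)%:E)%E.
    elim: k => [|k IH]; first by rewrite big_nil min0n mul0r.
    rewrite big_nat_recr//= IH; case: ltnP => kN.
      by rewrite -EFinD (minn_idPl kN) -[k.+1]addn1 natrD mulrDl mul1r.
    by rewrite adde0 (minn_idPr (leqW kN)).
  by rewrite lee_fin ler_wpM2r// ler_nat geq_minr.
rewrite lee_fin.
apply: (@le_trans _ _ (C * 2 ^- n)).
  apply: (@le_trans _ _ ((((2 * M + 1) * 2 ^ n) ^ d)%N%:R * (d%:R * 2 ^- n) ^+ d.+1)).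
    by rewrite ler_wpM2r ?ler_nat// exprn_ge0// mulr_ge0// ltW// exp2N_gt0.
  rewrite natrX natrM natrX /C !exprMn [(2 ^- n) ^+ d.+1]exprS.
  have h : (2 ^+ n) ^+ d * (2 ^- n) ^+ d = 1 :> R.
    by rewrite -exprMn divff ?expr1n// gt_eqF// exprn_gt0.
  have -> : (2 * M + 1)%:R ^+ d * (2 ^+ n) ^+ d * (d%:R ^+ d.+1 * (2 ^- n * (2 ^- n) ^+ d)) =
    (2 * M + 1)%:R ^+ d * d%:R ^+ d.+1 * 2 ^- n * ((2 ^+ n) ^+ d * (2 ^- n) ^+ d) :> R by ring.
  by rewrite h mulr1.
apply: (@le_trans _ _ ((C + 1) * (e / (C + 1)))).
  by apply: ler_pM => //; rewrite ?lerDl// ltW// exp2N_gt0.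
by rewrite mulrC divfK// gt_eqF// ltr_wpDl.
Qed.

End Hausdorff.

(** * Selection of scales *)

Section Pliss.
Context {R : realType}.
Implicit Types (l : nat -> R) (c : R).

Definition steep_ahead l c n i := exists j, [/\ (i < j <= n)%N & c * (j - i)%:R < l j - l i].

Definition steep_behind l c i := exists j, (j < i)%N /\ c * (i - j)%:R < l i - l j.

Lemma sum_bool_le (P : nat -> bool) j k : \sum_(j <= i < k) (P i)%:R <= (k - j)%:R :> R.
Proof.
rewrite -[leRHS]mulr1 mulr_natl -(sumr_const_nat k j).
by apply: ler_sum => i _; case: (P i).
Qed.

(** Scanning upwards, each steep ascent found is skipped as a whole: its length is paid
    for by its height. *)
Lemma pliss_ahead l c n k : 0 < c -> {homo l : i j / (i <= j)%N >-> i <= j} ->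
  (k <= n)%N -> c * \sum_(k <= i < n) (`[< steep_ahead l c n i >])%:R <= l n - l k.
Proof.
move=> c0 hl; have [p] := ubnP (n - k); elim: p k => // p IH k pn kn.
move: kn; rewrite leq_eqVlt => /orP[/eqP <-|kn]; first by rewrite big_geq// mulr0 subrr.
have [[j [/andP[kj jn] hj]]|nst] := pselect (steep_ahead l c n k).
  rewrite (big_cat_nat (ltnW kj) jn)/= mulrDr.
  have h1 : c * \sum_(k <= i < j) (`[< steep_ahead l c n i >])%:R <= c * (j - k)%:R.
    by rewrite ler_wpM2l ?(ltW c0)// sum_bool_le.
  have jp : (n - j < p)%N by lia.
  have := IH j jp jn.
  by move: (c * _) (c * _) h1 hj => A B; lra.
rewrite big_ltn// asboolF// add0r.
have kp : (n - k.+1 < p)%N by lia.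
apply: le_trans (IH k.+1 kp kn) _.
by rewrite lerD2l lerN2 hl.
Qed.

Lemma pliss_behind l c n : 0 < c -> {homo l : i j / (i <= j)%N >-> i <= j} ->
  c * \sum_(0 <= i < n.+1) (`[< steep_behind l c i >])%:R <= l n - l 0%N.
Proof.
move=> c0 hl; have [p] := ubnP n; elim: p n => // p IH n pn.
have [[j [jn hj]]|nst] := pselect (steep_behind l c n).
  rewrite (big_cat_nat (n := j.+1))//= ?mulrDr; last exact: ltnW.
  have h1 : c * \sum_(j.+1 <= i < n.+1) (`[< steep_behind l c i >])%:R <= c * (n - j)%:R.
    by rewrite ler_wpM2l ?(ltW c0)// -subSS sum_bool_le.
  have := IH j (leq_trans jn _); rewrite -ltnS => /(_ pn).
  by move: (c * _) (c * _) (c * _) h1 hj => A B C; lra.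
rewrite big_nat_recr//= asboolF// addr0.
case: n pn nst => [|n] pn nst; first by rewrite big_geq// mulr0 subrr.
by apply: le_trans (IH n _) _; [|rewrite lerB// hl].
Qed.

(** Up to a time [n] with [l n <= a n], the indices that are followed by an ascent of
    slope [c] have frequency at most [a / c < 1], and those preceded by one of slope
    [N a] at most [1 / N], up to bounded numbers of indices.  For large [N] these do not
    exhaust the indices, even after removal of the first and the last [L]. *)
Lemma pliss_times l a c : 0 < a -> a < c ->
  {homo l : i j / (i <= j)%N >-> i <= j} ->
  (forall K, exists2 n, (K <= n)%N & l n <= a * n%:R) ->
  exists2 N : nat, (0 < N)%N & forall L, exists t, [/\ (L <= t)%N,
    forall u, (u <= L)%N -> l (t + u)%N - l t <= c * u%:R &
    forall s, (s <= t)%N -> l t - l s <= N%:R * a * (t - s)%:R].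
Proof.
move=> a0 ac hl hn; have c0 : 0 < c := lt_trans a0 ac.
have gap : 0 < 1 - a / c by rewrite subr_gt0 ltr_pdivrMr// mul1r.
have [N hN] : exists N : nat, (1 - a / c)^-1 < N%:R.
  by exists (Num.bound (1 - a / c)^-1); apply: archi_boundP; rewrite invr_ge0 ltW.
have N0 : 0 < N%:R :> R by apply: lt_trans hN; rewrite invr_gt0.
exists N; first by rewrite -(ltr0n R).
move=> L; apply: contrapT => /forallNP noL.
have Na0 : 0 < N%:R * a by rewrite mulr_gt0.
have [g gE] : exists g, g = 1 - a / c - N%:R^-1 by exists (1 - a / c - N%:R^-1).
have g0 : 0 < g by rewrite gE subr_gt0 invf_plt// posrE.
pose C := `|l 0%N| * (c^-1 + (N%:R * a)^-1) + (2 * L)%:R.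
have C0 : 0 <= C.
  by rewrite addr_ge0// mulr_ge0// addr_ge0// invr_ge0 ltW.
have [K hK] : exists K : nat, C / g < K%:R.
  by exists (Num.bound (C / g)); apply: archi_boundP; rewrite divr_ge0// ltW.
have [n nK ln] := hn (maxn K (2 * L)).
move: nK; rewrite geq_max => /andP[nK nL].
have P1 := pliss_ahead c0 hl (leq0n n).
have P2 := pliss_behind n Na0 hl.
have bad t : (L <= t < n - L)%N ->
    1 <= (`[< steep_ahead l c n t >])%:R + (`[< steep_behind l (N%:R * a) t >])%:R :> R.
  move=> /andP[Lt tn].
  case: asboolP => [_|nf] /=; first by rewrite lerDl.
  case: asboolP => [_|nb] /=; first by rewrite add0r.
  exfalso; apply: (noL t); split => // [u uL|s st].
    case: u uL => [|u] uL; first by rewrite addn0 subrr mulr0.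
    rewrite leNgt; apply/negP => h; apply: nf; exists (t + u.+1)%N.
    split; last by rewrite addKn.
    rewrite -[X in (X < _)%N]addn0 ltn_add2l/=.
    by move: tn; rewrite ltn_subRL addnC => /ltnW; apply: leq_trans; rewrite leq_add2l.
  move: st; rewrite leq_eqVlt => /orP[/eqP ->|st]; first by rewrite subrr subnn mulr0.
  by rewrite leNgt; apply/negP => h; apply: nb; exists s.
have mid : (n - L - L)%:R <= \sum_(0 <= i < n) (`[< steep_ahead l c n i >])%:R +
    \sum_(0 <= i < n.+1) (`[< steep_behind l (N%:R * a) i >])%:R :> R.
  apply: (@le_trans _ _ (\sum_(L <= i < n - L) ((`[< steep_ahead l c n i >])%:R +
      (`[< steep_behind l (N%:R * a) i >])%:R))).
    rewrite -[leLHS]mulr1 mulr_natl -(sumr_const_nat (n - L) L).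
    by rewrite big_nat [leRHS]big_nat; apply: ler_sum => i; exact: bad.
  rewrite big_split /=; apply: lerD.
    have Ln : (L <= n - L)%N by rewrite leq_subRL ?addnn -?mul2n// (leq_trans _ nL)// leq_pmull.
    rewrite [leRHS](big_cat_nat (n := L))//=; last by rewrite (leq_trans _ nL)// leq_pmull.
    rewrite [X in _ <= _ + X](big_cat_nat (n := (n - L)%N))//=; last exact: leq_subr.
    rewrite addrCA lerDl addr_ge0// sumr_ge0//.
  have Ln : (L <= n - L)%N by rewrite leq_subRL ?addnn -?mul2n// (leq_trans _ nL)// leq_pmull.
  rewrite [leRHS](big_cat_nat (n := L))//=; last by rewrite (leq_trans _ (leqW nL))// leq_pmull.
  rewrite [X in _ <= _ + X](big_cat_nat (n := (n - L)%N))//=; last exact/leqW/leq_subr.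
  by rewrite addrCA lerDl addr_ge0// sumr_ge0.
have e1 : \sum_(0 <= i < n) (`[< steep_ahead l c n i >])%:R <= (l n - l 0%N) / c.
  by rewrite ler_pdivlMr// mulrC.
have e2 : \sum_(0 <= i < n.+1) (`[< steep_behind l (N%:R * a) i >])%:R <= (l n - l 0%N) / (N%:R * a).
  by rewrite ler_pdivlMr// mulrC.
have q0 : 0 <= c^-1 + (N%:R * a)^-1 by rewrite addr_ge0// invr_ge0 ltW.
have e3 : (l n - l 0%N) * (c^-1 + (N%:R * a)^-1) <= (a * n%:R + `|l 0%N|) * (c^-1 + (N%:R * a)^-1).
  by rewrite ler_wpM2r// lerD// -normrN ler_norm.
have e4 : (n - L - L)%:R = n%:R - (2 * L)%:R :> R.
  by rewrite -subnDA addnn -mul2n natrB.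
have e5 : (a * n%:R) * (c^-1 + (N%:R * a)^-1) = n%:R - n%:R * g.
  by rewrite gE; field; rewrite !gt_eqF.
have : n%:R * g <= C.
  rewrite /C; move: mid e1 e2 e3; rewrite e4 [(_ + `|_|) * _]mulrDl e5 => h1 h2 h3 h4.
  have h23 := lerD h2 h3; rewrite -mulrDr in h23.
  have := le_trans (le_trans h1 h23) h4.
  by move: (n%:R * g) (`|l 0%N| * _) => X Y; lra.
apply/negP; rewrite -ltNge -ltr_pdivrMr// (lt_le_trans hK)// ler_nat//.
Qed.

(** [pliss_times] for the negative logarithm of [b], in units of [ln 2]. *)
Lemma good_scales (b : nat -> R) (a c : R) : 0 < a -> a < c ->
  (forall n, 0 < b n) -> {homo b : i j / (i <= j)%N >-> j <= i} ->
  (forall K, exists2 n, (K <= n)%N & (2 ^- n) `^ a <= b n) ->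
  exists N : nat, forall L, exists t, [/\ (L <= t)%N,
    forall u, (u <= L)%N -> (2 ^- u) `^ c * b t <= b (t + u)%N &
    forall s, (s <= t)%N -> b s <= (2 ^+ (t - s)) ^+ N * b t].
Proof.
move=> a0 ac b0 hb hn.
have ln2 : 0 < ln 2 :> R by rewrite ln_gt0// ltr1n.
pose l n := - ln (b n).
have lh : {homo l : i j / (i <= j)%N >-> i <= j}.
  by move=> i j ij; rewrite lerN2 ler_ln ?posrE// hb.
have ln2N u : ln (2 ^- u) = - (u%:R * ln 2) :> R.
  by rewrite lnV ?posrE ?exprn_gt0// lnXn// mulr_natl.
have [||K|N N0 hN] := @pliss_times l (a * ln 2) (c * ln 2) _ _ lh.
- by rewrite mulr_gt0.
- by rewrite ltr_pM2r.
- have [n Kn h] := hn K; exists n => //.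
  have p0 : 0 < (2 ^- n : R) `^ a by rewrite powR_gt0// invr_gt0 exprn_gt0.
  have : ln ((2 ^- n : R) `^ a) <= ln (b n) by rewrite ler_ln ?posrE.
  by rewrite ln_powR ln2N /l; lra.
have [M hM] : exists M : nat, N%:R * a < M%:R.
  by exists (Num.bound (N%:R * a)); apply: archi_boundP; rewrite mulr_ge0// ltW.
exists M => L; have [t [Lt h1 h2]] := hN L; exists t; split => // [u uL|s st].
  have u0 : 0 < (2 ^- u : R) `^ c by rewrite powR_gt0// invr_gt0 exprn_gt0.
  rewrite -ler_ln ?posrE ?mulr_gt0// lnM ?posrE// ln_powR ln2N.
  by have := h1 u uL; rewrite /l; lra.
have p0 : 0 < (2 ^+ (t - s) : R) ^+ M by rewrite !exprn_gt0.
rewrite -ler_ln ?posrE ?mulr_gt0// lnM ?posrE// !lnXn ?exprn_gt0//.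
rewrite -[_ *+ M]mulr_natl -[_ *+ (t - s)]mulr_natl.
have := h2 s st; rewrite /l => h.
have : N%:R * (a * ln 2) * (t - s)%:R <= M%:R * ((t - s)%:R * ln 2).
  have -> : N%:R * (a * ln 2) * (t - s)%:R = N%:R * a * ((t - s)%:R * ln 2) by ring.
  by rewrite ler_wpM2r ?(ltW hM)// mulr_ge0// ltW.
lra.
Qed.

End Pliss.

(** * Smooth functions and cut-offs *)

Section LineDerivative.
Context {R : realType} {d : nat}.
Local Notation E := 'rV[R]_d.
Implicit Types (f g : E -> R) (x v : E).

Lemma is_derive_line f x v df :
  is_derive x v f df <-> is_derive (0 : R) (1 : R) (fun h : R => f (h *: v + x)) df.
Proof.
have e : (fun h : R => h^-1 *: ((f \o shift x) (h *: v) - f x)) =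
    (fun h : R => h^-1 *: (((fun h : R => f (h *: v + x)) \o shift 0) (h *: (1 : R)) -
       (fun h : R => f (h *: v + x)) 0)).
  by apply/funext => h /=; rewrite addr0 [h *: 1]mulr1 scale0r add0r.
split=> -[h1 h2]; split.
- exact: (derivable1P _ _ _).1.
- by rewrite -h2 /derive e.
- exact: (derivable1P _ _ _).2.
- by rewrite -h2 /derive -e.
Qed.

Lemma is_derive_chain (phi : R -> R) f x v df dphi :
  is_derive (f x) (1 : R) phi dphi -> is_derive x v f df ->
  is_derive x v (fun y => phi (f y)) (dphi * df).
Proof.
move=> hphi /is_derive_line hf; apply/is_derive_line.
have h0 : is_derive (f ((0 : R) *: v + x)) (1 : R) phi dphi by rewrite scale0r add0r.
have := @is_derive1_comp R phi (fun h : R => f (h *: v + x)) 0 dphi df h0 hf.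
by rewrite mulrC.
Qed.

Lemma is_derive_affine f (a v y : E) (c : R) df :
  is_derive (c *: (y - a)) v f df ->
  is_derive y v (fun z => f (c *: (z - a))) (c * df).
Proof.
move=> /is_derive_line hf; apply/is_derive_line.
have -> : (fun h : R => f (c *: (h *: v + y - a))) =
    (fun h : R => f (h *: v + c *: (y - a))) \o (fun h => c * h).
  by apply/funext => h /=; rewrite -addrA scalerDr scalerA.
have hc : is_derive (0 : R) (1 : R) (fun h => c * h) c.
  have := @is_deriveZ R R R id c 0 1 1 (is_derive_id _ _).
  by rewrite [c *: 1]mulr1.
have h0 : is_derive (c * 0) (1 : R) (fun h : R => f (h *: v + c *: (y - a))) df by rewrite mulr0.
have := @is_derive1_comp R (fun h : R => f (h *: v + c *: (y - a))) (fun h => c * h) 0 df c h0 hc.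
by rewrite mulrC.
Qed.

End LineDerivative.

Section Smooth.
Context {R : realType} {d : nat}.
Local Notation E := 'rV[R]_d.
Implicit Types (f g : E -> R) (x v : E).

Definition pd (i : 'I_d) f : E -> R := fun x => 'D_(delta_mx 0 i : E) f x.

Definition pderivable f := forall i x, derivable f x (delta_mx 0 i : E).

(** [smooth] quantifies over all iterated partial derivatives at once; the graded notion
    allows inductions in which products and compositions lose one order at a time. *)
Fixpoint Ck (k : nat) f : Prop :=
  continuous f /\ if k is k'.+1 then pderivable f /\ forall i, Ck k' (pd i f) else True.

Lemma partial_rcons s i f : partial (rcons s i) f = partial s (pd i f).
Proof. by rewrite /partial foldr_rcons. Qed.

Lemma Ck_continuous k f : Ck k f -> continuous f.
Proof. by case: k => [|k] []. Qed.

Lemma smooth_pd f i : smooth f -> smooth (pd i f).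
Proof. by move=> sf s; have := sf (rcons s i); rewrite partial_rcons. Qed.

Lemma smoothP f : smooth f <-> forall k, Ck k f.
Proof.
split.
  move=> sf k; elim: k f sf => [|k IH] f sf; first by split => //; case: (sf [::]).
  by split; [|split]; [case: (sf [::])|case: (sf [::])|move=> i; apply: IH; exact: smooth_pd].
move=> h s; elim/last_ind: s f h => [|s i IH] f h.
  by have [c [pf _]] := h 1%N; split.
rewrite partial_rcons; apply: IH => k.
by have [_ [_ hi]] := h k.+1; exact: hi.
Qed.

Lemma CkS k f : Ck k.+1 f -> Ck k f.
Proof.
elim: k f => [|k IH] f [c [pf h]]; first by split.
by split => //; split => // i; apply: IH; exact: h.
Qed.

Lemma Ck_step k f : Ck k.+1 f ->
  [/\ continuous f, pderivable f & forall i, Ck k (pd i f)].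
Proof. by move=> [cf [pf hf]]; split. Qed.

Lemma pd_is_derive f i x : pderivable f -> is_derive x (delta_mx 0 i : E) f (pd i f x).
Proof. by move=> h; apply: derivableP; exact: h. Qed.

Lemma pd_of_is_derive f i (df : E -> R) :
  (forall x, is_derive x (delta_mx 0 i : E) f (df x)) -> pd i f = df.
Proof. by move=> h; apply/funext => x; rewrite /pd (@derive_val _ _ _ _ _ _ _ (h x)). Qed.

Lemma pderivable_of_is_derive f (df : 'I_d -> E -> R) :
  (forall i x, is_derive x (delta_mx 0 i : E) f (df i x)) -> pderivable f.
Proof. by move=> h i x; exact: (@ex_derive _ _ _ _ _ _ _ (h i x)). Qed.

(** The step from one order to the next for a function whose partial derivatives are
    known explicitly. *)
Lemma Ck_intro k f (df : 'I_d -> E -> R) : continuous f ->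
  (forall i x, is_derive x (delta_mx 0 i : E) f (df i x)) ->
  (forall i, Ck k (df i)) -> Ck k.+1 f.
Proof.
move=> cf h hk; split => //; split; first exact: pderivable_of_is_derive h.
by move=> i; rewrite (pd_of_is_derive (h i)).
Qed.

Lemma Ck_cst k (c : R) : Ck k (fun=> c).
Proof.
elim: k c => [|k IH] c; first by split => // x; exact: cst_continuous.
apply: (@Ck_intro _ _ (fun _ _ => 0)); last by move=> i; exact: IH.
  by move=> x; exact: cst_continuous.
Qed.

Lemma Ck_coord k (j : 'I_d) : Ck k (fun x : E => x 0 j).
Proof.
have cc : continuous (fun x : E => x 0 j) by move=> x; exact: coord_continuous.
case: k => [|k]; first by split.
apply: (@Ck_intro _ _ (fun i _ => (i == j)%:R)) => //; last by move=> i; exact: Ck_cst.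
move=> i x; apply/is_derive_line.
have -> : (fun h : R => (h *: (delta_mx 0 i : E) + x) 0 j) =
    (fun h : R => (i == j)%:R * h + x 0 j).
  by apply/funext => h; rewrite !mxE eqxx /= mulrC eq_sym.
have hc : is_derive (0 : R) (1 : R) (fun h => (i == j)%:R * h) (i == j)%:R.
  have := @is_deriveZ R R R id (i == j)%:R 0 1 1 (is_derive_id _ _).
  by rewrite [_ *: 1]mulr1.
have := @is_deriveD R R R _ _ 0 1 _ _ hc (is_derive_cst (x 0 j) (0 : R) (1 : R)).
by rewrite addr0.
Qed.

Lemma pd_add f g i : pderivable f -> pderivable g ->
  pd i (fun x => f x + g x) = (fun x => pd i f x + pd i g x).
Proof.
move=> pf pg; apply: pd_of_is_derive => x.
by apply: (@is_deriveD R E R f g); exact: pd_is_derive.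
Qed.

Lemma Ck_add k f g : Ck k f -> Ck k g -> Ck k (fun x => f x + g x).
Proof.
have cadd (u w : E -> R) : continuous u -> continuous w -> continuous (fun x : E => u x + w x).
  by move=> cu cw x; apply: (continuousD (cu x) (cw x)).
elim: k f g => [|k IH] f g; first by move=> [cf _] [cg _]; split => //; exact: cadd.
move=> /Ck_step[cf pf hf] /Ck_step[cg pg hg].
apply: (@Ck_intro _ _ (fun i x => pd i f x + pd i g x)); first exact: cadd.
  by move=> i x; apply: (@is_deriveD R E R f g); exact: pd_is_derive.
by move=> i; exact: IH.
Qed.

Lemma is_derive_mul f g x v df dg : is_derive x v f df -> is_derive x v g dg ->
  is_derive x v (fun y => f y * g y) (f x * dg + g x * df).
Proof. by move=> hf hg; exact: (@is_deriveM R E f g x v df dg hf hg). Qed.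

Lemma Ck_mul k f g : Ck k f -> Ck k g -> Ck k (fun x => f x * g x).
Proof.
have cmul (u w : E -> R) : continuous u -> continuous w -> continuous (fun x : E => u x * w x).
  by move=> cu cw x; apply: (continuousM (cu x) (cw x)).
elim: k f g => [|k IH] f g; first by move=> [cf _] [cg _]; split => //; exact: cmul.
move=> Cf Cg; have [cf pf hf] := Ck_step Cf; have [cg pg hg] := Ck_step Cg.
apply: (@Ck_intro _ _ (fun i x => f x * pd i g x + g x * pd i f x)); first exact: cmul.
  by move=> i x; apply: is_derive_mul; exact: pd_is_derive.
by move=> i; apply: Ck_add; apply: IH => //; exact: CkS.
Qed.

Lemma Ck_affine k f (a : E) (c : R) : Ck k f -> Ck k (fun y => f (c *: (y - a))).
Proof.
have caff (u : E -> R) : continuous u -> continuous (fun y : E => u (c *: (y - a))).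
  move=> cu y; apply: (@continuous_comp _ _ _ (fun y : E => c *: (y - a)) u); last exact: cu.
  apply: (@continuous_comp _ _ _ (fun y : E => y - a) ( *:%R c)); last exact: scaler_continuous.
  by apply: continuousB; [exact: cvg_id|exact: cst_continuous].
elim: k f => [|k IH] f; first by move=> [cf _]; split => //; exact: caff.
move=> /Ck_step[cf pf hf].
apply: (@Ck_intro _ _ (fun i y => c * pd i f (c *: (y - a)))); first exact: caff.
  by move=> i y; apply: is_derive_affine; exact: pd_is_derive.
move=> i; apply: Ck_mul; first exact: Ck_cst.
exact: (IH (pd i f)).
Qed.

Lemma smooth_cst c : smooth (fun _ : E => c).
Proof. by apply/smoothP => k; exact: Ck_cst. Qed.

Lemma smooth_add f g : smooth f -> smooth g -> smooth (fun x => f x + g x).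
Proof. by move=> /smoothP sf /smoothP sg; apply/smoothP => k; exact: Ck_add. Qed.

Lemma smooth_mul f g : smooth f -> smooth g -> smooth (fun x => f x * g x).
Proof. by move=> /smoothP sf /smoothP sg; apply/smoothP => k; exact: Ck_mul. Qed.

Lemma smooth_affine f a c : smooth f -> smooth (fun y => f (c *: (y - a))).
Proof. by move=> /smoothP sf; apply/smoothP => k; exact: Ck_affine. Qed.

Lemma smooth_pderivable f : smooth f -> pderivable f.
Proof. by move=> sf; case: (sf [::]). Qed.

Lemma smooth_continuous f : smooth f -> continuous f.
Proof. by move=> sf; case: (sf [::]). Qed.

Lemma partial_add s f g : smooth f -> smooth g ->
  partial s (fun x => f x + g x) = (fun x => partial s f x + partial s g x).
Proof.
elim/last_ind: s f g => [//|s i IH] f g sf sg.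
rewrite !partial_rcons pd_add; [|exact: smooth_pderivable..].
by apply: IH; exact: smooth_pd.
Qed.

Lemma partial_cst s (c : R) : (0 < size s)%N -> partial s (fun _ : E => c) = fun=> 0.
Proof.
elim/last_ind: s c => // s i IH c _; rewrite partial_rcons.
have -> : pd i (fun=> c) = fun=> 0.
  by apply: pd_of_is_derive => x; exact: is_derive_cst.
by case: s IH => [//|j s] IH; exact: IH.
Qed.

Lemma partial_scale s (c : R) f : smooth f ->
  partial s (fun x => c * f x) = (fun x => c * partial s f x).
Proof.
elim/last_ind: s f => [//|s i IH] f sf; rewrite !partial_rcons.
have -> : pd i (fun x => c * f x) = (fun x => c * pd i f x).
  apply: pd_of_is_derive => x.
  have := is_derive_mul (is_derive_cst c x (delta_mx 0 i : E)) (pd_is_derive i x (smooth_pderivable sf)).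
  by rewrite mulr0 addr0.
by apply: IH; exact: smooth_pd.
Qed.

Lemma partial_affine s f (a : E) (c : R) : smooth f ->
  partial s (fun y => f (c *: (y - a))) =
  (fun y => c ^+ size s * partial s f (c *: (y - a))).
Proof.
elim/last_ind: s f => [|s i IH] f sf.
  by apply/funext => y; rewrite expr0 mul1r.
rewrite !partial_rcons.
have -> : pd i (fun y => f (c *: (y - a))) = (fun y => c * pd i f (c *: (y - a))).
  by apply: pd_of_is_derive => y; apply: is_derive_affine; apply: pd_is_derive; exact: smooth_pderivable.
rewrite partial_scale; last by apply: smooth_affine; exact: smooth_pd.
by rewrite IH; [apply/funext => y; rewrite size_rcons exprS mulrA|exact: smooth_pd].
Qed.

(** A crude Leibniz bound: each derivative splits a product in two. *)
Lemma partial_mul_bound s f g x A B : smooth f -> smooth g ->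
  (forall t, (size t <= size s)%N -> `|partial t f x| <= A) ->
  (forall t, (size t <= size s)%N -> `|partial t g x| <= B) ->
  `|partial s (fun y => f y * g y) x| <= 2 ^+ size s * (A * B).
Proof.
elim/last_ind: s f g => [|s i IH] f g sf sg hA hB.
  rewrite expr0 mul1r /= normrM; apply: ler_pM => //; first exact: (hA [::]).
  exact: (hB [::]).
rewrite partial_rcons.
have -> : pd i (fun y => f y * g y) = (fun y => f y * pd i g y + pd i f y * g y).
  apply: pd_of_is_derive => y; rewrite [pd i f y * _]mulrC; apply: is_derive_mul.
    by apply: pd_is_derive; exact: smooth_pderivable.
  by apply: pd_is_derive; exact: smooth_pderivable.
have sfi := smooth_pd i sf; have sgi := smooth_pd i sg.
rewrite partial_add; [|exact: smooth_mul..].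
apply: le_trans (ler_normD _ _) _.
rewrite size_rcons exprS -mulrA mulr_natl mulr2n; apply: lerD; apply: IH => // t ts.
- by apply: hA; rewrite size_rcons leqW.
- by rewrite -partial_rcons; apply: hB; rewrite !size_rcons ltnS.
- by rewrite -partial_rcons; apply: hA; rewrite !size_rcons ltnS.
- by apply: hB; rewrite size_rcons leqW.
Qed.

Lemma partial_near_cst s f (c : R) (U : set E) : open U -> (forall x, U x -> f x = c) ->
  forall x, U x -> partial s f x = partial s (fun=> c) x.
Proof.
move=> oU; elim/last_ind: s f c => [//|s i IH] f c fU x Ux.
rewrite !partial_rcons.
have -> : pd i (fun=> c) = fun=> 0.
  by apply: pd_of_is_derive => y; exact: is_derive_cst.
apply: IH => // y Uy; rewrite /pd (@near_eq_derive _ _ _ f (fun=> c)).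
  by rewrite derive_cst.
have := open_nbhs_nbhs (conj oU Uy); apply: filterS => z; exact: fU.
Qed.

End Smooth.

Section Bump.
Context {R : realType}.

(** The span of these functions [t ^- n * exp (- 1 / t)] is closed under
    differentiation. *)
Definition flat (n : nat) (t : R) : R :=
  if 0 < t then t ^- n * expR (- t^-1) else 0.

Lemma flat0 n t : t <= 0 -> flat n t = 0.
Proof. by rewrite /flat ltNge => ->. Qed.

Lemma flat_ge0 n t : 0 <= flat n t.
Proof.
rewrite /flat; case: ifPn => // t0.
by rewrite mulr_ge0 ?expR_ge0// invr_ge0 exprn_ge0// ltW.
Qed.

(** One term of the exponential series.  At [t = 0] it gives the differentiability of
    [flat n]. *)
Lemma flat_bound n t : flat n t <= n.+1`!%:R * `|t|.
Proof.
rewrite /flat; case: ifPn => [t0|_]; last by rewrite mulr_ge0.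
have u0 : 0 <= t^-1 by rewrite invr_ge0 ltW.
have := expR_ge1Dxn n u0.
have F0 : 0 < n.+1`!%:R :> R by rewrite ltr0n fact_gt0.
move=> h; have {}h : t^-1 ^+ n.+1 <= n.+1`!%:R * expR t^-1.
  rewrite mulrC -ler_pdivrMr//; lra.
rewrite expRN ler_pdivrMr ?expR_gt0// (gtr0_norm t0) mulrAC.
rewrite -ler_pdivrMr//; move: h; rewrite exprS mulrC exprVn.
by rewrite mulrC [leRHS]mulrC.
Qed.

Lemma is_derive_flat n t :
  is_derive t (1 : R) (flat n) (flat n.+2 t - n%:R * flat n.+1 t).
Proof.
have [t0|t0|->] := ltgtP t 0.
- rewrite !flat0 ?ltW// mulr0 subr0.
  apply: (@near_eq_is_derive _ _ _ (fun=> 0)).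
  + have : \forall z \near t, z < 0 by apply: open_nbhs_nbhs; split => //; exact: open_lt.
    by apply: filterS => z z0; rewrite flat0// ltW.
- have hV : is_derive t (1 : R) (fun s : R => s^-1) (- t ^- 2).
    have := @is_deriveV R id t 1 1 (lt0r_neq0 t0) (is_derive_id _ _).
    by rewrite [_ *: 1]mulr1.
  have hE : is_derive t (1 : R) (fun s : R => expR (- s^-1)) (expR (- t^-1) * t ^- 2).
    have hN := @is_deriveN _ _ _ _ _ _ _ hV; rewrite opprK in hN.
    have := @is_derive1_comp R expR (fun s => - s^-1) t _ _ (is_derive_expR _) hN.
    by rewrite mulrC.
  have nt : \forall z \near t, 0 < z by apply: open_nbhs_nbhs; split => //; exact: open_gt.
  case: n => [|n].
    apply: (@near_eq_is_derive R R R (fun s : R => expR (- s^-1))).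
      + by apply: filterS nt => z z0; rewrite /flat z0 invr1 mul1r.
    + by rewrite mul0r subr0 /flat t0 mulrC.
  have hX := @is_deriveX R R (fun s : R => s^-1) n.+1 t 1 _ hV.
  have hM := @is_deriveM R R _ _ t 1 _ _ hX hE.
  apply: (@near_eq_is_derive R R R ((fun s : R => s^-1) ^+ n.+1 * (fun s => expR (- s^-1)))).
  + by apply: filterS nt => z z0; rewrite /flat z0 -exprVn !fctE.
  + apply: is_derive_eq hM _; rewrite !fctE /flat t0.
    rewrite -!exprVn /= /GRing.scale /= !exprS; move: (expR (- t^-1)) => x; move: (t^-1 ^+ n) => w.
    ring.
- rewrite !flat0// mulr0 subr0.
  have cv : (fun h : R => h^-1 *: ((flat n \o shift 0) (h *: (1 : R)) - flat n 0)) @ 0^' --> (0 : R).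
    apply/cvgrPdist_le => e e0.
    pose K : R := n.+2`!%:R.
    have K0 : 0 < K by rewrite ltr0n fact_gt0.
    have : \forall h \near (0 : R)^', `|h| < e / K.
      by apply: dnbhs0_lt; rewrite divr_gt0.
    apply: filterS => h hK.
    rewrite /= addr0 [h *: 1]mulr1 (flat0 n (lexx 0)) subr0 sub0r normrN.
    have -> : h^-1 *: flat n h = flat n.+1 h.
      rewrite /flat; case: ifPn => h0; last by rewrite scaler0.
      by rewrite [_ *: _]mulrA exprS invfM.
    rewrite ger0_norm ?flat_ge0// (le_trans (flat_bound _ _))//.
    by rewrite mulrC -ler_pdivlMr// ltW.
  split; first exact: (cvgP _ cv).
  exact: (cvg_lim _ cv).
Qed.

Lemma flat_smooth_comp d (f : 'rV[R]_d -> R) n : smooth f -> smooth (fun x => flat n (f x)).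
Proof.
move=> /smoothP sf; apply/smoothP => k.
have cflat m : continuous (flat m).
  move=> t; apply: differentiable_continuous; apply/derivable1_diffP.
  by have [] := is_derive_flat m t.
have ccomp m : continuous (fun x => flat m (f x)).
  move=> x; apply: (@continuous_comp _ _ _ f (flat m)); last exact: cflat.
  exact: Ck_continuous (sf 0%N) x.
elim: k n => [|k IH] n; first by split.
apply: (@Ck_intro _ _ _ _ (fun i x => (flat n.+2 (f x) - n%:R * flat n.+1 (f x)) * pd i f x)).
- exact: ccomp.
- move=> i x; apply: is_derive_chain; first exact: is_derive_flat.
  by apply: pd_is_derive; have [_ []] := sf 1%N.
- move=> i; apply: Ck_mul; last by have [_ _ h] := Ck_step (sf k.+1); exact: h.
  have -> : (fun x => flat n.+2 (f x) - n%:R * flat n.+1 (f x)) =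
    (fun x => flat n.+2 (f x) + (- n%:R) * flat n.+1 (f x)).
    by apply/funext => x; rewrite mulNr.
  by apply: Ck_add; [exact: IH|apply: Ck_mul; [exact: Ck_cst|exact: IH]].
Qed.

Lemma flat0_mono s t : s <= t -> flat 0 s <= flat 0 t.
Proof.
move=> st; rewrite {1}/flat; case: ifPn => s0; last exact: flat_ge0.
rewrite /flat (lt_le_trans s0 st) !expr0 ler_wpM2l ?invr1// ler_expR lerN2.
by rewrite lef_pV2 ?posrE// (lt_le_trans s0 st).
Qed.

Lemma smooth_sum d (I : seq 'I_d) (f : 'I_d -> 'rV[R]_d -> R) :
  (forall i, smooth (f i)) -> smooth (fun x => \sum_(i <- I) f i x).
Proof.
move=> sf; elim: I => [|i I IH].
  by under [X in smooth X]eq_fun do rewrite big_nil; exact: smooth_cst.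
by under [X in smooth X]eq_fun do rewrite big_cons; exact: smooth_add.
Qed.

(** With [q x] the squared Euclidean norm and [f = flat 0], the function
    [e * f (1 - f (q x - 1 / 4) / f (3 / 4))] is built without quotients of functions:
    the inner term vanishes for [q x <= 1 / 4] and is at least [1] for [q x >= 1]. *)
Lemma smooth_cutoff d : exists chi : 'rV[R]_d -> R,
  [/\ smooth chi, forall x, 0 <= chi x <= 1,
     forall x, enorm x <= 2^-1 -> chi x = 1 &
     forall x, 1 <= `|x| -> chi x = 0].
Proof.
pose q (x : 'rV[R]_d) := \sum_i x 0 i ^+ 2.
have sq : smooth q.
  apply: smooth_sum => i; apply: smooth_mul; apply/smoothP => k; exact: Ck_coord.
have q0 x : 0 <= q x by apply: sumr_ge0 => i _; exact: sqr_ge0.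
have qE x : q x = enorm x ^+ 2 by rewrite /enorm sqr_sqrtr// q0.
pose lam := (flat 0 (3 / 4))^-1.
have p34 : 0 < flat 0 (3 / 4).
  by rewrite /flat divr_gt0// mulr_gt0 ?expR_gt0// invr_gt0 expr0.
have lam0 : 0 < lam by rewrite invr_gt0.
pose chi x := expR 1 * flat 0 (1 + (- lam) * flat 0 (q x + (- (1 / 4)))).
have f1 : expR 1 * flat 0 1 = 1.
  by rewrite /flat ltr01 expr0 !invr1 mul1r -expRD subrr expR0.
exists chi; split.
- apply: smooth_mul; first exact: smooth_cst.
  apply: flat_smooth_comp; apply: smooth_add; first exact: smooth_cst.
  apply: smooth_mul; first exact: smooth_cst.
  by apply: flat_smooth_comp; apply: smooth_add => //; exact: smooth_cst.
- move=> x; rewrite /chi mulr_ge0 ?expR_ge0 ?flat_ge0//= -[leRHS]f1.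
  rewrite ler_wpM2l ?expR_ge0//; apply: flat0_mono.
  by rewrite mulNr gerDl oppr_le0 mulr_ge0 ?flat_ge0// ltW.
- move=> x xh; rewrite /chi (flat0 0 (t := q x - _)) ?mulr0 ?addr0//.
  rewrite qE subr_le0 (_ : 1 / 4 = (2^-1) ^+ 2); last by field.
  by rewrite lerXn2r ?nnegrE ?enorm_ge0.
- move=> x x1; rewrite /chi flat0 ?mulr0// mulNr subr_le0.
  rewrite -(@ler_pM2l _ (flat 0 (3 / 4))) // mulr1 /lam mulVKf ?gt_eqF//.
  apply: flat0_mono; rewrite lerBrDr qE.
  have : 1 <= enorm x ^+ 2 by rewrite exprn_ege1// (le_trans x1)// norm_le_enorm.
  lra.
Qed.

End Bump.

(** * Components of vector charges *)

Section ComplexNorm.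
Context {R : realType}.
Local Notation C := R[i].
Local Notation Re := complex.Re.
Local Notation Im := complex.Im.
Local Notation normc := Normc.normc.

(** Real and imaginary parts are indexed by a boolean so that statements about both are
    proved once. *)
Definition cpart (b : bool) (z : C) : R := if b then Im z else Re z.

Lemma compD b (z w : C) : cpart b (z + w) = cpart b z + cpart b w.
Proof. by case: b z w => -[? ?] [? ?]. Qed.

Lemma compB b (z w : C) : cpart b (z - w) = cpart b z - cpart b w.
Proof. by case: b z w => -[? ?] [? ?]. Qed.

Lemma comp_sum b (I : Type) (s : seq I) (f : I -> C) :
  cpart b (\sum_(i <- s) f i) = \sum_(i <- s) cpart b (f i).
Proof.
elim: s => [|i s IH]; first by rewrite !big_nil; case: b.
by rewrite !big_cons compD IH.
Qed.

Lemma comp_real_mul b (c : R) (z : C) : cpart b (real_complex R c * z) = c * cpart b z.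
Proof. by case: b z => -[x y] /=; rewrite mul0r ?addr0 ?subr0. Qed.

Lemma complex_eqP (z w : C) : (forall b, cpart b z = cpart b w) -> z = w.
Proof.
by case: z w => [x y] [x' y'] h; have := h false; have := h true => /= -> ->.
Qed.

Lemma comp_normc b (z : C) : `|cpart b z| <= normc z.
Proof.
case: z => x y; rewrite /normc -sqrtr_sqr ler_wsqrtr//.
by case: b => /=; rewrite ?lerDl ?lerDr sqr_ge0.
Qed.

Lemma normc_ge0 (z : C) : 0 <= normc z.
Proof. by case: z => x y; exact: sqrtr_ge0. Qed.

Lemma normc_le_comp (z : C) : normc z <= `|cpart false z| + `|cpart true z|.
Proof.
case: z => x y; rewrite /normc /=.
have h : 0 <= `|x| + `|y| by rewrite addr_ge0.
rewrite -(ger0_norm h) -sqrtr_sqr ler_wsqrtr// sqrrD !real_normK ?num_real//.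
by rewrite addrAC lerDl mulrn_wge0// mulr_ge0.
Qed.

Lemma row_complex_eqP l (v w : 'rV[C]_l) :
  (forall k b, cpart b (v 0 k) = cpart b (w 0 k)) -> v = w.
Proof. by move=> h; apply/rowP => k; apply: complex_eqP => b; exact: h. Qed.

Lemma cnorm_ge0 l (v : 'rV[C]_l) : 0 <= cnorm v.
Proof. exact: sqrtr_ge0. Qed.

Lemma normc_le_cnorm l (v : 'rV[C]_l) k : normc (v 0 k) <= cnorm v.
Proof.
rewrite -(ger0_norm (normc_ge0 (v 0 k))) -sqrtr_sqr ler_wsqrtr// (bigD1 k)//= lerDl.
by apply: sumr_ge0 => j _; exact: sqr_ge0.
Qed.

Lemma comp_le_cnorm l b (v : 'rV[C]_l) k : `|cpart b (v 0 k)| <= cnorm v.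
Proof. exact: le_trans (comp_normc _ _) (normc_le_cnorm _ _). Qed.

Lemma sum_sqr_le (I : Type) (s : seq I) (f : I -> R) : (forall i, 0 <= f i) ->
  \sum_(i <- s) f i ^+ 2 <= (\sum_(i <- s) f i) ^+ 2.
Proof.
move=> f0; elim: s => [|i s IH]; first by rewrite !big_nil expr0n.
rewrite !big_cons sqrrD -addrA lerD2l (le_trans IH)// lerDr mulrn_wge0// mulr_ge0//.
exact: sumr_ge0.
Qed.

Lemma cnorm_le_sum l (v : 'rV[C]_l) : cnorm v <= \sum_k normc (v 0 k).
Proof.
have h : 0 <= \sum_k normc (v 0 k) by apply: sumr_ge0 => k _; exact: normc_ge0.
rewrite -(ger0_norm h) -sqrtr_sqr ler_wsqrtr// sum_sqr_le// => k.
exact: normc_ge0.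
Qed.

Lemma cnormZ l (c : C) (v : 'rV[C]_l) : cnorm (c *: v) = normc c * cnorm v.
Proof.
rewrite /cnorm -{1}(ger0_norm (normc_ge0 c)) -sqrtr_sqr -sqrtrM ?sqr_ge0//.
congr Num.sqrt; rewrite mulr_sumr; apply: eq_bigr => k _.
by rewrite mxE Normc.normcM exprMn.
Qed.

Lemma normc_real (c : R) : normc (real_complex R c) = `|c|.
Proof. by rewrite /normc /= expr0n addr0 sqrtr_sqr. Qed.

Lemma cvgC_comp l (u : nat -> 'rV[C]_l) v b k : cvgC u v ->
  (fun n => cpart b (u n 0 k)) @ \oo --> cpart b (v 0 k).
Proof.
move=> /cvgrPdist_lt h; apply/cvgrPdist_lt => e e0; apply: filterS (h e e0) => n.
rewrite sub0r normrN ger0_norm ?cnorm_ge0// distrC => /(le_lt_trans _); apply.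
by rewrite -compB; have := comp_le_cnorm b (u n - v) k; rewrite !mxE.
Qed.

Lemma cvg_sum_seq (I : Type) (s : seq I) (f : I -> nat -> R) (a : I -> R) :
  (forall i, f i @ \oo --> a i) ->
  (fun n => \sum_(i <- s) f i n) @ \oo --> \sum_(i <- s) a i.
Proof.
move=> h; elim: s => [|i s IH].
  by rewrite big_nil; under eq_fun do rewrite big_nil; exact: cvg_cst.
by rewrite big_cons; under eq_fun do rewrite big_cons; apply: cvgD.
Qed.

Lemma comp_cvgC l (u : nat -> 'rV[C]_l) (v : 'rV[C]_l) :
  (forall b k, (fun n => cpart b (u n 0 k)) @ \oo --> cpart b (v 0 k)) -> cvgC u v.
Proof.
move=> h.
have h0 b k : (fun n => `|cpart b ((u n - v) 0 k)|) @ \oo --> (0 : R).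
  have -> : (fun n => `|cpart b ((u n - v) 0 k)|) =
      (fun n => `|cpart b (u n 0 k) - cpart b (v 0 k)|).
    by apply/funext => n; rewrite !mxE compB.
  rewrite -[X in _ --> X](@normr0 _ R) -(subrr (cpart b (v 0 k))).
  by apply: cvg_norm; apply: cvgB; [exact: h|exact: cvg_cst].
rewrite /cvgC.
apply: (@squeeze_cvgr _ _ _ _ (fun=> 0)
  (fun n => \sum_k (`|cpart false ((u n - v) 0 k)| + `|cpart true ((u n - v) 0 k)|))).
- apply: nearW => n; rewrite cnorm_ge0 /=; apply: le_trans (cnorm_le_sum _) _.
  by apply: ler_sum => k _; exact: normc_le_comp.
- exact: cvg_cst.
- rewrite -[X in _ --> X](_ : \sum_(k < l) (0 + 0 : R) = 0); last by rewrite big1// addr0.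
  by apply: cvg_sum_seq => k; apply: cvgD; exact: h0.
Qed.

End ComplexNorm.

Section ChargeComponents.
Context {R : realType} {d : nat}.
Local Notation C := R[i].
Local Notation E := 'rV[R]_d.
Local Notation BE := (borelRd R d).

Definition component l (mu : set E -> 'rV[C]_l) (k : 'I_l) (b : bool) : set E -> R :=
  fun B => cpart b (mu B 0 k).

Lemma tvar_ge l (mu : set E -> 'rV[C]_l) (A B : set E) :
  bounded_borel B -> B `<=` A -> ((cnorm (mu B))%:E <= tvar mu A)%E.
Proof.
move=> bB BA; apply: ereal_sup_ubound; exists 1%N, (fun=> B); split => //.
  by move=> i j _ _ _; rewrite !ord1.
by rewrite big_ord_recl big_ord0 addr0.
Qed.

Lemma lf_charge_component l (mu : set E -> 'rV[C]_l) k b : lf_charge mu ->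
  real_charge (component mu k b).
Proof.
move=> [madd mfin]; split=> [F bF tF bUF|B bB].
  have := @cvgC_comp _ _ _ _ b k (madd F bF tF bUF).
  have -> : (fun n => cpart b ((\sum_(i < n) mu (F i)) 0 k)) =
      (fun n => \sum_(i < n) component mu k b (F i)).
    by apply/funext => n; rewrite summxE comp_sum.
  by [].
split.
  apply: le_lt_trans (mfin B bB); apply: ge_ereal_sup => _ [A [bA AB] <-].
  apply: le_trans (tvar_ge mu bA AB); rewrite lee_fin.
  exact: le_trans (ler_norm _) (comp_le_cnorm _ _ _).
apply: le_lt_trans (mfin B bB); apply: ge_ereal_sup => _ [A [bA AB] <-].
apply: le_trans (tvar_ge mu bA AB); rewrite lee_fin.
apply: le_trans (ler_norm _) _; rewrite normrN; exact: comp_le_cnorm.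
Qed.

Lemma component_neq0 l (mu : set E -> 'rV[C]_l) B : mu B <> 0 ->
  exists k b, component mu k b B != 0.
Proof.
move=> muB; apply: contrapT => h; apply: muB; apply/matrixP => i k.
rewrite ord1 mxE; apply: complex_eqP => b.
have -> : cpart b 0 = 0 :> R by case: b.
by apply/eqP; apply/negPn/negP => hk; apply: h; exists k, b.
Qed.

Lemma lf_measure_fin (nu : {measure set BE -> \bar R}) B : lf_measure nu ->
  bounded_borel B -> nu B \is a fin_num.
Proof. by move=> lf bB; rewrite ge0_fin_numE// lf. Qed.

Lemma lf_measure_series (nu : {measure set BE -> \bar R}) (F : nat -> set E) :
  lf_measure nu -> (forall i, bounded_borel (F i)) -> trivIset setT F ->
  bounded_set (\bigcup_i F i) ->
  (fun n => \sum_(i < n) fine (nu (F i))) @ \oo --> fine (nu (\bigcup_i F i)).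
Proof.
move=> lf bF tF bUF.
have rc : real_charge (fun B => fine (nu B) - fine ((mzero : {measure set BE -> \bar R}) B)).
  by apply: (@real_charge_diff _ _ _ nu mzero) => // B _; rewrite /mzero ltry.
case: rc => h _; have := h F bF tF bUF; rewrite /mzero /= subr0.
by under eq_fun do under eq_bigr do rewrite subr0.
Qed.

Lemma lf_charge_tensor l (a : 'rV[C]_l) (nu : {measure set BE -> \bar R}) :
  lf_measure nu -> lf_charge (tensor a nu).
Proof.
move=> lf; split=> [F bF tF bUF|B bB].
  apply: comp_cvgC => b k.
  have -> : (fun n => cpart b ((\sum_(i < n) tensor a nu (F i)) 0 k)) =
      (fun n => (\sum_(i < n) fine (nu (F i))) * cpart b (a 0 k)).
    apply/funext => n; rewrite summxE comp_sum mulr_suml.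
    by apply: eq_bigr => i _; rewrite /tensor !mxE comp_real_mul.
  rewrite /tensor !mxE comp_real_mul.
  by apply: cvgM; [exact: lf_measure_series|exact: cvg_cst].
apply: (@le_lt_trans _ _ (fine (nu B) * cnorm a)%:E); last exact: ltry.
apply: ge_ereal_sup => _ [n [F [bF FB tF ->]]]; rewrite lee_fin.
have -> : \sum_i cnorm (tensor a nu (F i)) = (\sum_i fine (nu (F i))) * cnorm a.
  rewrite mulr_suml; apply: eq_bigr => i _.
  by rewrite /tensor cnormZ normc_real ger0_norm// fine_ge0.
rewrite ler_wpM2r ?cnorm_ge0// -lee_fin -sumEFin (fineK (lf_measure_fin lf bB)).
rewrite (eq_bigr (fun i => nu (F i))); last first.
  by move=> i _; rewrite fineK// lf_measure_fin.
have mF i : measurable (F i : set BE) by case: (bF i).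
rewrite -(@measure_bigsetU_ord _ _ BE nu n xpredT F mF tF).
apply: le_measure; rewrite ?inE.
- exact: (@bigsetU_measurable _ BE).
- by case: bB.
- by elim/big_ind: _ => // A A' hA hA'; rewrite subUset.
Qed.

Lemma Rintegral_mscale (nu : {measure set BE -> \bar R}) (c : {nonneg R}) (f : E -> R) :
  nu.-integrable [set: BE] (EFin \o f) ->
  \int[mscale c nu]_x f x = c%:num * \int[nu]_x f x.
Proof.
move=> fi; rewrite /Rintegral integralE [in RHS]integralE.
have mf := measurable_int _ fi.
have pf : (\int[nu]_x ((fun y : BE => (f y)%:E) ^\+ x) \is a fin_num)%E.
  by apply: integrable_fin_num => //; exact: integrable_funepos.
have nf : (\int[nu]_x ((fun y : BE => (f y)%:E) ^\- x) \is a fin_num)%E.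
  by apply: integrable_fin_num => //; exact: integrable_funeneg.
rewrite !ge0_integral_mscale//.
- by rewrite -(fineK pf) -(fineK nf) /= mulrBr.
- exact: measurable_funeneg.
- exact: measurable_funepos.
Qed.

Lemma lf_mscale (nu : {measure set BE -> \bar R}) (c : {nonneg R}) :
  lf_measure nu -> lf_measure (mscale c nu).
Proof. by move=> lf B bB; rewrite /= /mscale lte_mul_pinfty ?lf. Qed.

(** The sign of [alpha] decides which of the two measures of the difference is zero. *)
Lemma rint_scale_measure (nu : {measure set BE -> \bar R}) (alpha : R) (f : E -> R) :
  lf_measure nu -> Cc f ->
  rint f (fun B => fine (nu B) * alpha) = (\int[nu]_x f x) * alpha.
Proof.
move=> lf cf.
have p0 : 0 <= Num.max alpha 0 by rewrite le_max lexx orbT.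
have n0 : 0 <= Num.max (- alpha) 0 by rewrite le_max lexx orbT.
have aE : alpha = Num.max alpha 0 - Num.max (- alpha) 0.
  case: (leP 0 alpha) => h; first by rewrite max_r ?oppr_le0// subr0.
  by rewrite max_l ?sub0r ?opprK// oppr_ge0 ltW.
rewrite (@rint_diff _ _ _ (mscale (NngNum p0) nu) (mscale (NngNum n0) nu))//; last 3 first.
- exact: lf_mscale.
- exact: lf_mscale.
- move=> B bB; rewrite /= /mscale !fineM ?(lf_measure_fin lf bB)//=.
  by rewrite -mulrBl -aE mulrC.
rewrite !Rintegral_mscale ?integrable_Cc//= -mulrBl -aE mulrC//.
Qed.

End ChargeComponents.

(** * Blow-ups of measures and polynomial growth *)

Section Dilation.
Context {R : realType} {d : nat}.
Local Notation E := 'rV[R]_d.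
Local Notation BE := (borelRd R d).
Implicit Types (m p : {measure set BE -> \bar R}).

Lemma rescale_image (x : E) (r : R) (B : set E) : 0 < r ->
  [set x + r *: y | y in B] = (fun y => r^-1 *: (y - x)) @^-1` B.
Proof.
move=> r0; have rn : r != 0 by rewrite gt_eqF.
apply/seteqP; split => [_ [y By <-] /=|z /= Bz].
  by rewrite addrC addKr scalerA mulVf// scale1r.
by exists (r^-1 *: (z - x)) => //; rewrite scalerA mulfV// scale1r addrC subrK.
Qed.

Lemma rescale_continuous (x : E) (r : R) : continuous (fun y : E => r *: (y - x)).
Proof.
move=> y; apply: (@continuous_comp _ _ _ (fun y : E => y - x) ( *:%R r)); last exact: scaler_continuous.
by apply: continuousB; [exact: cvg_id|exact: cst_continuous].
Qed.

Lemma rescale_measurable (x : E) (r : R) :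
  measurable_fun [set: BE] ((fun y => r *: (y - x)) : BE -> BE).
Proof.
apply: (@measurability _ _ BE BE _ _ (@open E)) => //.
move=> _ [U oU <-]; rewrite setTI; apply: open_borel.
by apply: open_comp => // y _; exact: rescale_continuous.
Qed.

Lemma Cc_rescale (f : E -> R) (x : E) (r : R) : 0 < r -> Cc f ->
  Cc (fun y => f (r^-1 *: (y - x))).
Proof.
move=> r0 [cf [M fM]]; split.
  move=> y; apply: (continuous_comp (@rescale_continuous x r^-1 y)); exact: cf.
exists (`|x| + r * M) => y hy; apply: fM.
rewrite normrZ ger0_norm ?invr_ge0 ?ltW// mulrC ltr_pdivlMr// mulrC.
rewrite -(ltrD2l `|x|) (lt_le_trans hy)// addrC -[X in `|X| <= _](subrK x y).
exact: ler_normD.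
Qed.

(** The normalised dilation of [m] is a multiple of its image under
    [y |-> r^-1 *: (y - x)]. *)
Lemma dilated_measure m (x : E) (r c : R) : lf_measure m -> 0 < r -> 0 <= c ->
  exists m', [/\ forall B, m' B = (c%:E * m [set (x + r *: y)%R | y in B])%E,
    lf_measure m' & forall f, Cc f ->
    \int[m']_y f y = c * \int[m]_y f (r^-1 *: (y - x))].
Proof.
move=> lf r0 c0.
pose A : BE -> BE := fun y => r^-1 *: (y - x).
have mA : measurable_fun [set: BE] A by exact: rescale_measurable.
have [q qE] : exists q : {measure set BE -> \bar R},
    (q : set BE -> \bar R) = pushforward m A.
  apply: exists_measure => [|B|F mF tF mUF].
  - by rewrite /pushforward preimage_set0 measure0.
  - exact: measure_ge0.
  - rewrite /pushforward preimage_bigcup; apply: measure_semi_sigma_additive.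
    + by move=> i; rewrite -[X in measurable X]setTI; exact: mA.
    + by apply/trivIsetP => i j _ _ ij; rewrite -preimage_setI;
        move/trivIsetP : tF => ->//; rewrite preimage_set0.
    + by rewrite -preimage_bigcup -[X in measurable X]setTI; exact: mA.
have lfq : lf_measure q.
  move=> B bB; rewrite qE /pushforward; apply: lf; split.
    by rewrite -[X in measurable X]setTI; apply: mA => //; case: bB.
  case: bB => _ /bounded_cball[M hM]; apply/bounded_cball.
  exists (`|x| + r * M) => y /= /hM; rewrite /cball /= !subr0.
  have ri : 0 <= r^-1 by rewrite invr_ge0 ltW.
  have -> : `|A y| = r^-1 * `|(y : E) - x| by rewrite /A normrZ (ger0_norm ri).
  rewrite ler_pdivrMl// => h.
  by rewrite -[y](subrK x) addrC (le_trans (ler_normD _ _))// lerD2l.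
exists (mscale (NngNum c0) q); split.
- by move=> B; rewrite /= /mscale /= qE /pushforward rescale_image.
- exact: lf_mscale.
- move=> f cf; rewrite Rintegral_mscale ?integrable_Cc//=; congr (_ * fine _).
  rewrite (@eq_measure_integral _ _ _ _ (pushforward m A)); last first.
    by move=> B _ _; rewrite qE.
  rewrite integral_pushforward//.
    by apply/measurable_EFinP; exact: Cc_borel.
  apply: (@integrable_Cc _ _ m (fun y => f (r^-1 *: (y - x)))) => //.
  exact: Cc_rescale.
Qed.

End Dilation.

Section Growth.
Context {R : realType} {d : nat}.
Local Notation E := 'rV[R]_d.
Local Notation BE := (borelRd R d).
Implicit Types (m p l : {measure set BE -> \bar R}).

Definition growth (C : R) (N : nat) m :=
  forall r, 1 <= r -> fine (m (cball 0 r)) <= C * r ^+ N.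

Lemma pow2_between (t : R) : 1 <= t -> exists k : nat, 2 ^+ k <= t < 2 ^+ k.+1.
Proof.
move=> t1; have [n tn] : exists n : nat, t < 2 ^+ n.
  have t0 : 0 < t^-1 by rewrite invr_gt0 (lt_le_trans _ t1).
  have [n hn] := exp2N_lt t0; exists n.
  by rewrite -ltf_pV2 ?posrE ?exprn_gt0// (lt_le_trans _ t1).
elim: n tn => [|n IH] tn; first by rewrite expr0 ltNge t1 in tn.
by have [/IH//|h] := ltP t (2 ^+ n); exists n; rewrite h.
Qed.

(** Multiples of indicators of balls: their sum dominates the weight
    [(1 + |y|)^-(N+1)] off the ball of radius [2 ^+ K] (everywhere if [K = 0]), and the
    integral of each is read off from the growth. *)
Definition shells (N K : nat) (y : E) (i : nat) : R :=
  (2 ^- (K + i)) ^+ N.+1 * \1_(cball 0 (2 ^+ (K + i).+1) : set E) y.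

Lemma shells_ge0 N K y i : 0 <= shells N K y i.
Proof. by rewrite /shells mulr_ge0// exprn_ge0. Qed.

Lemma weight_shell N K (y : E) : ((0 < K)%N -> 2 ^+ K < `|y|) ->
  exists i, (1 + `|y|) ^- N.+1 <= shells N K y i.
Proof.
move=> hK.
suff [i [h1 h2]] : exists i, 2 ^+ (K + i) <= 1 + `|y| /\ `|y| <= 2 ^+ (K + i).+1.
  exists i; rewrite /shells indicE mem_set ?mulr1; last by rewrite /cball /= subr0.
  rewrite exprVn lef_pV2 ?posrE ?exprn_gt0 ?ltr_wpDr//.
  by apply: lerXn2r => //; rewrite nnegrE ?exprn_ge0 ?addr_ge0.
have [y1|y1] := ltP `|y| 1.
  exists 0%N; case: K hK => [_|K hK]; first by rewrite expr0 expr1 lerDl; split => //; lra.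
  have := hK isT; have : 1 <= 2 ^+ K.+1 :> R by rewrite exprn_ege1// ler1n.
  lra.
have [k /andP[k1 k2]] := pow2_between y1.
have Kk : (K <= k)%N.
  case: K hK => // K hK; rewrite -ltnS -(@ltr_eXn2l R 2) ?ltr1n//.
  exact: lt_trans (hK isT) k2.
by exists (k - K)%N; rewrite subnKC//; split; [lra|exact: ltW].
Qed.

Lemma growth_ge0 C N m : growth C N m -> 0 <= C.
Proof.
move=> /(_ 1 (lexx _)); rewrite expr1n mulr1; apply: le_trans.
by rewrite fine_ge0.
Qed.

(** The integrals of the shells form a geometric series; functions that vanish on a
    large ball use only its tail. *)
Lemma decay_integral m C N K A (f : E -> R) : lf_measure m -> growth C N m ->
  measurable_fun [set: BE] (f : BE -> R) -> 0 <= A ->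
  (forall y, `|f y| <= A * (1 + `|y|) ^- N.+1) ->
  (forall y, f y != 0 -> (0 < K)%N -> 2 ^+ K < `|y|) ->
  m.-integrable [set: BE] (EFin \o (f : BE -> R)) /\
  `|\int[m]_y f y| <= A * (C * 2 ^+ N.+1 * 2 ^- K).
Proof.
move=> lf gm mf A0 fA fK; have C0 := growth_ge0 gm.
have mS i : measurable_fun [set: BE] (fun y : BE => (A * shells N K y i)%:E).
  apply/measurable_EFinP; apply: measurable_funM; first exact: measurable_cst.
  apply: measurable_funM; first exact: measurable_cst.
  by apply: measurable_indic; exact: measurable_cball.
have S0 i (y : BE) : (0 <= (A * shells N K y i)%:E)%E.
  by rewrite lee_fin mulr_ge0// shells_ge0.
have mB i : m (cball 0 (2 ^+ i)) \is a fin_num.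
  by apply: lf_measure_fin => //; exact: bounded_borel_cball.
have key : (\int[m]_y `|(f y)%:E| <= (A * (C * 2 ^+ N.+1 * 2 ^- K))%:E)%E.
  apply: (@le_trans _ _ (\int[m]_(y in setT) \sum_(0 <= i <oo) (A * shells N K y i)%:E)%E).
    apply: ge0_le_integral => //.
    - by apply: measurableT_comp => //; exact/measurable_EFinP.
    - by apply: (@ge0_emeasurable_sum _ _ _ _ _ xpredT).
    - move=> y _ /=; have [->|fy] := eqVneq (f y) 0.
        by rewrite normr0; apply: nneseries_ge0 => i _ _; exact: S0.
      have [i hi] := weight_shell N (fK y fy).
      apply: (@le_trans _ _ (A * shells N K y i)%:E).
        by rewrite lee_fin (le_trans (fA y))// ler_wpM2l.
      rewrite (@nneseriesD1 _ _ i)//.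
      by rewrite leeDl//; apply: nneseries_ge0 => k _ _; exact: S0.
  rewrite integral_nneseries//.
  set e := A * _.
  have e0 : 0 <= e by rewrite /e !mulr_ge0 ?invr_ge0 ?exprn_ge0.
  apply: (@le_trans _ _ (\sum_(0 <= i <oo) (e / (2 ^ i.+1)%:R)%:E)%E); last first.
    exact: epsilon_trick0.
  apply: lee_nneseries => [i _ _|i _]; first by apply: integral_ge0 => y _; exact: S0.
  rewrite /shells; under eq_integral do rewrite mulrA EFinM.
  rewrite ge0_integralZl//; last 2 first.
  - by apply/measurable_EFinP; apply: measurable_indic; exact: measurable_cball.
  - by rewrite lee_fin mulr_ge0// !exprn_ge0// invr_ge0 exprn_ge0.
  rewrite integral_indic ?setIT//; last exact: measurable_cball.
  rewrite -(fineK (mB _)) -EFinM lee_fin.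
  apply: (@le_trans _ _ (A * (2 ^- (K + i)) ^+ N.+1 * (C * (2 ^+ (K + i).+1) ^+ N))).
    rewrite ler_wpM2l ?mulr_ge0 ?exprn_ge0 ?invr_ge0 ?exprn_ge0//.
    by apply: gm; rewrite exprn_ege1// ler1n.
  have z0 : 2 ^+ (K + i) != 0 :> R by rewrite expf_neq0.
  have k0 : 2 ^+ K != 0 :> R by rewrite expf_neq0.
  have i0 : 2 ^+ i != 0 :> R by rewrite expf_neq0.
  rewrite /e le_eqVlt; apply/orP; left; apply/eqP.
  rewrite natrX (exprS _ (K + i)) (exprS _ i) exprMn exprVn (exprS (2 ^+ _) N).
  rewrite (exprS 2 N).
  have -> : 2 ^+ (K + i) = 2 ^+ K * 2 ^+ i :> R by rewrite exprD.
  rewrite exprMn; field.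
  by rewrite !expf_neq0.
have fi : m.-integrable [set: BE] (EFin \o (f : BE -> R)).
  apply/integrableP; split; first exact/measurable_EFinP.
  by apply: le_lt_trans key _; exact: ltry.
split => //; rewrite -lee_fin; apply: le_trans key.
rewrite EFin_normr_Rintegral//; apply: le_abse_integral => //.
exact/measurable_EFinP.
Qed.
Lemma growth_le p m C N : lf_measure m -> growth C N m ->
  (forall B, measurable (B : set BE) -> (p B <= m B)%E) -> growth C N p.
Proof.
move=> lfm gm pm r r1; apply: le_trans (gm r r1).
have mC : measurable (cball 0 r : set BE) by exact: measurable_cball.
have fm : m (cball 0 r) \is a fin_num.
  by apply: lf_measure_fin => //; exact: bounded_borel_cball.
by rewrite fine_le ?pm// ge0_fin_numE// (le_lt_trans (pm _ mC))// ltey_eq fm.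
Qed.

Lemma lf_le p m : lf_measure m ->
  (forall B, measurable (B : set BE) -> (p B <= m B)%E) -> lf_measure p.
Proof. by move=> lfm pm B bB; apply: le_lt_trans (lfm B bB); apply: pm; case: bB. Qed.

Lemma growth_limit (m : nat -> {measure set BE -> \bar R})
    (nu : {measure set BE -> \bar R}) C N :
  (forall j, lf_measure (m j)) -> lf_measure nu -> (forall j, growth C N (m j)) ->
  (forall f : E -> R, Cc f -> (fun j => \int[m j]_y f y) @ \oo --> \int[nu]_y f y) ->
  growth (C * 2 ^+ N) N nu.
Proof.
move=> lfm lfn gm cv r r1; have r0 : 0 < r by rewrite (lt_le_trans _ r1).
apply: le_trans (measure_cball_le_tent lfn r0) _.
apply: (cvgr_to_le (cv _ (Cc_tent r0))).
apply: nearW => j; apply: le_trans (tent_le_measure_cball (lfm j) r0) _.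
apply: le_trans (gm j (2 * r) _) _; first by lra.
by rewrite exprMn mulrA.
Qed.

Lemma mass_limit (m : nat -> {measure set BE -> \bar R})
    (nu : {measure set BE -> \bar R}) r c : 0 < r ->
  (forall j, lf_measure (m j)) -> lf_measure nu ->
  (forall f : E -> R, Cc f -> (fun j => \int[m j]_y f y) @ \oo --> \int[nu]_y f y) ->
  (\forall j \near \oo, c <= fine (m j (cball 0 r))) -> c <= fine (nu (cball 0 (2 * r))).
Proof.
move=> r0 lfm lfn cv hc; apply: le_trans (tent_le_measure_cball lfn r0).
apply: (cvgr_to_ge (cv _ (Cc_tent r0))); apply: filterS hc => j h.
exact: le_trans h (measure_cball_le_tent (lfm j) r0).
Qed.

Lemma integral_measure_le p m l (g : R) (f : E -> R) :
  lf_measure p -> lf_measure m -> lf_measure l -> 0 <= g ->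
  (forall B, measurable (B : set BE) -> (p B <= g%:E * m B + l B)%E) ->
  Cc f -> (forall y, 0 <= f y) ->
  \int[p]_y f y <= g * \int[m]_y f y + \int[l]_y f y.
Proof.
move=> lfp lfm lfl g0 pml cf f0.
have ip := integrable_Cc lfp cf; have im := integrable_Cc lfm cf.
have il := integrable_Cc lfl cf.
have lfs := lf_mscale (NngNum g0) lfm.
have i_s := integrable_Cc lfs cf.
have mf : measurable_fun [set: BE] (EFin \o (f : BE -> R)).
  by apply/measurable_EFinP; exact: Cc_borel.
rewrite -[g]/((NngNum g0)%:num) -Rintegral_mscale// -lee_fin EFinD.
rewrite /Rintegral !fineK; last 3 first.
- exact: integrable_fin_num.
- exact: integrable_fin_num.
- exact: integrable_fin_num.
have -> : (\int[mscale (NngNum g0) m]_x (f x)%:E + \int[l]_x (f x)%:E =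
  \int[measure_add (mscale (NngNum g0) m) l]_x (f x)%:E)%E.
  by rewrite integral_measure_add.
apply: ge0_le_measure_integral => //.
- move=> B mB; change (p B <= measure_add (mscale (NngNum g0) m) l B)%E.
  by rewrite measure_addE; exact: pml.
Qed.

Lemma integral_measure_close p m l (g : R) (f : E -> R) :
  lf_measure p -> lf_measure m -> lf_measure l -> 0 <= g ->
  (forall B, measurable (B : set BE) -> (p B <= g%:E * m B + l B)%E) ->
  (forall B, measurable (B : set BE) -> (g%:E * m B <= p B + l B)%E) ->
  Cc f -> (forall y, 0 <= f y) ->
  `|\int[p]_y f y - g * \int[m]_y f y| <= \int[l]_y f y.
Proof.
move=> lfp lfm lfl g0 h1 h2 cf f0.
have i1 := integral_measure_le lfp lfm lfl g0 h1 cf f0.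
have lfs := lf_mscale (NngNum g0) lfm.
have i2 : \int[mscale (NngNum g0) m]_y f y <= 1 * \int[p]_y f y + \int[l]_y f y.
  by apply: integral_measure_le => // B mB; rewrite mul1e; exact: h2.
rewrite Rintegral_mscale ?integrable_Cc//= mul1r in i2.
by rewrite ler_distl; apply/andP; split; lra.
Qed.

Lemma Cc_le_tent (f : E -> R) : Cc f ->
  exists K r : R, [/\ 0 <= K, 0 < r & forall y, `|f y| <= K * tent r y].
Proof.
move=> cf; have [K K0 fK] := Cc_bounded cf; have [_ [M fM]] := cf.
have r0 : 0 < Num.max M 1 by rewrite lt_max ltr01 orbT.
exists K, (Num.max M 1); split => // y; have [yM|yM] := leP `|y| M.
  by rewrite tent1 ?mulr1//; apply: le_trans yM _; rewrite le_max lexx.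
by rewrite fM// normr0 mulr_ge0// tent_ge0.
Qed.

(** For nonnegative [f] the difference of the two integrals is at most the integral of
    [f] against [l j]; a general [f] becomes nonnegative by adding a multiple of a
    cut-off. *)
Lemma density_limit_Cc (m p l : nat -> {measure set BE -> \bar R})
    (nu : {measure set BE -> \bar R}) (g : R) (f : E -> R) :
  (forall j, lf_measure (m j)) -> (forall j, lf_measure (p j)) ->
  (forall j, lf_measure (l j)) -> lf_measure nu -> 0 <= g ->
  (forall j B, measurable (B : set BE) -> (p j B <= g%:E * m j B + l j B)%E) ->
  (forall j B, measurable (B : set BE) -> (g%:E * m j B <= p j B + l j B)%E) ->
  (forall M e, 0 < e -> \forall j \near \oo, fine (l j (cball 0 M)) <= e) ->
  (forall f : E -> R, Cc f -> (fun j => \int[m j]_y f y) @ \oo --> \int[nu]_y f y) ->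
  Cc f -> (fun j => \int[p j]_y f y) @ \oo --> g * \int[nu]_y f y.
Proof.
move=> lfm lfp lfl lfn g0 h1 h2 hl cv cf.
have pos (h : E -> R) : Cc h -> (forall y, 0 <= h y) ->
    (fun j => \int[p j]_y h y) @ \oo --> g * \int[nu]_y h y.
  move=> ch h0.
  have d0 : (fun j => \int[p j]_y h y - g * \int[m j]_y h y) @ \oo --> (0 : R).
    have [K [r [K0 r0 hT]]] := Cc_le_tent ch.
    apply/cvgrPdist_le => e e0.
    have K1 : 0 < K + 1 by rewrite ltr_wpDl.
    apply: filterS (hl (2 * r) (e / (K + 1)) (divr_gt0 e0 K1)) => j hj.
    rewrite sub0r normrN.
    apply: le_trans (integral_measure_close (lfp j) (lfm j) (lfl j) g0 (h1 j) (h2 j) ch h0) _.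
    apply: (@le_trans _ _ (\int[l j]_y (K * tent r y))).
      apply: le_Rintegral => //; first exact: integrable_Cc.
        by apply: integrable_Cc => //; apply: Cc_scale; exact: Cc_tent.
      by move=> y _; exact: le_trans (ler_norm _) (hT y).
    rewrite RintegralZl//; last by apply: integrable_Cc => //; exact: Cc_tent.
    apply: (@le_trans _ _ ((K + 1) * (e / (K + 1)))).
      apply: ler_pM => //; last exact: le_trans (tent_le_measure_cball (lfl j) r0) hj.
      + by apply: Rintegral_ge0 => y _; exact: tent_ge0.
      + by rewrite lerDl.
    by rewrite mulrC divfK// gt_eqF.
  have -> : (fun j => \int[p j]_y h y) =
      (fun j => (\int[p j]_y h y - g * \int[m j]_y h y) + g * \int[m j]_y h y).
    by apply/funext => j; rewrite subrK.
  rewrite -[X in _ --> X]add0r; apply: cvgD => //.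
  by apply: cvgM; [exact: cvg_cst|exact: cv].
have [K [r [K0 r0 hT]]] := Cc_le_tent cf.
have cT : Cc (fun y : E => K * tent r y) by apply: Cc_scale; exact: Cc_tent.
have cS := Cc_add cf cT.
have c1 := pos _ cT (fun y => mulr_ge0 K0 (tent_ge0 r y)).
have c2 : (fun j => \int[p j]_y (f y + K * tent r y)) @ \oo -->
    g * \int[nu]_y (f y + K * tent r y).
  by apply: pos => // y; have := hT y; rewrite ler_norml => /andP[]; lra.
have eqm (m' : {measure set BE -> \bar R}) : lf_measure m' ->
    \int[m']_y f y = \int[m']_y (f y + K * tent r y) - \int[m']_y (K * tent r y).
  by move=> lf'; rewrite RintegralD ?addrK//; exact: integrable_Cc.
rewrite (eqm _ lfn); under eq_fun do rewrite (eqm _ (lfp _)).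
by rewrite mulrBr; apply: cvgB.
Qed.

(** The uniform growth makes the parts of all integrals outside a large ball small at
    once, which reduces the statement to functions of bounded support. *)
Lemma density_limit (m p l : nat -> {measure set BE -> \bar R})
    (nu : {measure set BE -> \bar R}) (g C A : R) N (phi : nat -> E -> R) (f : E -> R) :
  (forall j, lf_measure (m j)) -> (forall j, lf_measure (l j)) -> lf_measure nu ->
  (forall j, growth C N (m j)) -> 0 <= g ->
  (forall j B, measurable (B : set BE) -> (p j B <= m j B)%E) ->
  (forall j B, measurable (B : set BE) -> (p j B <= g%:E * m j B + l j B)%E) ->
  (forall j B, measurable (B : set BE) -> (g%:E * m j B <= p j B + l j B)%E) ->
  (forall M e, 0 < e -> \forall j \near \oo, fine (l j (cball 0 M)) <= e) ->
  (forall h : E -> R, Cc h -> (fun j => \int[m j]_y h y) @ \oo --> \int[nu]_y h y) ->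
  0 <= A -> (forall j, continuous (phi j)) -> continuous f ->
  (forall j y, `|phi j y| <= A * (1 + `|y|) ^- N.+1) ->
  (forall y, `|f y| <= A * (1 + `|y|) ^- N.+1) ->
  (forall M, \forall j \near \oo, forall y, `|y| <= M -> phi j y = f y) ->
  (fun j => \int[p j]_y phi j y) @ \oo --> g * \int[nu]_y f y.
Proof.
move=> lfm lfl lfn gm g0 pm h1 h2 hl cv A0 cphi cf phiA fA phif.
have lfp j : lf_measure (p j) by exact: lf_le (lfm j) (pm j).
have gp j : growth C N (p j) by exact: growth_le (lfm j) (gm j) (pm j).
have gn : growth (C * 2 ^+ N) N nu by exact: growth_limit gm cv.
have C0 : 0 <= C by exact: growth_ge0 (gm 0%N).
pose D := A * (C * 2 ^+ N * 2 ^+ N.+1).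
have D0 : 0 <= D by rewrite !mulr_ge0.
have split_tail C' (m' : {measure set BE -> \bar R}) (h : E -> R) K : lf_measure m' ->
    growth C' N m' -> C' <= C * 2 ^+ N -> continuous h ->
    (forall y, `|h y| <= A * (1 + `|y|) ^- N.+1) ->
    `|\int[m']_y h y - \int[m']_y (h y * tent (2 ^+ K) y)| <= D * 2 ^- K.
  move=> lf' g' C'C ch hA.
  have mh : measurable_fun [set: BE] (h : BE -> R) by exact: continuous_borel.
  have [|ih _] := @decay_integral m' C' N 0 A h lf' g' mh A0 hA; first by [].
  have K0 : 0 < 2 ^+ K :> R by rewrite exprn_gt0.
  have it : m'.-integrable [set: BE] (EFin \o (fun y : BE => h y * tent (2 ^+ K) y)).
    by apply: integrable_Cc => //; apply: Cc_mul => //; exact: Cc_tent.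
  rewrite -RintegralB//.
  have [|||_] := @decay_integral m' C' N K A
      (fun y => h y - h y * tent (2 ^+ K) y) lf' g' _ A0.
  - apply: continuous_borel => y; apply: (continuousB (ch y)).
    by apply: (continuousM (ch y)); exact: continuous_tent.
  - move=> y; rewrite -{1}[h y]mulr1 -mulrBr normrM (le_trans _ (hA y))//.
    rewrite ler_piMr// ger0_norm ?subr_ge0 ?tent_le1//.
    by rewrite lerBlDr lerDl tent_ge0.
  - move=> y; rewrite -{1}[h y]mulr1 -mulrBr => hy _; rewrite ltNge; apply: contra hy.
    by move=> yK; rewrite tent1// subrr mulr0.
  move=> /le_trans; apply; rewrite /D -!mulrA ler_wpM2l// !mulrA ler_wpM2r//.
  by rewrite ler_wpM2r.
have CC : C <= C * 2 ^+ N by rewrite ler_peMr// exprn_ege1// ler1n.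
apply/cvgrPdist_le => e e0.
have [K hK] : exists K : nat, (D + g * D) * 2 ^- K <= e / 2.
  have D1 : 0 < D + g * D + 1 by rewrite ltr_wpDl// addr_ge0// mulr_ge0.
  have [K hK] := exp2N_lt (divr_gt0 (divr_gt0 e0 (ltr0n _ 2)) D1).
  exists K; rewrite ltr_pdivlMr// mulrC in hK; apply: le_trans (ltW hK).
  by rewrite ler_wpM2r ?invr_ge0 ?exprn_ge0// lerDl.
have K0 : 0 < 2 ^+ K :> R by rewrite exprn_gt0.
have cfT : Cc (fun y => f y * tent (2 ^+ K) y) by apply: Cc_mul => //; exact: Cc_tent.
have lim := density_limit_Cc lfm lfp lfl lfn g0 h1 h2 hl cv cfT.
have e2 : 0 < e / 2 by rewrite divr_gt0.
near=> j.
have t1 := split_tail _ _ _ K lfn gn (lexx _) cf fA.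
have t2 := split_tail _ _ _ K (lfp j) (gp j) CC (cphi j) (phiA j).
have eT : \int[p j]_y (phi j y * tent (2 ^+ K) y) = \int[p j]_y (f y * tent (2 ^+ K) y).
  congr fine; apply: eq_integral => y _; congr EFin.
  have [yK|yK] := leP `|y| (2 * 2 ^+ K); last by rewrite tent0 ?mulr0 ?ltW.
  by congr (_ * _); move: y yK; near: j; exact: phif.
have t3 : `|g * \int[nu]_y (f y * tent (2 ^+ K) y) - \int[p j]_y (f y * tent (2 ^+ K) y)| <= e / 2.
  by near: j; move/cvgrPdist_le : lim; exact.
rewrite eT in t2.
have t1' : `|g * \int[nu]_y f y - g * \int[nu]_y (f y * tent (2 ^+ K) y)| <= g * (D * 2 ^- K).
  by rewrite -mulrBr normrM (ger0_norm g0) ler_wpM2l.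
rewrite mulrDl -mulrA in hK.
move: t1' t2 t3 hK; move: (\int[nu]_y f y) => a.
move: (\int[nu]_y (f y * tent (2 ^+ K) y)) => b.
move: (\int[p j]_y (f y * tent (2 ^+ K) y)) => c.
move: (\int[p j]_y phi j y) => a'; move: (D * 2 ^- K) => q.
rewrite !ler_norml => /andP[? ?] /andP[? ?] /andP[? ?] ?.
by apply/andP; split; lra.
Unshelve. all: by end_near. Qed.
End Growth.

(** * Schwartz functions under rescaling *)

Section SchwartzCalculus.
Context {R : realType} {d : nat}.
Local Notation C := R[i].
Local Notation E := 'rV[R]_d.
Local Notation BE := (borelRd R d).
Implicit Types (f : E -> R) (phi psi : E -> C).

Definition compf (b : bool) phi : E -> R := fun x => cpart b (phi x).

Lemma csmoothP phi : csmooth phi <-> forall b, smooth (compf b phi).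
Proof. by split=> [[h1 h2] []|h] //; split; [exact: (h false)|exact: (h true)]. Qed.

Lemma comp_cpartial b s phi x : cpart b (cpartial s phi x) = partial s (compf b phi) x.
Proof. by case: b. Qed.

Lemma schwartz_norm_ge0 N phi : (0 <= schwartz_norm N phi)%E.
Proof.
apply: (@le_trans _ _ ((1 + enorm (0 : E)) ^+ N * Normc.normc (cpartial [::] phi 0))%:E).
  by rewrite lee_fin mulr_ge0 ?normc_ge0// exprn_ge0// addr_ge0// enorm_ge0.
by apply: ereal_sup_ubound; exists [::], 0.
Qed.

Lemma schwartz_norm_le N phi (K : R) :
  (forall b s x, (size s <= N)%N -> (1 + enorm x) ^+ N * `|partial s (compf b phi) x| <= K) ->
  (schwartz_norm N phi <= (2 * K)%:E)%E.
Proof.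
move=> h; apply: ge_ereal_sup => _ [s [x [sN ->]]]; rewrite lee_fin.
apply: le_trans (ler_wpM2l _ (normc_le_comp _)) _.
  by rewrite exprn_ge0// addr_ge0// enorm_ge0.
rewrite !comp_cpartial mulrDr mulr_natl mulr2n lerD//; exact: h.
Qed.

Definition snorm N phi : R := fine (schwartz_norm N phi).

Lemma snorm_ge0 N phi : 0 <= snorm N phi.
Proof. by rewrite /snorm fine_ge0// schwartz_norm_ge0. Qed.

Lemma snormE N phi : schwartz phi -> schwartz_norm N phi = (snorm N phi)%:E.
Proof. by move=> [_ h]; rewrite fineK// ge0_fin_numE ?schwartz_norm_ge0. Qed.

Lemma schwartz_partial N phi b s x : schwartz phi -> (size s <= N)%N ->
  (1 + enorm x) ^+ N * `|partial s (compf b phi) x| <= snorm N phi.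
Proof.
move=> sp sN; rewrite -lee_fin -snormE//.
apply: (@le_trans _ _ ((1 + enorm x) ^+ N * Normc.normc (cpartial s phi x))%:E).
  rewrite lee_fin ler_wpM2l ?exprn_ge0 ?addr_ge0 ?enorm_ge0//.
  by rewrite -comp_cpartial comp_normc.
by apply: ereal_sup_ubound; exists s, x.
Qed.

Lemma schwartz_decay N phi b x : schwartz phi ->
  `|compf b phi x| <= snorm N phi * (1 + `|x|) ^- N.
Proof.
move=> sp; have x0 : 0 < 1 + `|x| by rewrite ltr_wpDr.
rewrite ler_pdivlMr ?exprn_gt0// mulrC.
apply: le_trans (@schwartz_partial N phi b [::] x sp _) => //.
rewrite ler_wpM2r//; apply: lerXn2r; rewrite ?nnegrE ?(ltW x0) ?addr_ge0 ?enorm_ge0//.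
by rewrite lerD2l norm_le_enorm.
Qed.

Lemma csmooth_compf phi b : csmooth phi -> smooth (compf b phi).
Proof. by move=> /csmoothP. Qed.

Lemma compf_lin b (a : C) phi psi :
  compf b (fun x => a * phi x + psi x) =
  (fun x => (cpart b a * compf false phi x +
     (if b then cpart false a else - cpart true a) * compf true phi x) + compf b psi x).
Proof.
apply/funext => x; rewrite /compf compD; congr (_ + _).
by case: b; case: a (phi x) => [? ?] [? ?] /=; ring.
Qed.

Lemma partial_outside s f (c M : R) (x : E) : (forall y, M < `|y| -> f y = c) -> M < `|x| ->
  partial s f x = partial s (fun=> c) x.
Proof.
move=> fM Mx; apply: (@partial_near_cst _ _ _ _ _ [set y : E | M < `|y|]) => //.
rewrite (_ : [set _ | _] = (fun y : E => `|y|) @^-1` [set t | M < t])//.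
by apply: open_comp; [move=> y _; exact: norm_continuous|exact: open_gt].
Qed.

Lemma partial_cst_le s (c : R) (x : E) : `|partial s (fun=> c) x| <= `|c|.
Proof. by case: s => [//|i s]; rewrite partial_cst// normr0. Qed.

(** Induction on the order: a partial derivative of such a function vanishes near
    infinity. *)
Lemma smooth_bounded f (c M : R) n : smooth f -> (forall x, M < `|x| -> f x = c) ->
  exists2 B : R, 0 <= B & forall s, (size s <= n)%N -> forall x, `|partial s f x| <= B.
Proof.
elim: n f c => [|n IH] f c sf fM.
  have cf : Cc (fun x => f x - c).
    split; last by exists M => x /fM ->; rewrite subrr.
    by move=> x; apply: continuousB; [exact: smooth_continuous|exact: cst_continuous].
  have [K K0 hK] := Cc_bounded cf; exists (K + `|c|); first by rewrite addr_ge0.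
  move=> s; rewrite leqn0 size_eq0 => /eqP -> x /=.
  by rewrite -[f x](subrK c) (le_trans (ler_normD _ _))// lerD2r.
have [B0 B00 hB0] := IH f c sf fM.
have hi i : exists B : R, 0 <= B /\
    forall s, (size s <= n)%N -> forall x, `|partial s (pd i f) x| <= B.
  have [|B B0' hB] := IH (pd i f) 0 (smooth_pd i sf); last by exists B.
  move=> x Mx; rewrite -[pd i f x]/(partial [:: i] f x) (partial_outside _ fM Mx).
  by rewrite partial_cst.
have [B hB] := choice hi.
exists (B0 + \sum_i B i).
  by rewrite addr_ge0// sumr_ge0// => i _; case: (hB i).
have S0 : 0 <= \sum_i B i by rewrite sumr_ge0// => i _; case: (hB i).
elim/last_ind => [_ x|s i _].
  by apply: (le_trans (hB0 [::] _ x)) => //; rewrite lerDl.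
rewrite size_rcons ltnS => sn x; rewrite partial_rcons.
apply: le_trans (proj2 (hB i) s sn x) _; rewrite (bigD1 i)//= addrCA lerDl addr_ge0//.
by rewrite sumr_ge0// => j _; case: (hB j).
Qed.

Lemma schwartz_compact phi : csmooth phi -> compact_supp phi -> schwartz phi.
Proof.
move=> /csmoothP sp /compact_supp_bounded[M hM]; split; first exact/csmoothP.
move=> N.
have z b x : M < `|x| -> compf b phi x = 0 by move=> /hM; rewrite /compf => ->; case: b.
have [B B0 hB] : exists2 B : R, 0 <= B & forall b s, (size s <= N)%N ->
    forall x, `|partial s (compf b phi) x| <= B.
  have [B1 B10 h1] := smooth_bounded N (sp false) (z false).
  have [B2 B20 h2] := smooth_bounded N (sp true) (z true).
  exists (B1 + B2); first by rewrite addr_ge0.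
  move=> [] s sN x; [apply: le_trans (h2 s sN x) _|apply: le_trans (h1 s sN x) _].
    by rewrite lerDr.
  by rewrite lerDl.
apply: (@le_lt_trans _ _ (2 * ((1 + d%:R * `|M|) ^+ N * B))%:E); last exact: ltry.
apply: schwartz_norm_le => b s x sN.
have [xM|xM] := leP `|x| M.
  apply: ler_pM => //; [by rewrite exprn_ge0// addr_ge0// enorm_ge0| |exact: hB].
  apply: lerXn2r; rewrite ?nnegrE ?addr_ge0 ?enorm_ge0 ?mulr_ge0//.
  rewrite lerD2l (le_trans (enorm_le_norm x))// ler_wpM2l//.
  exact: le_trans (ler_norm _).
rewrite (partial_outside _ (z b) xM).
have -> : partial s (fun=> 0) x = 0.
  by apply/eqP; rewrite -normr_le0 (le_trans (partial_cst_le _ _ _))// normr0.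
by rewrite normr0 mulr0 mulr_ge0// exprn_ge0// addr_ge0// mulr_ge0.
Qed.

Definition rescalef (x : E) (r : R) phi : E -> C := fun y => phi (r^-1 *: (y - x)).

Lemma enorm_rescale (x y : E) (r : R) : 0 < r ->
  1 + enorm y <= (1 + d%:R * `|x| + d%:R * r) * (1 + enorm (r^-1 *: (y - x))).
Proof.
move=> r0; set z := r^-1 *: (y - x).
have yE : y = x + r *: z by rewrite /z scalerA mulfV ?gt_eqF// scale1r addrC subrK.
have h1 : enorm y <= d%:R * (`|x| + r * `|z|).
  apply: le_trans (enorm_le_norm y) _; rewrite ler_wpM2l// {1}yE.
  by apply: le_trans (ler_normD _ _) _; rewrite normrZ (gtr0_norm r0).
have h2 := norm_le_enorm z; have h3 := enorm_ge0 z.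
have h4 : d%:R * r * `|z| <= d%:R * r * enorm z by rewrite ler_wpM2l// mulr_ge0// ltW.
have h5 : 0 <= d%:R * `|x| :> R by rewrite mulr_ge0.
have h6 : 0 <= d%:R * r by rewrite mulr_ge0// ltW.
have h7 : 0 <= d%:R * `|x| * enorm z by rewrite mulr_ge0.
rewrite mulrDr mulr1 !mulrDl mul1r; rewrite mulrDr mulrA in h1; lra.
Qed.

Lemma csmooth_rescale (x : E) (r : R) phi : csmooth phi -> csmooth (rescalef x r phi).
Proof.
move=> /csmoothP sp; apply/csmoothP => b.
by rewrite (_ : compf b _ = fun y => compf b phi (r^-1 *: (y - x)))//; exact: smooth_affine.
Qed.

Lemma compact_supp_rescale (x : E) (r : R) phi : 0 < r -> compact_supp phi ->
  compact_supp (rescalef x r phi).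
Proof.
move=> r0 /compact_supp_bounded[M hM].
apply: (@bounded_compact_supp _ _ _ (`|x| + r * M)) => y hy; apply: hM.
rewrite normrZ ger0_norm ?invr_ge0 ?ltW// mulrC ltr_pdivlMr// mulrC.
rewrite -(ltrD2l `|x|) (lt_le_trans hy)// addrC -[X in `|X| <= _](subrK x y).
exact: ler_normD.
Qed.

(** Rescaling is continuous on Schwartz functions, with a constant that may blow up as
    [r] tends to [0]. *)
Lemma schwartz_norm_rescale N (x : E) (r : R) : 0 < r ->
  exists2 K : R, 0 <= K & forall phi, schwartz phi ->
    (schwartz_norm N (rescalef x r phi) <= (K * snorm N phi)%:E)%E.
Proof.
move=> r0; have ri : 0 <= r^-1 by rewrite invr_ge0 ltW.
pose X := 1 + d%:R * `|x| + d%:R * r.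
have X0 : 0 <= X by rewrite !addr_ge0 ?mulr_ge0// ltW.
exists (2 * (X ^+ N * (1 + r^-1) ^+ N)); first by rewrite !mulr_ge0// exprn_ge0// addr_ge0.
move=> phi sp; rewrite -(mulrA 2); apply: schwartz_norm_le => b s y sN.
rewrite (_ : compf b _ = fun y => compf b phi (r^-1 *: (y - x)))//.
have [/csmoothP sm _] := sp.
rewrite partial_affine// normrM normrX (ger0_norm ri).
set z := r^-1 *: (y - x).
have h1 : (1 + enorm y) ^+ N <= X ^+ N * (1 + enorm z) ^+ N.
  rewrite -exprMn; apply: lerXn2r; last exact: enorm_rescale.
    by rewrite nnegrE addr_ge0// enorm_ge0.
  by rewrite nnegrE mulr_ge0// addr_ge0// enorm_ge0.
have h2 : r^-1 ^+ size s <= (1 + r^-1) ^+ N.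
  apply: (@le_trans _ _ ((1 + r^-1) ^+ size s)).
    by apply: lerXn2r; rewrite ?nnegrE ?addr_ge0// lerDr.
  by rewrite ler_weXn2l// lerDl.
have h3 := schwartz_partial b z sp sN.
apply: (@le_trans _ _ (X ^+ N * (1 + enorm z) ^+ N *
    ((1 + r^-1) ^+ N * `|partial s (compf b phi) z|))).
  apply: ler_pM => //; rewrite ?mulr_ge0 ?exprn_ge0 ?addr_ge0 ?enorm_ge0//.
  by rewrite ler_wpM2r.
rewrite mulrACA -!mulrA ler_wpM2l ?exprn_ge0// ler_wpM2l ?exprn_ge0 ?addr_ge0//.
Qed.

Lemma schwartz_rescale (x : E) (r : R) phi : 0 < r -> schwartz phi ->
  schwartz (rescalef x r phi).
Proof.
move=> r0 sp; split; first by apply: csmooth_rescale; case: sp.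
move=> N; have [K _ hK] := schwartz_norm_rescale N x r0.
by apply: le_lt_trans (hK phi sp) _; exact: ltry.
Qed.

Lemma compf_real_mul b f phi :
  compf b (fun y => real_complex R (f y) * phi y) = (fun y => f y * compf b phi y).
Proof. by apply/funext => y; rewrite /compf comp_real_mul. Qed.

(** At distance at least [delta] from [x] the rescaled variable has norm at least
    [delta / r]; the decay of [phi] to a high order there outweighs the negative powers
    of [r] produced by differentiation. *)
Lemma schwartz_away f (delta c L : R) phi (x : E) (N M : nat) : smooth f -> 0 < delta ->
  (forall y : E, `|y| < delta -> f y = 0) -> (forall y : E, L < `|y| -> f y = c) ->
  schwartz phi ->
  exists2 K : R, 0 <= K & forall r : R, 0 < r <= 1 ->
    (schwartz_norm N (fun y : E => real_complex R (f (y - x)) * rescalef x r phi y)%R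
       <= (K * r ^+ M)%:E)%E.
Proof.
move=> sf d0 f0 fc sp; have [B B0 hB] := smooth_bounded N sf fc.
pose X := 1 + d%:R * `|x| + d%:R.
have X0 : 0 <= X by rewrite !addr_ge0 ?mulr_ge0.
(* [N] orders for the polynomial weight, [N] for the factors [r^-1] of the derivatives,
   and [M] for the claimed power of [r]. *)
pose P := (N + (N + M))%N.
pose K := X ^+ N * (2 ^+ N * (B * (snorm P phi * delta^-1 ^+ (N + M)))).
have K0 : 0 <= K by rewrite !mulr_ge0 ?exprn_ge0 ?snorm_ge0 ?invr_ge0// ltW.
exists (2 * K); first by rewrite mulr_ge0.
move=> r /andP[r0 r1]; have ri : 0 <= r^-1 by rewrite invr_ge0 ltW.
rewrite -mulrA; apply: schwartz_norm_le => b s y sN.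
rewrite compf_real_mul.
have fE : (fun y => f (y - x)) = (fun y : E => f (1 *: (y - x))).
  by apply/funext => z; rewrite scale1r.
have sf' : smooth (fun y => f (y - x)) by rewrite fE; exact: smooth_affine.
have [/csmoothP sm _] := sp.
rewrite (_ : compf b (rescalef x r phi) = fun y => compf b phi (r^-1 *: (y - x)))//.
have sg : smooth (fun y => compf b phi (r^-1 *: (y - x))) by exact: smooth_affine.
have KM0 : 0 <= K * r ^+ M by rewrite mulr_ge0// exprn_ge0// ltW.
have [yd|yd] := ltP `|y - x| delta.
  have op : open [set z : E | `|z - x| < delta] by exact: open_oball.
  rewrite (@partial_near_cst _ _ _ _ 0 _ op)//; last first.
    by move=> z /= hz; rewrite f0// mul0r.
  have -> : partial s (fun=> 0) y = 0.
    by apply/eqP; rewrite -normr_le0 (le_trans (partial_cst_le _ _ _))// normr0.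
  by rewrite normr0 mulr0.
set z := r^-1 *: (y - x).
have zd : delta / r <= `|z|.
  by rewrite /z normrZ (ger0_norm ri) [delta / r]mulrC ler_wpM2l.
have z1 : delta / r <= 1 + enorm z.
  by apply: le_trans zd _; apply: le_trans (norm_le_enorm z) _; rewrite lerDr.
have z0 : 0 < 1 + enorm z by rewrite ltr_wpDr// enorm_ge0.
have dr0 : 0 < delta / r by rewrite divr_gt0.
have h1 : (1 + enorm y) ^+ N <= X ^+ N * (1 + enorm z) ^+ N.
  rewrite -exprMn; apply: lerXn2r.
  - by rewrite nnegrE addr_ge0// enorm_ge0.
  - by rewrite nnegrE mulr_ge0// addr_ge0// enorm_ge0.
  apply: le_trans (enorm_rescale x y r0) _; rewrite ler_wpM2r ?(ltW z0)//.
  by rewrite /X lerD2l ler_piMr.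
pose G := r^-1 ^+ N * (snorm P phi * (1 + enorm z) ^- P).
have hg t : (size t <= size s)%N ->
    `|partial t (fun y => compf b phi (r^-1 *: (y - x))) y| <= G.
  move=> ts; rewrite partial_affine// normrM normrX (ger0_norm ri).
  have tN := leq_trans ts sN.
  apply: ler_pM => //; first by rewrite exprn_ge0// invr_ge0 ltW.
    by apply: ler_weXn2l => //; rewrite invf_ge1.
  rewrite ler_pdivlMr ?exprn_gt0// mulrC.
  by apply: schwartz_partial => //; exact: leq_trans tN (leq_addr _ _).
have hf t : (size t <= size s)%N -> `|partial t (fun y => f (y - x)) y| <= B.
  move=> ts; rewrite fE partial_affine// expr1n mul1r; apply: hB; exact: leq_trans ts sN.
have hp := partial_mul_bound sf' sg hf hg.
have G0 : 0 <= G by rewrite !mulr_ge0 ?exprn_ge0 ?snorm_ge0 ?invr_ge0 ?exprn_ge0// ltW.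
apply: (@le_trans _ _ (X ^+ N * (1 + enorm z) ^+ N * (2 ^+ N * (B * G)))).
  apply: ler_pM => //; first by rewrite exprn_ge0// addr_ge0// enorm_ge0.
  have BG0 : 0 <= B * G by exact: mulr_ge0.
  apply: le_trans hp _; rewrite ler_wpM2r//.
  by apply: ler_weXn2l => //; rewrite ler1n.
rewrite /K /G -!mulrA ler_wpM2l ?exprn_ge0//.
rewrite (mulrCA _ (2 ^+ N)) ler_wpM2l ?exprn_ge0// (mulrCA _ B) ler_wpM2l//.
rewrite (mulrCA _ (r^-1 ^+ N)) (mulrCA _ (snorm P phi)) (mulrCA _ (snorm P phi)).
rewrite ler_wpM2l ?snorm_ge0//.
rewrite /P exprD invfM (mulrA (_ ^+ N) (_ ^- N)) mulfV ?mul1r; last first.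
  by rewrite expf_neq0// gt_eqF.
apply: (@le_trans _ _ (r^-1 ^+ N * ((delta / r) ^- (N + M)))).
  rewrite ler_wpM2l ?exprn_ge0 ?invr_ge0 ?(ltW r0)// lef_pV2 ?posrE ?exprn_gt0//.
  by apply: lerXn2r; rewrite ?nnegrE ?(ltW z0) ?(ltW dr0).
rewrite -[(delta / r) ^- _]exprVn invfM invrK exprMn (exprD r) (exprVn r) mulrCA.
by rewrite mulKf// expf_neq0// gt_eqF.
Qed.

End SchwartzCalculus.

(** * Blow-ups as tempered distributions *)

Section MeasureDistribution.
Context {R : realType} {d : nat}.
Local Notation C := R[i].
Local Notation E := 'rV[R]_d.
Local Notation BE := (borelRd R d).
Implicit Types (nu : {measure set BE -> \bar R}).

Lemma cint_entry l (f : E -> C) (mu : set E -> 'rV[C]_l) k b :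
  cpart b (cint f mu 0 k) =
  rint (compf false f) (component mu k b) +
  (if b then 1 else -1) * rint (compf true f) (component mu k (~~ b)).
Proof. by case: b; rewrite /cint mxE /= ?mul1r ?mulN1r. Qed.

Definition cintegral nu (f : E -> C) : C :=
  Complex (\int[nu]_x compf false f x) (\int[nu]_x compf true f x).

Lemma cpart_mul b (z w : C) : cpart b (z * w) =
  cpart false z * cpart b w + (if b then 1 else -1) * (cpart true z * cpart (~~ b) w).
Proof. by case: b; case: z w => [? ?] [? ?] /=; ring. Qed.

Lemma compf_Cc (f : E -> C) b : csmooth f -> compact_supp f -> Cc (compf b f).
Proof.
move=> sf /compact_supp_bounded[M fM]; split.
  by apply: smooth_continuous; exact: csmooth_compf.
by exists M => x /fM; rewrite /compf => ->; case: b.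
Qed.

Lemma component_tensor l (a : 'rV[C]_l) nu k b :
  component (tensor a nu) k b = (fun B => fine (nu B) * cpart b (a 0 k)).
Proof. by apply/funext => B; rewrite /component /tensor mxE comp_real_mul. Qed.

Lemma cint_tensor l (a : 'rV[C]_l) nu (f : E -> C) : lf_measure nu ->
  (forall b, Cc (compf b f)) -> cint f (tensor a nu) = cintegral nu f *: a.
Proof.
move=> lf cf; apply: row_complex_eqP => k b.
rewrite cint_entry [X in _ = cpart b X]mxE cpart_mul !component_tensor !rint_scale_measure//.
Qed.

Lemma integrable_schwartz nu C0 N (f : E -> C) b : lf_measure nu -> growth C0 N nu ->
  schwartz f -> nu.-integrable [set: BE] (EFin \o (compf b f : BE -> R)) /\
  `|\int[nu]_x compf b f x| <= snorm N.+1 f * (C0 * 2 ^+ N.+1).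
Proof.
move=> lf g sf.
have := @decay_integral _ _ nu C0 N 0 (snorm N.+1 f) (compf b f) lf g.
rewrite expr0 invr1 mulr1; apply => //.
- by apply: continuous_borel; apply: smooth_continuous; apply: csmooth_compf; case: sf.
- exact: snorm_ge0.
- by move=> y; exact: schwartz_decay.
Qed.

(** Against a measure of polynomial growth Schwartz functions are integrable, and their
    integrals are bounded by one Schwartz norm. *)
Lemma measure_distribution l (a : 'rV[C]_l) nu C0 N : lf_measure nu -> growth C0 N nu ->
  represents (fun f => cintegral nu f *: a) (tensor a nu).
Proof.
move=> lf g; split; last first.
  by move=> f sf cf; rewrite cint_tensor// => b; exact: compf_Cc.
split.
  move=> z f h sf sh; rewrite scalerA -scalerDl; congr (_ *: _).
  apply: complex_eqP => b; rewrite compD cpart_mul.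
  have If b' := proj1 (integrable_schwartz b' lf g sf).
  have Ih b' := proj1 (integrable_schwartz b' lf g sh).
  have Iz c b' : nu.-integrable [set: BE] (EFin \o (fun x : BE => c * compf b' f x)).
    have := @integrableZl _ _ _ nu setT measurableT c _ (If b').
    by apply: eq_integrable => // x _; rewrite /= EFinM.
  have -> : cpart b (cintegral nu (fun x => z * f x + h x)) =
      \int[nu]_x compf b (fun x => z * f x + h x) x by case: b.
  rewrite compf_lin RintegralD//; last first.
    have := integrableD measurableT (Iz (cpart b z) false)
      (Iz (if b then cpart false z else - cpart true z) true).
    by apply: eq_integrable.
  rewrite RintegralD//; [|exact: Iz..].
  rewrite !RintegralZl//.
  by rewrite /cintegral; case: b => /=; ring.
have C00 := growth_ge0 g.
pose K := 2 * (C0 * 2 ^+ N.+1) * cnorm a.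
exists N.+1, K => f sf; rewrite snormE// -EFinM lee_fin cnormZ.
have h b := proj2 (integrable_schwartz b lf g sf).
rewrite /K mulrAC ler_wpM2r ?cnorm_ge0//.
apply: le_trans (normc_le_comp _) _; rewrite /cintegral /=.
apply: le_trans (lerD (h false) (h true)) _.
by rewrite le_eqVlt; apply/orP; left; apply/eqP; ring.
Qed.

End MeasureDistribution.

Section BlowupDistribution.
Context {R : realType} {d : nat}.
Local Notation C := R[i].
Local Notation E := 'rV[R]_d.
Local Notation BE := (borelRd R d).

Lemma component_blowup l (mu : set E -> 'rV[C]_l) x c r j k b :
  component (blowup mu x c r j) k b =
  (fun B => c j * component mu k b [set x + r j *: y | y in B]).
Proof. by apply/funext => B; rewrite /component /blowup mxE comp_real_mul. Qed.

Lemma bounded_borel_rescale (x : E) (r : R) B : 0 < r -> bounded_borel B ->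
  bounded_borel [set x + r *: y | y in B].
Proof.
move=> r0 [mB /bounded_cball[M hM]]; split.
  by rewrite rescale_image// -[X in measurable X]setTI; exact: rescale_measurable.
apply/bounded_cball; exists (`|x| + r * M) => _ [y /hM By <-].
move: By; rewrite /cball /= !subr0 => By.
by apply: le_trans (ler_normD _ _) _; rewrite lerD2l normrZ (gtr0_norm r0) (ler_wpM2l (ltW r0)).
Qed.

(** Both sides are differences of integrals against dilated upper variations. *)
Lemma rint_dilation (sigma : set E -> R) (x : E) (r c : R) (f : E -> R) :
  real_charge sigma -> 0 < r -> 0 <= c -> Cc f ->
  rint f (fun B => c * sigma [set x + r *: y | y in B]) =
  c * rint (fun y => f (r^-1 *: (y - x))) sigma.
Proof.
move=> rc r0 c0 cf.
have [p [pE lfp]] := upvar_measure rc.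
have [q [qE lfq]] := upvar_measure (real_chargeN rc).
have sE B : bounded_borel B -> sigma B = fine (p B) - fine (q B).
  move=> bB; have := upvar_jordan rc bB; rewrite -pE -qE.
  rewrite -(fineK (lf_measure_fin lfp bB)) -(fineK (lf_measure_fin lfq bB)) -EFinD.
  by move=> [->]; rewrite addrK.
have [p' [pE' lfp' ip]] := dilated_measure x lfp r0 c0.
have [q' [qE' lfq' iq]] := dilated_measure x lfq r0 c0.
rewrite (@rint_diff _ _ _ p' q')//; last first.
  move=> B bB; have bB' := bounded_borel_rescale x r0 bB.
  rewrite pE' qE' !fineM ?(lf_measure_fin lfp bB') ?(lf_measure_fin lfq bB')//=.
  by rewrite sE// mulrBr.
rewrite (@rint_diff _ _ sigma p q)//; last exact: Cc_rescale.
by rewrite ip// iq// mulrBr.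
Qed.

Lemma cint_blowup l (mu : set E -> 'rV[C]_l) x c r j (f : E -> C) : lf_charge mu ->
  0 < r j -> 0 < c j -> (forall b, Cc (compf b f)) ->
  cint f (blowup mu x c r j) = real_complex R (c j) *: cint (rescalef x (r j) f) mu.
Proof.
move=> lf r0 c0 cf; apply: row_complex_eqP => k b.
rewrite [X in _ = cpart b X]mxE comp_real_mul !cint_entry !component_blowup.
rewrite !rint_dilation ?(ltW c0)//; [|exact: lf_charge_component..].
rewrite -[compf false (rescalef _ _ _)]/(fun y => compf false f ((r j)^-1 *: (y - x))).
rewrite -[compf true (rescalef _ _ _)]/(fun y => compf true f ((r j)^-1 *: (y - x))).
ring.
Qed.

(** The distribution that extends a blow-up of the charge is the rescaled distribution
    of the charge itself. *)
Lemma blowup_distribution l (mu : set E -> 'rV[C]_l) x c r j (T : (E -> C) -> 'rV[C]_l) :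
  lf_charge mu -> 0 < r j -> 0 < c j -> represents T mu ->
  represents (fun f => real_complex R (c j) *: T (rescalef x (r j) f)) (blowup mu x c r j).
Proof.
move=> lf r0 c0 [[Tlin [N [K TK]]] TE]; split; last first.
  move=> f sf cf; rewrite cint_blowup//; last by move=> b; exact: compf_Cc.
  by rewrite TE//; [exact: csmooth_rescale|exact: compact_supp_rescale].
split.
  move=> z f h sf sh.
  rewrite -[rescalef x (r j) (fun y => z * f y + h y)]/(fun y =>
    z * rescalef x (r j) f y + rescalef x (r j) h y).
  rewrite Tlin; [|exact: schwartz_rescale..].
  by rewrite scalerDr !scalerA mulrC.
have [L L0 hL] := schwartz_norm_rescale N x r0.
exists N, (c j * (`|K| * L)) => f sf; have sr := schwartz_rescale x r0 sf.
rewrite snormE// -EFinM lee_fin cnormZ normc_real (gtr0_norm c0) -!mulrA ler_wpM2l ?(ltW c0)//.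
have h := hL f sf; rewrite snormE// lee_fin in h.
have := TK _ sr; rewrite snormE// -EFinM lee_fin => /le_trans; apply.
apply: le_trans (_ : `|K| * snorm N (rescalef x (r j) f) <= _).
  by rewrite ler_wpM2r ?snorm_ge0// ler_norm.
by rewrite ler_wpM2l.
Qed.

(** The functions [phi j] stand for [f] in the [j]-th blow-up: they are supported where
    the blow-up only sees the unit ball around the centre, and they have the decay that
    the growth of the blow-ups can absorb.  For test functions of compact support the
    constant sequence qualifies; for Schwartz functions it consists of cut-offs at
    radius [1 / r j]. *)
Definition approximates (N : nat) (r : nat -> R) (phi : nat -> E -> R) (f : E -> R) :=
  [/\ continuous f, forall j, Cc (phi j),
    \forall j \near \oo, forall y, (r j)^-1 < `|y| -> phi j y = 0,
    exists2 A : R, 0 <= A & (forall y, `|f y| <= A * (1 + `|y|) ^- N.+1) /\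
      forall j y, `|phi j y| <= A * (1 + `|y|) ^- N.+1 &
    forall M, \forall j \near \oo, forall y, `|y| <= M -> phi j y = f y].

(** The common source of both modes of convergence: it yields the tangent charge by
    [Tan_of_limit] and the Schwartz convergence by [cvg_tempered_of_limit]. *)
Definition component_limit l N (mu : set E -> 'rV[C]_l) x (c r : nat -> R)
    (a : 'rV[C]_l) (nu : {measure set BE -> \bar R}) :=
  forall phi f, approximates N r phi f -> forall k b,
    (fun j => rint (phi j) (component (blowup mu x c r j) k b)) @ \oo -->
    cpart b (a 0 k) * \int[nu]_y f y.

Lemma cint_limit l N (mu : set E -> 'rV[C]_l) x c r (a : 'rV[C]_l) nu
    (phi : nat -> E -> C) (f : E -> C) :
  component_limit N mu x c r a nu ->
  (forall b, approximates N r (fun j => compf b (phi j)) (compf b f)) ->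
  cvgC (fun j => cint (phi j) (blowup mu x c r j)) (cintegral nu f *: a).
Proof.
move=> lim ap; apply: comp_cvgC => b k; rewrite mxE cpart_mul.
under eq_fun do rewrite cint_entry.
apply: cvgD.
  by rewrite /cintegral /= mulrC; apply: (lim _ _ (ap false)).
apply: cvgM; first exact: cvg_cst.
by rewrite /cintegral /= mulrC; apply: (lim _ _ (ap true)).
Qed.

Lemma approximates_Cc N r f : r @ \oo --> (0 : R) -> (forall j, 0 < r j) -> Cc f ->
  approximates N r (fun=> f) f.
Proof.
move=> r0 rp cf; have [K K0 fK] := Cc_bounded cf; have [cf' [M fM]] := cf.
split => //; last by move=> L; apply: nearW.
- have M1 : 0 < (`|M| + 1)^-1 by rewrite invr_gt0 ltr_wpDl.
  move/cvgrPdist_lt : r0 => /(_ _ M1); apply: filterS => j; rewrite sub0r normrN.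
  rewrite (gtr0_norm (rp j)) => rj y yr; apply: fM; apply: lt_trans yr.
  rewrite -(invrK M); apply: (@le_lt_trans _ _ `|M|); first by rewrite invrK ler_norm.
  apply: (@lt_trans _ _ (`|M| + 1)); first by rewrite ltrDl.
  by rewrite -[X in X < _]invrK ltf_pV2 ?posrE ?invr_gt0 ?ltr_wpDl.
- exists (K * (1 + `|M|) ^+ N.+1); first by rewrite mulr_ge0 ?exprn_ge0 ?addr_ge0.
  suff h y : `|f y| <= K * (1 + `|M|) ^+ N.+1 * (1 + `|y|) ^- N.+1 by [].
  have y0 : 0 < 1 + `|y| by rewrite ltr_wpDr.
  rewrite ler_pdivlMr ?exprn_gt0//; have [yM|yM] := leP `|y| M.
    apply: ler_pM => //.
    apply: lerXn2r; rewrite ?nnegrE ?(ltW y0) ?addr_ge0// lerD2l.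
    exact: le_trans (ler_norm _).
  by rewrite fM// normr0 mul0r mulr_ge0 ?exprn_ge0 ?addr_ge0.
Qed.

Lemma Tan_of_limit l N (mu : set E -> 'rV[C]_l) x c r (a : 'rV[C]_l) nu :
  blowup_seqs c r -> lf_measure nu -> charge_neq0 (tensor a nu) ->
  component_limit N mu x c r a nu -> Tan mu x (tensor a nu).
Proof.
move=> bs lf n0 lim; split => //; first exact: lf_charge_tensor.
exists c, r; split => // f [cre cim fc].
have cf b : Cc (compf b f).
  split; first by case: b.
  by have [M hM] := compact_supp_bounded fc; exists M => y /hM; rewrite /compf => ->; case: b.
rewrite cint_tensor//; apply: (cint_limit lim) => b.
by case: bs => _ rp _ r0; apply: approximates_Cc.
Qed.

(** The rescaled Schwartz function is cut off at a fixed distance from [x].  The inner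
    part falls under [component_limit]; the outer one has Schwartz norms of order
    [r j ^+ N.+1] by [schwartz_away], which beats the constants [c j]. *)
Lemma cvg_tempered_of_limit l N (C0 C1 : R) (mu : set E -> 'rV[C]_l) x c r (a : 'rV[C]_l) nu :
  lf_charge mu -> blowup_seqs c r -> (forall j, r j <= 1) ->
  (forall j, c j <= C0 * (r j) ^- N) -> lf_measure nu -> growth C1 N nu ->
  component_limit N mu x c r a nu -> tempered mu ->
  cvg_tempered (blowup mu x c r) (tensor a nu).
Proof.
move=> lf [cp rp _ r0] r1 cr lfn gn lim [T rT].
have [[Tlin [N0 [K TK]]] TE] := rT.
exists (fun j f => real_complex R (c j) *: T (rescalef x (r j) f)), (fun f => cintegral nu f *: a).
split.
- by move=> j; exact: blowup_distribution.
- exact: measure_distribution lfn gn.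
move=> f sf; have [csf _] := sf.
have [chi [schi chi01 chi1 chi0]] := @smooth_cutoff R d.
pose eta y : R := 1 - chi y.
have seta : smooth eta.
  have -> : eta = (fun y => 1 + (-1) * chi y) by apply/funext => y; rewrite mulN1r.
  by apply: smooth_add; [exact: smooth_cst|apply: smooth_mul => //; exact: smooth_cst].
pose delta : R := (2 * (d%:R + 1))^-1.
have d0 : 0 < delta by rewrite invr_gt0 mulr_gt0// ltr_wpDl.
have eta0 y : `|y| < delta -> eta y = 0.
  move=> yd; rewrite /eta chi1 ?subrr//; apply: le_trans (enorm_le_norm y) _.
  apply: (@le_trans _ _ ((d%:R + 1) * delta)).
    by apply: ler_pM => //; [rewrite lerDl|exact: ltW].
  by rewrite /delta invfM mulrCA mulfV ?mulr1// gt_eqF// ltr_wpDl.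
have etac y : 1 < `|y| -> eta y = 1 by move=> /ltW/chi0; rewrite /eta => ->; rewrite subr0.
have [K2 K20 hK2] := schwartz_away x N0 N.+1 seta d0 eta0 etac sf.
pose psi j (y : E) : C := real_complex R (chi (r j *: y)) * f y.
pose rest j (y : E) : C := real_complex R (eta (y - x)) * rescalef x (r j) f y.
have spsi j : csmooth (psi j).
  apply/csmoothP => b; rewrite compf_real_mul; apply: smooth_mul; last exact: csmooth_compf.
  have -> : (fun y => chi (r j *: y)) = (fun y => chi (r j *: (y - 0))).
    by apply/funext => y; rewrite subr0.
  exact: smooth_affine.
have psi0 j y : (r j)^-1 < `|y| -> psi j y = 0.
  move=> yr; rewrite /psi chi0 ?rmorph0 ?mul0r//.
  rewrite normrZ (gtr0_norm (rp j)) -(mulfV (lt0r_neq0 (rp j))).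
  by rewrite ler_wpM2l ?ltW.
have cpsi j : compact_supp (psi j) by apply: bounded_compact_supp; exact: psi0.
have srest j : schwartz (rest j).
  split; last first.
    move=> M; have [K3 _ hK3] := schwartz_away x M 0 seta d0 eta0 etac sf.
    by apply: le_lt_trans (hK3 (r j) _) _; [rewrite rp r1|exact: ltry].
  apply/csmoothP => b; rewrite compf_real_mul; apply: smooth_mul.
    have -> : (fun y => eta (y - x)) = (fun y => eta (1 *: (y - x))).
      by apply/funext => y; rewrite scale1r.
    exact: smooth_affine.
  by apply: csmooth_compf; exact: csmooth_rescale.
have eq j : rescalef x (r j) f = (fun y => 1 * rescalef x (r j) (psi j) y + rest j y).
  apply/funext => y; rewrite mul1r /psi /rest /rescalef scalerA mulfV ?lt0r_neq0// scale1r.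
  by rewrite -mulrDl -rmorphD /eta addrCA subrr addr0 rmorph1 mul1r.
have Teq j : real_complex R (c j) *: T (rescalef x (r j) f) =
    cint (psi j) (blowup mu x c r j) + real_complex R (c j) *: T (rest j).
  have spj : schwartz (psi j) by exact: schwartz_compact.
  rewrite eq (Tlin _ _ _ (schwartz_rescale x (rp j) spj) (srest j)) scale1r scalerDr.
  rewrite (cint_blowup x lf (rp j) (cp j) (fun b => @compf_Cc _ _ (psi j) b (spsi j) (cpsi j))).
  by rewrite (TE _ (csmooth_rescale x (r j) (spsi j)) (@compact_supp_rescale _ _ x _ _ (rp j) (cpsi j))).
have small : (fun j => cnorm (real_complex R (c j) *: T (rest j))) @ \oo --> (0 : R).
  apply: (@squeeze_cvgr _ _ _ _ (fun=> 0) (fun j => C0 * (`|K| * K2) * r j)).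
  - apply: nearW => j; rewrite cnorm_ge0 /= cnormZ normc_real (gtr0_norm (cp j)).
    have := TK _ (srest j); rewrite snormE// -EFinM lee_fin => h.
    have := hK2 (r j); rewrite rp r1 => /(_ isT); rewrite -/(rest j) snormE// lee_fin => h2.
    have h3 : cnorm (T (rest j)) <= `|K| * (K2 * r j ^+ N.+1).
      apply: le_trans h _; apply: (@le_trans _ _ (`|K| * snorm N0 (rest j))).
        by rewrite ler_wpM2r ?snorm_ge0// ler_norm.
      by rewrite ler_wpM2l.
    apply: le_trans (ler_pM (ltW (cp j)) (cnorm_ge0 _) (cr j) h3) _.
    have rN : r j ^+ N != 0 by rewrite expf_neq0// lt0r_neq0.
    by rewrite le_eqVlt; apply/orP; left; apply/eqP; rewrite exprS; field.
  - exact: cvg_cst.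
  - by rewrite -[X in _ --> X](mulr0 (C0 * (`|K| * K2))); apply: cvgM => //; exact: cvg_cst.
have main : cvgC (fun j => cint (psi j) (blowup mu x c r j)) (cintegral nu f *: a).
  apply: (cint_limit lim) => b; split.
  - by apply: smooth_continuous; exact: csmooth_compf.
  - by move=> j; exact: compf_Cc.
  - by apply: nearW => j y /psi0; rewrite /compf => ->; case: b.
  - exists (snorm N.+1 f); first exact: snorm_ge0.
    split=> [y|j y]; first exact: schwartz_decay.
    apply: le_trans (schwartz_decay N.+1 b y sf).
    rewrite /compf comp_real_mul normrM ler_piMl// ger0_norm; have /andP[] := chi01 (r j *: y) => //.
  - move=> M.
    have e0 : 0 < (2 * (d%:R * `|M| + 1))^-1 :> R.
      by rewrite invr_gt0 mulr_gt0// ltr_wpDl// mulr_ge0.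
    move/cvgrPdist_lt : r0 => /(_ _ e0); apply: filterS => j; rewrite sub0r normrN.
    rewrite (gtr0_norm (rp j)) => rj y yM.
    rewrite /compf /psi chi1 ?rmorph1 ?mul1r//.
    apply: le_trans (enorm_le_norm _) _; rewrite normrZ (gtr0_norm (rp j)).
    have D0 : 0 < d%:R * `|M| + 1 :> R by rewrite ltr_wpDl// mulr_ge0.
    apply: (@le_trans _ _ (r j * (d%:R * `|M| + 1))).
      rewrite mulrCA ler_wpM2l ?(ltW (rp j))// ler_wpDr// ler_wpM2l//.
      exact: le_trans yM (ler_norm _).
    apply: (@le_trans _ _ ((2 * (d%:R * `|M| + 1))^-1 * (d%:R * `|M| + 1))).
      by rewrite ler_wpM2r ?ltW.
    by rewrite invfM -mulrA mulVf ?mulr1// lt0r_neq0.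
apply: comp_cvgC => b k.
have h1 := @cvgC_comp _ _ _ _ b k main.
have sm : cvgC (fun j => real_complex R (c j) *: T (rest j)) 0.
  by rewrite /cvgC; under eq_fun do rewrite subr0.
have h2 := @cvgC_comp _ _ _ _ b k sm.
have -> : (fun j => cpart b ((real_complex R (c j) *: T (rescalef x (r j) f)) 0 k)) =
    (fun j => cpart b (cint (psi j) (blowup mu x c r j) 0 k) +
       cpart b ((real_complex R (c j) *: T (rest j)) 0 k)).
  by apply/funext => j; rewrite Teq -compD mxE.
rewrite -[X in _ --> X]addr0; apply: cvgD; first exact: h1.
move: h2; rewrite (mxE _ _ 0 k).
by rewrite (_ : cpart b 0 = 0 :> R)//; case: b {h1}.
Qed.

End BlowupDistribution.

(** * Densities of the components *)

Section Domination.
Context {R : realType} {d : nat}.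
Local Notation E := 'rV[R]_d.
Local Notation BE := (borelRd R d).
Implicit Types (m p : {measure set BE -> \bar R}).

Lemma dominating_measure (I : finType) (p : I -> {measure set BE -> \bar R}) :
  (forall i, lf_measure (p i)) ->
  exists m, [/\ lf_measure m, forall i B, (p i B <= m B)%E &
    forall B, (forall i, p i B = 0%E) -> m B = 0%E].
Proof.
move=> lfp.
suff [m [h1 h2 h3]] : exists m, [/\ lf_measure m, forall i B, i \in enum I -> (p i B <= m B)%E &
    forall B, (forall i, p i B = 0%E) -> m B = 0%E].
  by exists m; split => // i B; apply: h2; rewrite mem_enum.
elim: (enum I) => [|i s [m [h1 h2 h3]]].
  by exists mzero; split => // B _; rewrite /mzero ltry.
have [q qE] : exists q : {measure set BE -> \bar R}, forall B, q B = (p i B + m B)%E.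
  by exists (measure_add (p i) m) => B; exact: measure_addE.
exists q; split.
- by move=> B bB; rewrite qE lte_add_pinfty ?h1 ?lfp.
- move=> k B; rewrite inE qE => /predU1P[->|/h2 h]; first by rewrite leeDl.
  by apply: le_trans (h B) _; rewrite leeDr.
- by move=> B pB; rewrite qE pB h3// adde0.
Qed.

Lemma restricted_measure m (W : set E) : measurable (W : set BE) ->
  exists q : {measure set BE -> \bar R}, forall B, q B = m (B `&` W).
Proof. by move=> mW; exists (mrestr m mW). Qed.

(** The Radon-Nikodym theorem, with a density that is finite everywhere. *)
Lemma density_of_dominated p m : (m setT < +oo)%E ->
  (forall B, measurable (B : set BE) -> (p B <= m B)%E) ->
  exists g : E -> R, [/\ forall x, 0 <= g x, m.-integrable [set: BE] (EFin \o (g : BE -> R)) &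
    forall A, measurable (A : set BE) -> p A = (\int[m]_(x in (A : set BE)) (g x)%:E)%E].
Proof.
move=> mfin pm.
have pfin : (p setT < +oo)%E by apply: le_lt_trans mfin; exact: pm.
pose m' : {finite_measure set BE -> \bar R} := mfrestr (@measurableT _ BE) mfin.
pose p' : {finite_measure set BE -> \bar R} := mfrestr (@measurableT _ BE) pfin.
have mE B : m' B = m B by rewrite /m' /= /mfrestr /mrestr setIT.
have pE B : p' B = p B by rewrite /p' /= /mfrestr /mrestr setIT.
have dom : p' `<< m'.
  apply/null_content_dominatesP => A mA mA0'.
  have mA0 : m A = 0%E by rewrite -mE; exact: mA0'.
  rewrite -[LHS]/(p' A) pE; apply/eqP; by rewrite eq_le measure_ge0 andbT -[X in (_ <= X)%E]mA0; exact: pm.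
have [f [f0 ff fi fE]] := radon_nikodym_sigma_finite dom.
exists (fun x => fine (f x)); have fEf : EFin \o (fun x : BE => fine (f x)) = f.
  by apply/funext => x /=; rewrite fineK.
split.
- by move=> x; rewrite fine_ge0.
- rewrite fEf; apply/integrableP; split; first exact: measurable_int fi.
  move/integrableP : fi => [_]; rewrite (@eq_measure_integral _ _ _ _ m)//.
  by move=> A _ _; exact: mE.
- move=> A mA; rewrite -pE fE// (@eq_measure_integral _ _ _ _ m); last first.
    by move=> B _ _; exact: mE.
  by apply: eq_integral => x _; rewrite fineK.
Qed.

(** Take [l = |g - g x| m]. *)
Lemma density_oscillation p m (g : E -> R) (x : E) : (m setT < +oo)%E ->
  (forall y, 0 <= g y) -> m.-integrable [set: BE] (EFin \o (g : BE -> R)) ->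
  (forall A, measurable (A : set BE) -> p A = (\int[m]_(y in (A : set BE)) (g y)%:E)%E) ->
  exists l : {measure set BE -> \bar R}, [/\
    forall A, measurable (A : set BE) ->
      l A = (\int[m]_(y in (A : set BE)) `|g y - g x|%:E)%E,
    forall A, measurable (A : set BE) -> (p A <= (g x)%:E * m A + l A)%E &
    forall A, measurable (A : set BE) -> ((g x)%:E * m A <= p A + l A)%E].
Proof.
move=> mfin g0 gi pE.
have mg : measurable_fun [set: BE] (g : BE -> R).
  by apply/measurable_EFinP; exact: measurable_int gi.
have mo : measurable_fun [set: BE] (fun y : BE => `|g y - g x|).
  by apply: measurableT_comp => //; apply: measurable_funB => //; exact: measurable_cst.
have [l lE] : exists l : {measure set BE -> \bar R},
    (l : set BE -> \bar R) = (fun A => \int[m]_(y in A) `|g y - g x|%:E)%E.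
  apply: exists_measure.
  - by rewrite integral_set0.
  - by move=> A; apply: integral_ge0 => y _; rewrite lee_fin.
  - apply: (@semi_sigma_additive_nng_induced _ BE R m (fun y => `|g y - g x|%:E)).
      exact/measurable_EFinP.
    by move=> y; rewrite lee_fin.
have mA' (h : E -> R) A : measurable_fun [set: BE] (h : BE -> R) ->
    measurable_fun (A : set BE) (fun y : BE => (h y)%:E).
  by move=> mh; apply/measurable_EFinP; exact: measurable_funTS.
have cE A : measurable (A : set BE) ->
    ((g x)%:E * m A = \int[m]_(y in (A : set BE)) (g x)%:E)%E.
  by move=> mA; rewrite integral_cst.
exists l; split => [A mA|A mA|A mA]; rewrite lE//= pE// cE//.
- rewrite -ge0_integralD//; do ?[exact: mA' (measurable_cst _)|exact: mA'|by move=> y _; rewrite ?lee_fin].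
  apply: ge0_le_integral => //.
  + by move=> y _; rewrite lee_fin.
  + exact: mA'.
  + by apply: emeasurable_funD; [exact: mA' (measurable_cst _)|exact: mA'].
  + by move=> y _; rewrite -EFinD lee_fin; have := ler_norm (g y - g x); lra.
- rewrite -ge0_integralD//; do ?[exact: mA'|by move=> y _; rewrite ?lee_fin].
  apply: ge0_le_integral => //.
  + by move=> y _; rewrite lee_fin.
  + by apply: emeasurable_funD; exact: mA'.
  + by move=> y _; rewrite -EFinD lee_fin; have := ler_norm (- (g y - g x)); rewrite normrN; lra.
Qed.

(** Densities that agree almost everywhere on [F] have the same integral over [F]. *)
Lemma density_differ m (g h : E -> R) (F Z : set E) :
  measurable (F : set BE) -> m.-negligible (Z : set BE) ->
  m.-integrable [set: BE] (EFin \o (g : BE -> R)) ->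
  m.-integrable [set: BE] (EFin \o (h : BE -> R)) ->
  (\int[m]_(x in (F : set BE)) (g x)%:E)%E <> (\int[m]_(x in (F : set BE)) (h x)%:E)%E ->
  exists x, [/\ F x, ~ Z x & g x != h x].
Proof.
move=> mF nZ gi hi; apply: contra_notP => nx.
apply: (@ae_eq_integral _ BE R m F (fun x : BE => (h x)%:E) (fun x : BE => (g x)%:E)) => //.
- exact: measurable_funTS (measurable_int _ gi).
- exact: measurable_funTS (measurable_int _ hi).
apply: negligibleS nZ => x /= hx; apply: contrapT => Zx; apply: hx => Fx.
by congr EFin; apply/eqP; apply/negPn/negP => gh; apply: nx; exists x.
Qed.

End Domination.

(** * A charged set of almost minimal dimension *)

Section Exponents.
Context {R : realType} {d : nat}.
Local Notation C := R[i].
Local Notation E := 'rV[R]_d.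

Lemma hausdorff_dim_ge0 (A : set E) : (0 <= hausdorff_dim A)%E.
Proof. by apply: le_ereal_inf_tmp => _ [s [s0 _] <-]; rewrite lee_fin. Qed.

Lemma dimH_ge0 l (mu : set E -> 'rV[C]_l) : (0 <= dimH mu)%E.
Proof.
apply: le_ereal_inf_tmp => _ [a [F [_ h _]] <-].
exact: le_trans (hausdorff_dim_ge0 F) h.
Qed.

(** An infinite dimension imposes no condition on the exponents, so any charged bounded
    set serves; otherwise the room [eps] is divided between the three exponents. *)
Lemma charged_null_set l (mu : set E -> 'rV[C]_l) eps : charge_neq0 mu -> 0 < eps ->
  exists (F : set E) (s a b : R), [/\ bounded_borel F, mu F <> 0, hausdorff_measure s F = 0%E &
    [/\ 0 <= s, s < a, a < b & (b%:E <= dimH mu + eps%:E)%E]].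
Proof.
move=> [B [bB muB]] e0; have := dimH_ge0 mu.
case dE : (dimH mu) => [D| |] // D0; last first.
  have [s s0 hs] := bounded_hausdorff_null bB.2.
  by exists B, s, (s + 1), (s + 2); split => //; split; rewrite ?leey//; lra.
rewrite lee_fin in D0.
have : (dimH mu < (D + eps / 4)%:E)%E by rewrite dE lte_fin ltrDl divr_gt0.
move=> /ereal_inf_lt[_ [alpha [F [bF hF muF]] <-]] al.
have [s /andP[s0 sl] hs] := hausdorff_null_lt (le_lt_trans hF al).
exists F, s, (D + eps / 2), (D + eps); split => //.
by split; [by []|lra|lra|rewrite EFinD].
Qed.

End Exponents.

(** * Convergence of the blow-ups at a good point *)

Section BlowupSequence.
Context {R : realType} {d : nat}.
Local Notation E := 'rV[R]_d.
Local Notation BE := (borelRd R d).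
Implicit Types (m p q : {measure set BE -> \bar R}).

Lemma good_scale_sequence (b : nat -> R) (a c : R) : 0 < a -> a < c ->
  (forall n, 0 < b n) -> {homo b : i j / (i <= j)%N >-> j <= i} ->
  (forall K, exists2 n, (K <= n)%N & (2 ^- n) `^ a <= b n) ->
  exists (N : nat) (t : nat -> nat), [/\ forall k, (t k < t k.+1)%N,
    forall k u, (u <= k)%N -> (2 ^- u) `^ c * b (t k) <= b (t k + u)%N &
    forall k s, (s <= t k)%N -> b s <= (2 ^+ (t k - s)) ^+ N * b (t k)].
Proof.
move=> a0 ac b0 bd bi; have [N hN] := good_scales a0 ac b0 bd bi.
have [T hT] := choice hN.
pose L := fix L k := if k is k'.+1 then (T (L k')).+1 else 0%N.
have kL k : (k <= L k)%N.
  elim: k => // k IH; rewrite /= ltnS (leq_trans IH)//; by case: (hT (L k)).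
exists N, (fun k => T (L k)); split=> [k|k u uk|k s sk].
- by have [h _ _] := hT (L k.+1); exact: h.
- have [_ h _] := hT (L k); apply: h; exact: leq_trans (kL k).
- by have [_ _ h] := hT (L k); exact: h.
Qed.

Lemma image_cball (x : E) (r rho : R) : 0 < r ->
  [set x + r *: y | y in cball 0 rho] = cball x (r * rho).
Proof.
move=> r0; rewrite rescale_image//; have ri : 0 <= r^-1 by rewrite invr_ge0 ltW.
have -> : cball 0 rho = [set z : E | `|z| <= rho].
  by apply/seteqP; split => z; rewrite /cball /= subr0.
by apply/seteqP; split => y; rewrite /cball /= normrZ (ger0_norm ri) ler_pdivrMl.
Qed.

Lemma finite_lf m : (m setT < +oo)%E -> lf_measure m.
Proof. by move=> h B [mB _]; rewrite -ge0_fin_numE// finite_measure_fin. Qed.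

Lemma exp2_mulN (t n : nat) : (n <= t)%N -> 2 ^- t * 2 ^+ n = 2 ^- (t - n) :> R.
Proof.
move=> nt; rewrite -{1}(subnK nt) exprD invfM -mulrA mulVf ?mulr1//.
Qed.

Lemma sequence_ge_id (t : nat -> nat) : (forall k, (t k < t k.+1)%N) -> forall k, (k <= t k)%N.
Proof. by move=> h; elim=> // k IH; exact: leq_ltn_trans (h k). Qed.

(** The scales come from [good_scales]: towards larger radii they give the uniform growth
    and with it compactness, towards smaller ones the lower bound of exponent [beta]. *)
Lemma blowup_sequence m (x : E) (a beta : R) : (m setT < +oo)%E -> 0 < a -> a < beta ->
  (forall n, 0 < fine (m (dyball x n))) ->
  (forall K, exists2 n, (K <= n)%N & (2 ^- n) `^ a <= fine (m (dyball x n))) ->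
  exists (N : nat) (C : R) (t : nat -> nat) (M : nat -> {measure set BE -> \bar R})
    (nu : {measure set BE -> \bar R}),
  let b n := fine (m (dyball x n)) in
  [/\ [/\ forall k, (t k < t k.+1)%N, lf_measure nu & forall j, lf_measure (M j)],
      forall j B, M j B =
        ((b (t j))^-1%:E * m [set (x + 2 ^- t j *: y)%R | y in B])%E,
      [/\ forall j, growth C N (M j), forall j, (b (t j))^-1 <= C * (2 ^- t j) ^- N &
        forall n j, (n <= t j)%N -> b (t j - n)%N <= (2 ^+ n) ^+ N * b (t j)],
      forall u, \forall j \near \oo, (2 ^- u) `^ beta <= fine (M j (cball 0 (2 ^- u))) &
      forall f : E -> R, Cc f -> (fun j => \int[M j]_y f y) @ \oo --> \int[nu]_y f y].
Proof.
move=> mfin a0 ab b0 bi.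
pose b n := fine (m (dyball x n)).
have mD n : measurable (dyball x n : set BE) by exact: measurable_cball.
have bfin (A : set E) : measurable (A : set BE) -> m A \is a fin_num.
  by move=> mA; exact: finite_measure_fin.
have bd : {homo b : i j / (i <= j)%N >-> j <= i}.
  move=> i j ij; rewrite /b fine_le ?bfin//; apply: le_measure; rewrite ?inE//.
  by apply: le_cball; exact: exp2N_le.
have [N [t [ti tl tg]]] := good_scale_sequence a0 ab b0 bd bi.
have lfm := finite_lf mfin.
have bt0 j : 0 < b (t j) by exact: b0.
have ci j : 0 <= (b (t j))^-1 by rewrite invr_ge0 ltW.
have [M hM] := choice (fun j => dilated_measure x lfm (exp2N_gt0 (t j)) (ci j)).
have ME j B : M j B = ((b (t j))^-1%:E * m [set (x + 2 ^- t j *: y)%R | y in B])%E.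
  by case: (hM j).
have lfM j : lf_measure (M j) by case: (hM j).
have Mball j rho : fine (M j (cball 0 rho)) =
    (b (t j))^-1 * fine (m (cball x (2 ^- t j * rho))).
  rewrite ME image_cball; last exact: exp2N_gt0.
  by rewrite fineM// bfin//; exact: measurable_cball.
have le_ball (u v : R) : u <= v -> fine (m (cball x u)) <= fine (m (cball x v)).
  move=> uv; have [mu mv] := (measurable_cball x u, measurable_cball x v).
  by rewrite fine_le ?bfin//; apply: le_measure; rewrite ?inE//; exact: le_cball.
(* The first term bounds the growth up to the radius at which the blow-up leaves the
   unit ball around [x]; beyond it the total mass of [m] does. *)
pose C := 2 ^+ N + (fine (m setT) + 1) / b 0%N.
have b00 : 0 < b 0%N by exact: b0.
have W0 : 0 <= fine (m setT) by rewrite fine_ge0.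
have inv_le j : (b (t j))^-1 <= (2 ^+ t j) ^+ N / b 0%N.
  rewrite ler_pdivlMr// mulrC ler_pdivrMr//.
  by have := tg j 0%N (leq0n _); rewrite subn0.
have gM j : growth C N (M j).
  move=> r r1; rewrite Mball; have [i /andP[i1 i2]] := pow2_between r1.
  have r0 : 0 <= r by exact: le_trans r1.
  have rN : 0 <= r ^+ N by rewrite exprn_ge0.
  have [it|it] := leqP i.+1 (t j).
    apply: (@le_trans _ _ (2 ^+ N * r ^+ N)); last first.
      by rewrite ler_wpM2r// lerDl divr_ge0 ?addr_ge0// ltW.
    rewrite mulrC ler_pdivrMr//.
    apply: (@le_trans _ _ (b (t j - i.+1)%N)).
      rewrite /b /dyball -exp2_mulN//; apply: le_ball.
      by rewrite ler_wpM2l ?(ltW (exp2N_gt0 _))// ltW.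
    apply: le_trans (tg j _ (leq_subr _ _)) _; rewrite subKn// ler_wpM2r ?(ltW (bt0 j))//.
    rewrite -exprMn; apply: lerXn2r; rewrite ?nnegrE ?mulr_ge0 ?exprn_ge0//.
    by rewrite exprS ler_wpM2l.
  apply: (@le_trans _ _ ((fine (m setT) / b 0%N) * r ^+ N)); last first.
    rewrite ler_wpM2r// ler_wpDl ?exprn_ge0//.
    by rewrite ler_wpM2r ?invr_ge0 ?(ltW b00)// lerDl.
  rewrite -mulrA mulrC; apply: ler_pM => //; rewrite ?fine_ge0//.
    rewrite fine_le ?bfin//; first exact: measurable_cball.
    by apply: le_measure; rewrite ?inE//; exact: measurable_cball.
  apply: le_trans (inv_le j) _; rewrite mulrC ler_wpM2l ?invr_ge0 ?(ltW b00)//.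
  apply: lerXn2r; rewrite ?nnegrE ?exprn_ge0//.
  by apply: le_trans i1; rewrite ler_weXn2l ?ler1n.
have bounded_mass r : exists K, \forall j \near \oo, fine (M j (cball 0 r)) <= K.
  exists (C * Num.max r 1 ^+ N); apply: nearW => j.
  apply: (@le_trans _ _ (fine (M j (cball 0 (Num.max r 1))))).
    rewrite !Mball ler_wpM2l//; apply: le_ball.
    by rewrite ler_wpM2l ?(ltW (exp2N_gt0 _))// le_max lexx.
  by apply: gM; rewrite le_max lexx orbT.
have [g [gi [nu [lfn cv]]]] := vague_compactness lfM bounded_mass.
have mono : {homo t : i j / (i < j)%N}.
  by apply: homo_ltn => //; exact: ltn_trans.
exists N, C, (t \o g), (M \o g), nu; split.
- by split=> [k|//|j]; [apply: mono; exact: gi|exact: lfM].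
- by move=> j B; exact: ME.
- split => [j|j|n j nt]; first exact: gM.
    apply: le_trans (inv_le (g j)) _; rewrite exprVn invrK mulrC ler_wpM2r ?exprn_ge0//.
    rewrite /C ler_wpDl ?exprn_ge0// -[X in X <= _]mul1r ler_wpM2r ?invr_ge0 ?(ltW b00)//.
    by rewrite lerDr.
  by have := tg (g j) _ (leq_subr n _); rewrite subKn.
- move=> u; exists u => // j /= uj; rewrite Mball -invfM -exprD mulrC ler_pdivlMr//.
  apply: tl; apply: leq_trans uj _; exact: sequence_ge_id.
- exact: cv.
Qed.
(** A ball of radius [M] in the blow-up lies in a dyadic ball around [x] that is larger
    by a fixed factor only; the growth bound makes that ball doubling, so the Lebesgue
    point property applies to it. *)
Lemma oscillation_vanishes m (x : E) (g : E -> R) N (t : nat -> nat)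
    (l : {measure set BE -> \bar R}) (L : nat -> {measure set BE -> \bar R}) :
  let b n := fine (m (dyball x n)) in
  (m setT < +oo)%E -> (forall n, 0 < b n) -> (forall k, (t k < t k.+1)%N) ->
  (forall n j, (n <= t j)%N -> b (t j - n)%N <= (2 ^+ n) ^+ N * b (t j)) ->
  (forall D e, 0 < e -> \forall n \near \oo,
    fine (m (cball x (3 * 2 ^- n))) <= D * fine (m (dyball x n)) ->
    \int[m]_(y in dyball x n) `|g y - g x| <= e * fine (m (dyball x n))) ->
  (forall A, measurable (A : set BE) -> l A = (\int[m]_(y in (A : set BE)) `|g y - g x|%:E)%E) ->
  lf_measure l ->
  (forall j B, L j B = ((b (t j))^-1%:E * l [set (x + 2 ^- t j *: y)%R | y in B])%E) ->
  forall M e, 0 < e -> \forall j \near \oo, fine (L j (cball 0 M)) <= e.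
Proof.
move=> b mfin b0 ti dbl leb lE lfl LE M e e0.
have [n Mn] : exists n : nat, M <= 2 ^+ n.
  have M1 : 1 <= Num.max M 1 by rewrite le_max lexx orbT.
  have [n /andP[_ h]] := pow2_between M1.
  by exists n.+1; apply: le_trans (ltW h); rewrite le_max lexx.
have Q0 : 0 < (2 ^+ n) ^+ N :> R by rewrite !exprn_gt0.
have e'0 : 0 < e / (2 ^+ n) ^+ N by rewrite divr_gt0.
have [K _ hK] := leb ((2 ^+ n.+2) ^+ N) _ e'0.
exists (K + n.+2)%N => // j /= Kj.
have tj : (K + n.+2 <= t j)%N by apply: leq_trans Kj _; exact: sequence_ge_id.
have nt : (n <= t j)%N by lia.
have ml (A : set E) : bounded_borel A -> l A \is a fin_num by exact: lf_measure_fin.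
have bD k : bounded_borel (dyball x k) by exact: bounded_borel_cball.
have bC u : bounded_borel (cball x u) by exact: bounded_borel_cball.
have mfn u : m (cball x u) \is a fin_num.
  by apply: finite_measure_fin => //; exact: measurable_cball.
rewrite LE image_cball ?exp2N_gt0// fineM ?ml//= mulrC ler_pdivrMr//.
apply: (@le_trans _ _ (fine (l (dyball x (t j - n))))).
  rewrite fine_le ?ml//; apply: le_measure; rewrite ?inE; [by case: (bC (2 ^- t j * M))
    |by case: (bD (t j - n)%N)|].
  by rewrite /dyball -exp2_mulN//; apply: le_cball; rewrite ler_wpM2l ?(ltW (exp2N_gt0 _)).
have -> : fine (l (dyball x (t j - n))) = \int[m]_(y in dyball x (t j - n)) `|g y - g x|.
  by rewrite lE//; case: (bD (t j - n)%N).
apply: le_trans (hK (t j - n)%N _ _) _.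
- by rewrite /=; lia.
- apply: (@le_trans _ _ (b (t j - n.+2)%N)).
    rewrite /b /dyball fine_le//; apply: le_measure; rewrite ?inE; [exact: measurable_cball..|].
    apply: le_cball; rewrite -!exp2_mulN; [|lia..].
    rewrite mulrCA ler_wpM2l ?(ltW (exp2N_gt0 _))//.
    rewrite !exprS mulrA ler_wpM2r ?exprn_ge0//; lra.
  apply: le_trans (dbl _ _ _) _; first by lia.
  rewrite ler_wpM2l ?exprn_ge0// /b /dyball fine_le//.
  apply: le_measure; rewrite ?inE; [exact: measurable_cball..|].
  by apply: le_cball; apply: exp2N_le; exact: leq_subr.
- apply: le_trans (ler_wpM2l (ltW e'0) (dbl _ _ nt)) _.
  by rewrite mulrA divfK// gt_eqF.
Qed.

Lemma integral_eq_local p m (A : set E) (f : E -> R) : measurable (A : set BE) ->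
  (forall y, ~ A y -> f y = 0) ->
  (forall B, measurable (B : set BE) -> B `<=` A -> p B = m B) ->
  \int[p]_y f y = \int[m]_y f y.
Proof.
move=> mA fA pm; congr fine.
have loc (q : {measure set BE -> \bar R}) :
    (\int[q]_y (f y)%:E = \int[q]_(y in (A : set BE)) (f y)%:E)%E.
  rewrite [RHS]integral_mkcond; apply: eq_integral => y _; rewrite patchE.
  by case: ifPn => //; rewrite notin_setE => /fA ->.
by rewrite !loc; exact: eq_measure_integral.
Qed.

(** Near [x] the measure [p] differs from [g x] times [m] by at most the oscillation of
    [g], which disappears in the limit. *)
Lemma density_blowup m p q (W : set E) (x : E) (g : E -> R) N C (t : nat -> nat)
    (M P : nat -> {measure set BE -> \bar R}) (nu : {measure set BE -> \bar R})
    (phi : nat -> E -> R) (f : E -> R) :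
  let b n := fine (m (dyball x n)) in
  (m setT < +oo)%E -> (forall n, 0 < b n) -> (forall k, (t k < t k.+1)%N) ->
  (forall n j, (n <= t j)%N -> b (t j - n)%N <= (2 ^+ n) ^+ N * b (t j)) ->
  (forall j, lf_measure (M j)) -> lf_measure nu -> (forall j, growth C N (M j)) ->
  (forall j B, M j B = ((b (t j))^-1%:E * m [set (x + 2 ^- t j *: y)%R | y in B])%E) ->
  (forall h : E -> R, Cc h -> (fun j => \int[M j]_y h y) @ \oo --> \int[nu]_y h y) ->
  cball x 1 `<=` W -> (forall B, q B = p (B `&` W)) ->
  (forall B, measurable (B : set BE) -> (q B <= m B)%E) ->
  (forall y, 0 <= g y) -> m.-integrable [set: BE] (EFin \o (g : BE -> R)) ->
  (forall A, measurable (A : set BE) -> q A = (\int[m]_(y in (A : set BE)) (g y)%:E)%E) ->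
  (forall D e, 0 < e -> \forall n \near \oo,
    fine (m (cball x (3 * 2 ^- n))) <= D * fine (m (dyball x n)) ->
    \int[m]_(y in dyball x n) `|g y - g x| <= e * fine (m (dyball x n))) ->
  (forall j B, P j B = ((b (t j))^-1%:E * p [set (x + 2 ^- t j *: y)%R | y in B])%E) ->
  approximates N (fun j => 2 ^- t j) phi f ->
  (fun j => \int[P j]_y phi j y) @ \oo --> g x * \int[nu]_y f y.
Proof.
move=> b mfin b0 ti dbl lfM lfn gM ME cv xW qE qm g0 gi qg leb PE [cf cphi loc dec conv].
have [l [lE h1 h2]] := @density_oscillation R d q m g x mfin g0 gi qg.
have lfm := finite_lf mfin.
have lfq : lf_measure q by exact: lf_le lfm qm.
have lfl : lf_measure l.
  apply: finite_lf; rewrite lE//.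
  have fint : m.-integrable [set: BE] (EFin \o (fun y : BE => g y - g x)).
    have ic : m.-integrable [set: BE] (EFin \o (fun _ : BE => g x)).
      apply: measurable_bounded_integrable => //.
      exists `|g x|; split; first exact: num_real.
      by move=> K hK y _; exact: ltW.
    by apply: eq_integrable (integrableB measurableT gi ic).
  by case/integrableP : fint.
have ci j : 0 <= (b (t j))^-1 by rewrite invr_ge0 ltW.
have [Q hQ] := choice (fun j => dilated_measure x lfq (exp2N_gt0 (t j)) (ci j)).
have [L hL] := choice (fun j => dilated_measure x lfl (exp2N_gt0 (t j)) (ci j)).
have QE j B : Q j B = ((b (t j))^-1%:E * q [set (x + 2 ^- t j *: y)%R | y in B])%E.
  by case: (hQ j).
have LE j B : L j B = ((b (t j))^-1%:E * l [set (x + 2 ^- t j *: y)%R | y in B])%E.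
  by case: (hL j).
have mI j (B : set E) : measurable (B : set BE) ->
    measurable ([set (x + 2 ^- t j *: y)%R | y in B] : set BE).
  move=> mB; rewrite rescale_image ?exp2N_gt0// -[X in measurable X]setTI.
  exact: rescale_measurable.
have c0 j : (0 <= (b (t j))^-1%:E)%E by rewrite lee_fin.
have lim : (fun j => \int[Q j]_y phi j y) @ \oo --> g x * \int[nu]_y f y.
  have [A A0 [fA phiA]] := dec.
  apply: (@density_limit R d M Q L nu (g x) C A N phi f) => //.
  - by move=> j; case: (hL j).
  - by move=> j B mB; rewrite QE ME; apply: lee_wpmul2l => //; apply: qm; exact: mI.
  - move=> j B mB; rewrite QE ME LE muleCA -ge0_muleDr ?mule_ge0// ?lee_fin//.
    by apply: lee_wpmul2l => //; apply: h1; exact: mI.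
  - move=> j B mB; rewrite QE ME LE muleCA -ge0_muleDr//.
    by apply: lee_wpmul2l => //; apply: h2; exact: mI.
  - exact: (oscillation_vanishes mfin b0 ti dbl leb lE lfl LE).
  - by move=> j; case: (cphi j).
apply: cvg_trans lim; apply: near_eq_cvg; apply: filterS loc => j hj.
apply/esym; apply: (@integral_eq_local _ _ (cball 0 (2 ^- t j)^-1)).
- exact: measurable_cball.
- by move=> y; rewrite /cball /= subr0 => /negP; rewrite -ltNge; exact: hj.
- move=> B mB BA; rewrite PE QE qE; congr (_ * p _)%E; apply/esym/setIidPl.
  move=> _ [y /BA By <-]; apply: xW; move: By; rewrite /cball /= subr0 => By.
  rewrite addrC addKr normrZ (gtr0_norm (exp2N_gt0 _)).
  by rewrite mulrC -ler_pdivlMr ?exp2N_gt0// mul1r.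
Qed.

End BlowupSequence.

(** * The local dimension of the limit *)

Section LocalDimension.
Context {R : realType} {d : nat}.
Local Notation E := 'rV[R]_d.
Local Notation BE := (borelRd R d).

Lemma measurable_eball (r : R) : 0 <= r -> measurable (eball (0 : E) r : set BE).
Proof.
move=> r0; pose q (x : E) := \sum_i x 0 i ^+ 2.
have sq : smooth q.
  apply: smooth_sum => i; apply: smooth_mul; apply/smoothP => k; exact: Ck_coord.
have -> : eball (0 : E) r = q @^-1` [set t | t <= r ^+ 2].
  have q0 x : 0 <= q x by apply: sumr_ge0 => i _; exact: sqr_ge0.
  apply/seteqP; split => x; rewrite /eball /= subr0 => h.
    by rewrite -(sqr_sqrtr (q0 x)); apply: lerXn2r; rewrite ?nnegrE ?enorm_ge0.
  by rewrite -(ger0_norm r0) -sqrtr_sqr ler_wsqrtr.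
apply: closed_borel; apply: closed_comp; last exact: closed_le.
by move=> x _; exact: smooth_continuous.
Qed.

(** Constant factors in the radius do not affect the limit of the ratio of logarithms. *)
Lemma local_dimH_le (nu : {measure set BE -> \bar R}) (beta : R) : lf_measure nu ->
  (forall u, (2 ^- u) `^ beta <= fine (nu (cball 0 (2 * 2 ^- u)))) ->
  (local_dimH nu 0 <= beta%:E)%E.
Proof.
move=> lf mass; rewrite /local_dimH limf_einfE; apply: ge_ereal_sup => _ [V FV <-].
have [e /= e0 hV] : exists2 e : R, 0 < e & forall r, 0 < r -> r < e -> V r.
  move: FV => [e /= e0 hV]; exists e => // r r0 re; apply: hV => //=.
  by rewrite /ball/= sub0r normrN gtr0_norm.
apply/lee_addgt0Pr => delta d0.
(* A Euclidean ball of radius [kap * 2 ^- u] contains the ball of radius [2 * 2 ^- u]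
   of the maximum norm. *)
pose kap : R := 2 * (d%:R + 1).
have k0 : 0 < kap by rewrite mulr_gt0// ltr_wpDl.
pose e1 := Num.min (Num.min (e / kap) (1 / kap)) (expR (- ((beta + delta) * ln kap / delta))).
have e10 : 0 < e1 by rewrite !lt_min !divr_gt0// expR_gt0.
have [u] := exp2N_lt e10; rewrite !lt_min => /andP[/andP[u1 u2] u3].
have z0 := exp2N_gt0 u : 0 < 2 ^- u :> R.
pose r := kap * 2 ^- u.
have r0 : 0 < r by rewrite mulr_gt0.
have re : r < e by rewrite /r mulrC -ltr_pdivlMr.
have r1 : r < 1 by rewrite /r mulrC -ltr_pdivlMr.
apply: le_trans (ereal_inf_lbound _) _; first by exists r => //; exact: hV.
rewrite -EFinD lee_fin.
have lr : ln r < 0 by rewrite ln_lt0// r0.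
rewrite ler_ndivrMr//.
have sub : cball 0 (2 * 2 ^- u) `<=` eball (0 : E) r.
  move=> y; rewrite /cball /eball /= !subr0 => yu; apply: le_trans (enorm_le_norm y) _.
  rewrite /r /kap mulrAC mulrC; apply: ler_pM => //.
  by rewrite lerDl.
have mE := measurable_eball (ltW r0).
have bE : bounded_borel (eball (0 : E) r).
  split => //; apply/bounded_cball; exists r => y; rewrite /eball /cball /=.
  exact: le_trans (norm_le_enorm _).
have le1 : (2 ^- u) `^ beta <= fine (nu (eball 0 r)).
  apply: le_trans (mass u) _; rewrite fine_le ?lf_measure_fin//.
    exact: bounded_borel_cball.
  by apply: le_measure; rewrite ?inE//; exact: measurable_cball.
have p0 : 0 < (2 ^- u) `^ beta :> R by rewrite powR_gt0.
apply: (@le_trans _ _ (ln ((2 ^- u) `^ beta))); last first.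
  by rewrite ler_ln// posrE// (lt_le_trans p0).
rewrite ln_powR /r lnM ?posrE//.
have h3 : ln (2 ^- u) <= - ((beta + delta) * ln kap / delta).
  by rewrite -[leRHS]expRK ler_ln ?posrE ?expR_gt0// ltW.
have h4 : delta * ln (2 ^- u) <= - ((beta + delta) * ln kap).
  have := ler_wpM2l (ltW d0) h3.
  by rewrite mulrN mulrCA mulfV ?mulr1// gt_eqF.
lra.
Qed.

End LocalDimension.

(** * Existence of tangent charges of the form a (x) nu *)

Section Assembly.
Context {R : realType}.

Lemma negligible_fin d (m : {measure set (borelRd R d) -> \bar R}) (I : finType)
    (Z : I -> set 'rV[R]_d) : (forall i, m.-negligible (Z i)) ->
  m.-negligible (\bigcup_i Z i).
Proof.
move=> nZ.
apply: (@negligibleS _ (borelRd R d) R m (\bigcup_n (if unpickle n is Some i then Z i else set0))).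
  by move=> x [i _ Zx]; exists (pickle i) => //; rewrite pickleK.
apply: negligible_bigcup => n; case: unpickle => [i|]; [exact: nZ|exact: negligible_set0].
Qed.

Lemma dyadic_scales (t : nat -> nat) : (forall k, (t k < t k.+1)%N) ->
  decreasing_seq (fun j => 2 ^- t j : R) /\ (fun j => 2 ^- t j) @ \oo --> (0 : R).
Proof.
move=> ti; split.
  apply/decreasing_seqP => n; rewrite ltf_pV2 ?posrE ?exprn_gt0//.
  by rewrite ltr_eXn2l ?ltr1n.
apply/cvgrPdist_lt => e e0; have [n hn] := exp2N_lt e0.
exists n => // j /= nj; rewrite sub0r normrN gtr0_norm ?exp2N_gt0//.
apply: le_lt_trans hn; apply: exp2N_le; apply: leq_trans nj _; exact: sequence_ge_id.
Qed.

End Assembly.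

Theorem theorem1p2 (R : realType) (d l : nat) (mu : set 'rV[R]_d -> 'rV[R[i]]_l)
    (eps : R) (mu_charge : lf_charge mu) (mu_neq0 : charge_neq0 mu)
    (eps_gt0 : 0 < eps) :
  exists (x : 'rV[R]_d) (a : 'rV[R[i]]_l)
         (nu : {measure set (borelRd R d) -> \bar R}),
    supp (tvar mu) x /\
    a <> 0 /\
    lf_measure nu /\
    (exists2 B : set (borelRd R d), measurable B & nu B <> 0%E) /\
    Tan mu x (tensor a nu) /\
    (supp nu 0 /\ (local_dimH nu 0 <= dimH mu + eps%:E)%E) /\
    tempered_measure nu /\
    (tempered mu ->
      exists c r : nat -> R, blowup_seqs c r /\
        cvg_tempered (blowup mu x c r) (tensor a nu)).
Proof.
have [F [s [alpha [beta [bF muF hF [s0 sa ab bD]]]]]] := charged_null_set mu_neq0 eps_gt0.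
pose I := ('I_l * bool * bool)%type.
pose sg (i : I) : set 'rV[R]_d -> R :=
  if i.2 then (fun B => - component mu i.1.1 i.1.2 B) else component mu i.1.1 i.1.2.
have rc (i : I) : real_charge (sg i).
  rewrite /sg; case: i.2; last exact: lf_charge_component.
  by apply: real_chargeN; exact: lf_charge_component.
have [p hp] := choice (fun i => upvar_measure (rc i)).
have pE i : (p i : set (borelRd R d) -> \bar R) = upvar (sg i) by case: (hp i).
have lfp i : lf_measure (p i) by case: (hp i).
have jordan k b B : bounded_borel B ->
    component mu k b B = fine (p (k, b, false) B) - fine (p (k, b, true) B).
  move=> bB; have := upvar_jordan (rc (k, b, false)) bB.
  rewrite -(pE (k, b, false)) -[upvar (fun _ => _)]/(upvar (sg (k, b, true))) -(pE (k, b, true)).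
  rewrite -(fineK (lf_measure_fin (lfp _) bB)) -(fineK (lf_measure_fin (lfp (k, b, true)) bB)).
  by rewrite -EFinD => -[->]; rewrite addrK.
have [m0 [lfm0 pm0 m00]] := dominating_measure lfp.
have [mF /bounded_cball[K FK]] := bF.
(* The window contains the unit ball around every point of [F]. *)
pose W : set 'rV[R]_d := cball 0 (K + 1).
have mW : measurable (W : set (borelRd R d)) by exact: measurable_cball.
have [m mE] := restricted_measure m0 mW.
have [q qE] := choice (fun i => restricted_measure (p i) mW).
have mfin : (m setT < +oo)%E.
  by rewrite mE setTI; apply: lfm0; exact: bounded_borel_cball.
have qm i B : (q i B <= m B)%E by rewrite qE mE; exact: pm0.
have [g hg] := choice (fun i => density_of_dominated mfin (fun B _ => qm i B)).
have g0 i y : 0 <= g i y by case: (hg i).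
have gi i : m.-integrable [set: borelRd R d] (EFin \o (g i : borelRd R d -> R)) by case: (hg i).
have gE i A : measurable (A : set (borelRd R d)) ->
    q i A = (\int[m]_(y in (A : set (borelRd R d))) (g i y)%:E)%E by case: (hg i) => _ _; exact.
have [Z hZ] := choice (fun i => doubling_lebesgue_point mfin (gi i)).
have a0 : 0 < alpha by exact: le_lt_trans sa.
have nZ0 := mass_distribution m (introT andP (conj s0 (ltW sa))) a0 hF.
have nZ := negligible_fin (fun i => (hZ i).1).
have nZZ := negligibleU nZ0 nZ.
have [k0 [b0 sF]] := component_neq0 muF.
have FW : F `&` W = F.
  apply/setIidPl => y /FK; apply: le_cball; by rewrite lerDl.
have diff : (\int[m]_(y in (F : set (borelRd R d))) (g (k0, b0, false) y)%:E)%E <>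
    (\int[m]_(y in (F : set (borelRd R d))) (g (k0, b0, true) y)%:E)%E.
  rewrite -!gE// !qE FW => h; move: sF; rewrite jordan// h subrr.
  by rewrite eqxx.
have [x [Fx Zx gx]] := density_differ mF nZZ (gi _) (gi _) diff.
have xW : cball x 1 `<=` W.
  have := FK _ Fx; rewrite /cball /= subr0 => xK.
  by apply: sub_cball; rewrite subr0 lerD2r.
have leb i D e : 0 < e -> \forall n \near \oo,
    fine (m (cball x (3 * 2 ^- n))) <= D * fine (m (dyball x n)) ->
    \int[m]_(y in dyball x n) `|g i y - g i x| <= e * fine (m (dyball x n)).
  by move=> e0; apply: (hZ i).2 => // Zix; apply: Zx; right; exists i.
have mD n : measurable (dyball x n : set (borelRd R d)) by exact: measurable_cball.
have mDf n : m (dyball x n) \is a fin_num by exact: finite_measure_fin.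
have io n : exists2 k, (n <= k)%N & (2 ^- k) `^ alpha <= fine (m (dyball x k)).
  apply: contrapT => h; apply: Zx; left; split => //; exists n => k nk.
  rewrite -(fineK (mDf k)) lte_fin ltNge; apply/negP => hk; apply: h; by exists k.
have bpos n : 0 < fine (m (dyball x n)).
  have [k nk hk] := io n; apply: (@lt_le_trans _ _ ((2 ^- k) `^ alpha)).
    by rewrite powR_gt0// exp2N_gt0.
  apply: le_trans hk _; rewrite fine_le//; apply: le_measure; rewrite ?inE//.
  by apply: le_cball; exact: exp2N_le.
have [N [C [t [M [nu [[ti lfn lfM] ME [gM cC dbl] mass cv]]]]]] :=
  blowup_sequence mfin a0 ab bpos io.
pose c j : R := (fine (m (dyball x (t j))))^-1.
pose r j : R := 2 ^- t j.
have c0 j : 0 < c j by rewrite invr_gt0.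
have r0 j : 0 < r j by exact: exp2N_gt0.
have [rdec rlim] := @dyadic_scales R t ti.
have bs : blowup_seqs c r by split.
pose a : 'rV[R[i]]_l := \row_k
  Complex (g (k, false, false) x - g (k, false, true) x)
          (g (k, true, false) x - g (k, true, true) x).
have aE k b : cpart b (a 0 k) = g (k, b, false) x - g (k, b, true) x.
  by rewrite mxE; case: b.
have an0 : a <> 0.
  move=> az; move: gx; rewrite -subr_eq0 -aE az mxE.
  by rewrite (_ : cpart b0 0 = 0 :> R) ?eqxx//; case: b0 {sF diff}.
(* Only the two upper variations of one component enter, each with its own density. *)
have lim : component_limit N mu x c r a nu.
  move=> phi f ap k b.
  have [P hP] := choice (fun j => dilated_measure x (lfp (k, b, false)) (r0 j) (ltW (c0 j))).
  have [Q hQ] := choice (fun j => dilated_measure x (lfp (k, b, true)) (r0 j) (ltW (c0 j))).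
  have PE j B : P j B = ((c j)%:E * p (k, b, false) [set (x + r j *: y)%R | y in B])%E.
    by case: (hP j).
  have QE j B : Q j B = ((c j)%:E * p (k, b, true) [set (x + r j *: y)%R | y in B])%E.
    by case: (hQ j).
  have limi i (P' : nat -> {measure set (borelRd R d) -> \bar R}) :
      (forall j B, P' j B = ((c j)%:E * p i [set (x + r j *: y)%R | y in B])%E) ->
      (fun j => \int[P' j]_y phi j y) @ \oo --> g i x * \int[nu]_y f y.
    move=> P'E.
    exact: (density_blowup mfin bpos ti dbl lfM lfn gM ME cv xW (qE i) (fun B _ => qm i B)
      (g0 i) (gi i) (gE i) (leb i) P'E ap).
  rewrite aE mulrBl.
  have -> : (fun j => rint (phi j) (component (blowup mu x c r j) k b)) =
      (fun j => \int[P j]_y phi j y - \int[Q j]_y phi j y).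
    apply/funext => j; apply: rint_diff.
    - by case: (hP j).
    - by case: (hQ j).
    - move=> B bB; have bB' := bounded_borel_rescale x (r0 j) bB.
      rewrite component_blowup PE QE !fineM ?lf_measure_fin//=.
      by rewrite -mulrBr -jordan.
    - by case: ap => _ h _ _ _; exact: h.
  by apply: cvgB; apply: limi.
have gn : growth (C * 2 ^+ N) N nu by exact: growth_limit gM cv.
have nu_ball u : (2 ^- u) `^ beta <= fine (nu (cball 0 (2 * 2 ^- u))).
  exact: (mass_limit (exp2N_gt0 u) lfM lfn cv (mass u)).
have nu_pos u : 0 < fine (nu (cball 0 (2 * 2 ^- u))).
  by apply: lt_le_trans (nu_ball u); rewrite powR_gt0// exp2N_gt0.
exists x, a, nu; split; [|split; [|split; [|split; [|split; [|split; [|split]]]]]] => //.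
- move=> U oU Ux.
  have [u hu] : exists u, dyball x u `<=` U.
    have /nbhs_ballP[e /= e0 he] : nbhs x U by exact: open_nbhs_nbhs.
    have [u hu] := exp2N_lt e0; exists u => y; rewrite /dyball /cball /= => yx.
    by apply: he; rewrite -ball_normE /= distrC (le_lt_trans yx).
  have mU : measurable (U : set (borelRd R d)) by exact: open_borel.
  have m0U : m0 U <> 0%E.
    move=> h; have := bpos u; rewrite mE.
    have : (m0 (dyball x u `&` W) <= 0)%E.
      rewrite -h; apply: le_measure; rewrite ?inE//; first exact: (@measurableI _ (borelRd R d)).
      by move=> y [/hu].
    by rewrite measure_le0 => /eqP ->; rewrite ltxx.
  have [i pU] : exists i, p i U <> 0%E.
    by apply: contrapT => h; apply: m0U; apply: m00 => i; apply: contrapT => hi; apply: h; exists i.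
  have : (0 < upvar (sg i) U)%E by rewrite -pE lt0e measure_ge0 andbT; exact/eqP.
  move=> /ereal_sup_gt[_ [B [bB BU] <-]]; rewrite lte_fin => sB.
  apply: lt_le_trans (tvar_ge mu bB BU); rewrite lte_fin.
  apply: lt_le_trans sB (le_trans _ (comp_le_cnorm i.1.2 (mu B) i.1.1)).
  by rewrite /sg; case: i.2; [rewrite -normrN|]; exact: ler_norm.
- exists (cball 0 (2 * 2 ^- 0%N)); first exact: measurable_cball.
  by move=> h; have := nu_pos 0%N; rewrite h ltxx.
- apply: (Tan_of_limit bs lfn _ lim).
  exists (cball 0 (2 * 2 ^- 0%N)); split; first exact: bounded_borel_cball.
  move=> /eqP; rewrite /tensor scaler_eq0 => /orP[|/eqP//].
  by rewrite fmorph_eq0 => /eqP h; have := nu_pos 0%N; rewrite h ltxx.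
- split.
    move=> U oU U0.
    have [u hu] : exists u, cball 0 (2 * 2 ^- u) `<=` U.
      have /nbhs_ballP[e /= e0 he] : nbhs (0 : 'rV[R]_d) U by exact: open_nbhs_nbhs.
      have [u hu] := exp2N_lt (divr_gt0 e0 (ltr0n R 2)).
      exists u => y; rewrite /cball /= subr0 => yx.
      apply: he; rewrite -ball_normE /= sub0r normrN (le_lt_trans yx)//.
      by rewrite mulrC -ltr_pdivlMr.
    apply: (@lt_le_trans _ _ (nu (cball 0 (2 * 2 ^- u)))).
      rewrite lt0e measure_ge0 andbT; apply/eqP => h.
      by have := nu_pos u; rewrite h ltxx.
    apply: le_measure; rewrite ?inE//; [exact: measurable_cball|exact: open_borel].
  exact: le_trans (local_dimH_le lfn nu_ball) bD.
- by exists (fun f => cintegral nu f *: const_mx 1); exact: measure_distribution lfn gn.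
- move=> tmu; exists c, r; split => //.
  apply: (cvg_tempered_of_limit mu_charge bs _ cC lfn gn lim tmu) => j.
  by rewrite /r invf_le1 ?exprn_gt0// exprn_ege1// ler1n.
Qed.
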